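(* Let $P\in\mathcal G_N$. Then the map $$\pi_P:\mathcal U\longrightarrow\mathcal G_N,\qquad \pi_P(U)=UPU^{-1},$$ is a real analytic submersion, and induces on $\mathcal G_N$ the structure of a real analytic homogeneous space of the Banach-Lie group $\mathcal U$. Furthermore, $\mathcal G_N$ is a real analytic submanifold of $\mathcal B(\mathbf H^1)$.
   Context: $L^2=L^2(\mathbb R^3)$ is the complex Hilbert space with inner product $\langle\phi,\psi\rangle_{L^2}=\int\phi\,\overline{\psi}\,dx$. $\mathbf H^1=\mathbf H^1(\mathbb R^3)$ is the Sobolev space of order one, a complex Hilbert space with inner product $\langle\phi,\psi\rangle_{\mathbf H^1}=\langle\phi,\psi\rangle_{L^2}+\sum_{i=1}^3\langle\partial_i\phi,\partial_i\psi\rangle_{L^2}$. $\mathcal B(\mathbf H^1)$ is the algebra of bounded linear operators on $\mathbf H^1$ with the operator norm, and $Gl(\mathbf H^1)$ is its group of invertible elements. $\mathcal U:=\{U\in Gl(\mathbf H^1):\|U\phi\|_{L^2}=\|\phi\|_{L^2}\ \forall\phi\in\mathbf H^1\}$. It is a real Banach-Lie group in the norm topology of $\mathcal B(\mathbf H^1)$, with Lie algebra $\mathfrak u=\{X\in\mathcal B(\mathbf H^1):\langle X\phi,\psi\rangle_{L^2}=-\langle\phi,X\psi\rangle_{L^2}\ \forall\phi,\psi\in\mathbf H^1\}$, exponential map $X\mapsto e^X$, and real analytic inclusion $\mathcal U\hookrightarrow Gl(\mathbf H^1)$ whose derivative at the identity is the inclusion $\mathfrak u\hookrightarrow\mathcal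 B(\mathbf H^1)$. Fix $N\in\mathbb N$. The Grassmann manifold $\mathcal G_N$ (projection presentation) is the set of rank $N$ operators $P\in\mathcal B(\mathbf H^1)$ with $P^2=P$ and $\langle P\xi,\eta\rangle_{L^2}=\langle\xi,P\eta\rangle_{L^2}$ for all $\xi,\eta\in\mathbf H^1$, with the topology inherited from $\mathcal B(\mathbf H^1)$. The group $\mathcal U$ acts transitively on $\mathcal G_N$ by $U\cdot P=UPU^{-1}$. Conventions: submanifolds of a Banach space (regarded as a real Banach space) have closed complemented tangent spaces and carry the relative topology; a submersion has at each point a surjective differential with closed complemented kernel. A real analytic homogeneous space of $\mathcal U$ is a real analytic manifold with a transitive real analytic action of $\mathcal U$ whose orbit maps are submersions. *)

(* Defs.v *)
From HB Require Import structures.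
From mathcomp Require Import all_boot all_order all_algebra complex.
From mathcomp Require Import all_classical all_reals all_analysis.
From mathcomp Require Import measurable_realfun ring lra.

Set Implicit Arguments.
Unset Strict Implicit.
Unset Printing Implicit Defensive.
Import Order.TTheory GRing.Theory Num.Theory.
Import numFieldNormedType.Exports.
Local Open Scope classical_set_scope.
Local Open Scope ring_scope.
Local Open Scope quotient_scope.

Section L2.
Variable R : realType.

(* [measurableTypeR R] is [R] with its Borel sigma-algebra; [R3] also inherits the
   normed space structure of [R * R * R], used below for directional derivatives. *)
Definition R3 := (measurableTypeR R * measurableTypeR R * measurableTypeR R)%type.

Definition vol : {measure set R3 -> \bar R} :=
  ((@lebesgue_measure R \x @lebesgue_measure R) \x @lebesgue_measure R)%E.

Definition re_part (f : R3 -> R[i]) : R3 -> R := fun x => complex.Re (f x).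
Definition im_part (f : R3 -> R[i]) : R3 -> R := fun x => complex.Im (f x).

Definition cintegral (f : R3 -> R[i]) : R[i] :=
  ((\int[vol]_x re_part f x) +i* (\int[vol]_x im_part f x))%C.

Definition L2fun : {pred R3 -> R[i]} :=
  [pred f | (re_part f \in Lfun vol 2%:E) && (im_part f \in Lfun vol 2%:E)].

Lemma le12 : (1%:E <= 2%:E :> \bar R)%E. Proof. by rewrite lee_fin ler1n. Qed.

Lemma Lfun2_lin (a b : R) (f g : R3 -> R) :
  f \in Lfun vol 2%:E -> g \in Lfun vol 2%:E ->
  (fun x => a * f x + b * g x) \in Lfun vol 2%:E.
Proof.
move=> fL gL; have [_ H] := Lfun_submod_closed vol le12.
have -> : (fun x => a * f x + b * g x) =
  a *: (f : R3 -> R) + (b *: (g : R3 -> R) + 0) by rewrite addr0.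
by apply: (H) => //; apply: (H) => //; have [] := Lfun_submod_closed vol le12.
Qed.

Lemma L2fun_submod_closed : submod_closed L2fun.
Proof.
have L0 : (fun=> 0) \in Lfun vol (2%:E : \bar R).
  by have [] := Lfun_submod_closed vol le12.
split; first by rewrite !inE; apply/andP; split.
move=> c f g; rewrite !inE => /andP[fr fi] /andP[gr gi].
have E1 : re_part (c *: f + g) = fun x => 1 * (complex.Re c * re_part f x +
    (- complex.Im c) * im_part f x) + 1 * re_part g x.
  apply/funext => x; rewrite /re_part /im_part.
  have -> : (c *: f + g) x = c * f x + g x by [].
  by case: (c) (f x) (g x) => [a b] [a1 b1] [a2 b2] /=; rewrite !mul1r mulNr.
have E2 : im_part (c *: f + g) = fun x => 1 * (complex.Re c * im_part f x +
    complex.Im c * re_part f x) + 1 * im_part g x.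
  apply/funext => x; rewrite /re_part /im_part.
  have -> : (c *: f + g) x = c * f x + g x by [].
  by case: (c) (f x) (g x) => [a b] [a1 b1] [a2 b2] /=; rewrite !mul1r.
by rewrite E1 E2; apply/andP; split; apply: Lfun2_lin => //; apply: Lfun2_lin.
Qed.

HB.instance Definition _ :=
  GRing.isSubmodClosed.Build R[i] (R3 -> R[i]) L2fun L2fun_submod_closed.

Record sqint := Sqint { sqint_fun :> R3 -> R[i]; _ : sqint_fun \in L2fun }.
HB.instance Definition _ := [isSub for sqint_fun].
HB.instance Definition _ := [Choice of sqint by <:].
HB.instance Definition _ := [SubChoice_isSubLmodule of sqint by <:].

Definition sqint_ae (f g : sqint) := `[< {ae vol, forall x, f x = g x} >].

Lemma sqint_ae_refl : reflexive sqint_ae.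
Proof. by move=> f; apply/asboolP/nearW. Qed.

Lemma sqint_ae_sym : symmetric sqint_ae.
Proof.
by move=> f g; apply/idP/idP => /asboolP H; apply/asboolP; move: H; apply: filterS.
Qed.

Lemma sqint_ae_trans : transitive sqint_ae.
Proof.
move=> g f h /asboolP fg /asboolP gh; apply/asboolP.
by move: gh; apply: filterS2 fg => x -> ->.
Qed.

Canonical sqint_ae_equiv :=
  EquivRel sqint_ae sqint_ae_refl sqint_ae_sym sqint_ae_trans.

Definition L2 : Type := {eq_quot sqint_ae}.
HB.instance Definition _ := Choice.on L2.
HB.instance Definition _ := EqQuotient.on L2.

Lemma L2W (P : L2 -> Prop) : (forall f, P (\pi_L2 f)) -> forall x, P x.
Proof. by move=> H x; rewrite -[x]reprK. Qed.

Lemma L2P (f g : sqint) : \pi_L2 f = \pi_L2 g <-> {ae vol, forall x, f x = g x}.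
Proof.
split=> [/eqP|H]; first by rewrite eqmodE /= => /asboolP.
by apply/eqP; rewrite eqmodE; apply/asboolP.
Qed.

Lemma repr_ae (f : sqint) : {ae vol, forall x, repr (\pi_L2 f) x = f x}.
Proof. by apply/L2P; rewrite reprK. Qed.

(* The operations of the quotient are computed on the representatives [repr]. *)
Definition L2zero : L2 := \pi_L2 0.
Definition L2opp (f : L2) : L2 := \pi_L2 (- repr f).
Definition L2add (f g : L2) : L2 := \pi_L2 (repr f + repr g).
Definition L2scale (c : R[i]) (f : L2) : L2 := \pi_L2 (c *: repr f).

Lemma pi_opp f : L2opp (\pi_L2 f) = \pi_L2 (- f).
Proof.
apply/L2P; apply: filterS (repr_ae f) => x E.
by rewrite -[LHS]/(- repr (\pi_L2 f) x) E.
Qed.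
Lemma pi_add f g : L2add (\pi_L2 f) (\pi_L2 g) = \pi_L2 (f + g).
Proof.
apply/L2P; move: (repr_ae g); apply: filterS2 (repr_ae f) => x E E'.
by rewrite -[LHS]/(repr (\pi_L2 f) x + repr (\pi_L2 g) x) E E'.
Qed.
Lemma pi_scale c f : L2scale c (\pi_L2 f) = \pi_L2 (c *: f).
Proof.
apply/L2P; apply: filterS (repr_ae f) => x E.
by rewrite -[LHS]/(c * repr (\pi_L2 f) x) E.
Qed.

Lemma L2addA : associative L2add.
Proof. move=> f g h; elim/L2W: f => f; elim/L2W: g => g; elim/L2W: h => h.
by rewrite !pi_add addrA. Qed.
Lemma L2addC : commutative L2add.
Proof. move=> f g; elim/L2W: f => f; elim/L2W: g => g.
by rewrite !pi_add addrC. Qed.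
Lemma L2add0 : left_id L2zero L2add.
Proof. by move=> f; elim/L2W: f => f; rewrite !pi_add add0r. Qed.
Lemma L2addN : left_inverse L2zero L2opp L2add.
Proof. by move=> f; elim/L2W: f => f; rewrite pi_opp !pi_add addNr. Qed.
HB.instance Definition _ :=
  GRing.isZmodule.Build L2 L2addA L2addC L2add0 L2addN.

Lemma L2scaleA a b (f : L2) : L2scale a (L2scale b f) = L2scale (a * b) f.
Proof. by elim/L2W: f => f; rewrite !pi_scale scalerA. Qed.
Lemma L2scale1 : left_id 1 L2scale.
Proof. by move=> f; elim/L2W: f => f; rewrite pi_scale scale1r. Qed.
Lemma L2scaleDr : right_distributive L2scale +%R.
Proof.
move=> a f g; elim/L2W: f => f; elim/L2W: g => g.
by rewrite -[_ + _]/(L2add _ _) -[RHS]/(L2add _ _) !(pi_add, pi_scale) scalerDr.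
Qed.
Lemma L2scaleDl f : {morph L2scale^~ f : a b / a + b}.
Proof.
move=> a b; elim/L2W: f => f.
by rewrite -[RHS]/(L2add _ _) !(pi_add, pi_scale) scalerDl.
Qed.
HB.instance Definition _ :=
  GRing.Zmodule_isLmodule.Build R[i] L2 L2scaleA L2scale1 L2scaleDr L2scaleDl.

(* Linear in the first argument, antilinear in the second one. *)
Definition ip_L2 (f g : L2) : R[i] :=
  cintegral (fun x => repr f x * ((repr g x)^*)%C).

End L2.

Section TestFunctions.
Variable R : realType.
Implicit Types phi : R3 R -> R.

Definition basis_vec (i : 'I_3) : R3 R :=
  ((i == 0 :> nat)%:R, (i == 1 :> nat)%:R, (i == 2 :> nat)%:R).

Fixpoint C_k (k : nat) (phi : R3 R -> R) : Prop :=
  match k with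
  | 0 => continuous phi
  | k'.+1 => continuous phi /\ forall i : 'I_3,
      (forall x, derivable phi x (basis_vec i)) /\
      C_k k' (fun x => 'D_(basis_vec i) phi x)
  end.

(* Real-valued test functions suffice in the definition of weak derivatives of
   complex-valued functions, the pairing being linear in the test function. *)
Definition test_function (phi : R3 R -> R) : Prop :=
  (forall k, C_k k phi) /\ compact (closure [set x | phi x != 0]).

Lemma open_measurable_R3 (O : set (R3 R)) : open O -> measurable O.
Proof.
move=> oO.
pose B (k : rat * rat * rat * nat) : set (R3 R) :=
  ball (ratr k.1.1.1 : R) k.2.+1%:R^-1 `*` ball (ratr k.1.1.2 : R) k.2.+1%:R^-1
  `*` ball (ratr k.1.2 : R) k.2.+1%:R^-1.
pose F k : set (R3 R) := if `[< B k `<=` O >] then B k else set0.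
have -> : O = \bigcup_k F k.
  rewrite eqEsubset; split=> [x Ox|x [k _]]; last first.
    by rewrite /F; case: asboolP => // BO /BO.
  have /nbhs_ballP[e /= e0 xe] := open_nbhs_nbhs (conj oO Ox).
  have [n ne] : exists n, n.+1%:R^-1 < e / 2.
    have e2 : 0 < e / 2 by rewrite divr_gt0.
    have [n _ /(_ n (leqnn n)) ne] := near_infty_natSinv_lt (PosNum e2).
    by exists n.
  have n0 : 0 < n.+1%:R^-1 :> R by rewrite invr_gt0.
  have rq (y : R) : exists q : rat, ball (ratr q : R) n.+1%:R^-1 y.
    have [q] : exists q : rat, ratr q \in `]y - n.+1%:R^-1, y + n.+1%:R^-1[.
      by apply: rat_in_itvoo; rewrite ltrBlDr -addrA ltrDl addr_gt0.
    by rewrite in_itv/= => q1; exists q; rewrite /ball/= ltr_distl.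
  have [q1 b1] := rq x.1.1; have [q2 b2] := rq x.1.2; have [q3 b3] := rq x.2.
  exists (q1, q2, q3, n) => //; rewrite /F; case: asboolP => [|[]].
    by move=> _; split; first split.
  have bb (a b c : R) : ball a n.+1%:R^-1 b -> ball a n.+1%:R^-1 c -> ball b e c.
    rewrite /ball/= => h1 h2; rewrite -(subrK a b) -addrA.
    apply: le_lt_trans (ler_normD _ _) _; rewrite (distrC b).
    by rewrite [e]splitr; apply: ltrD; apply: lt_trans ne.
  move=> [[y1 y2] y3] [[h1 h2] h3]; apply: xe.
  by split; first split; [exact: bb b1 h1|exact: bb b2 h2|exact: bb b3 h3].
apply: countable_bigcupT_measurable; first exact: countableP.
move=> k; rewrite /F; case: asboolP => _ //.
by apply: measurableX; first apply: measurableX; rewrite ball_itv; exact: measurable_itv.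
Qed.

Lemma continuous_measurable_R3 phi : continuous phi -> measurable_fun setT phi.
Proof.
move=> cphi; apply: (measurability _ (RGenOInfty.measurableE R)) => //.
move=> /= _ [_ [a ->] <-]; rewrite setTI; apply: open_measurable_R3.
move/continuousP: cphi; apply; exact: interval_open.
Qed.

Lemma Lfun_continuous_compact phi (K : set (R3 R)) : continuous phi -> compact K ->
  (forall x, ~ K x -> phi x = 0) -> phi \in Lfun (vol R) 2%:E.
Proof.
move=> cphi cK phiK.
have mphi := continuous_measurable_R3 cphi.
have [M M0 phiM] : exists2 M, 0 <= M & forall x, `|phi x| <= M.
  have : compact (phi @` K).
    by apply: continuous_compact => //; exact: continuous_subspaceT.
  move=> /compact_bounded[N [_ /(_ (Num.max N 0 + 1))]].
  rewrite ltr_pwDr// ?le_max ?lexx//= => /(_ isT) HN.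
  exists (Num.max N 0 + 1); first by rewrite addr_ge0// le_max lexx orbT.
  move=> x; have [Kx|/phiK ->] := pselect (K x); first by apply: HN; exists x.
  by rewrite normr0 addr_ge0// le_max lexx orbT.
have [r r0 Kr] : exists2 r : R, 0 < r & K `<=`
    `[-r, r]%classic `*` `[-r, r]%classic `*` `[-r, r]%classic.
  move: cK => /compact_bounded[N [_ /(_ (Num.max N 0 + 1))]].
  rewrite ltr_pwDr// ?le_max ?lexx//= => /(_ isT) HN.
  exists (Num.max N 0 + 1); first by rewrite ltr_wpDl// le_max lexx orbT.
  move=> [[x y] z] /HN /=; rewrite !prod_normE/= !ge_max => /andP[/andP[]].
  by rewrite !in_itv/= -!ler_norml => -> -> ->.
set S : set (R3 R) := _ `*` _ in Kr.
have mS : measurable S by apply: measurableX => //; exact: measurableX.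
have volS : (vol R S < +oo)%E.
  rewrite /vol /S /=.
  have mI : measurable (`[-r, r]%classic : set (measurableTypeR R)) by [].
  rewrite product_measure1E//=; last exact: measurableX.
  rewrite product_measure1E//= lebesgue_measure_itv /=.
  by rewrite lte_fin; case: ifP; rewrite -?EFinD -?EFinM ?mul0e ltry.
apply/andP; split; rewrite inE//=.
rewrite /finite_norm unlock /=; apply: poweR_lty.
apply: (@le_lt_trans _ _ (\int[vol R]_x (cst (M ^+ 2)%:E \_ S) x)%E).
  apply: ge0_le_integral => //.
  - apply/measurable_EFinP.
    apply: (@measurableT_comp _ _ _ _ _ _ (fun x : R => x `^ 2)) => //.
    exact: measurableT_comp.
  - by apply/(measurable_restrictT _ _).1.
  move=> x _; rewrite /patch; case: ifPn => xS.
    by rewrite lee_fin powR_mulrn// ler_pXn2r// ?nnegrE.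
  rewrite phiK ?normr0 ?powR0//.
  by move=> /Kr Sx; move: xS; rewrite notin_setE.
rewrite -integral_mkcond integral_cst//.
by rewrite lte_mul_pinfty// ?lee_fin ?exprn_ge0.
Qed.

Lemma test_function_deriv_Lfun phi i : test_function phi ->
  (fun x => 'D_(basis_vec i) phi x) \in Lfun (vol R) 2%:E.
Proof.
move=> [Cphi cphi]; have [_ /(_ i)[_ /= cD]] := Cphi 1.
apply: Lfun_continuous_compact cD cphi _ => x nx.
have -> : 'D_(basis_vec i) phi x = 'D_(basis_vec i) (cst 0) x.
  apply: near_eq_derive.
  have : open (~` closure [set x | phi x != 0]) by rewrite openC; exact: closed_closure.
  move=> oC; have : nbhs x (~` closure [set x | phi x != 0]) by exact: open_nbhs_nbhs.
  apply: filterS => y ny; apply/eqP; apply: contra_notT ny => h.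
  exact: subset_closure.
by rewrite derive_cst.
Qed.

Lemma test_function_Lfun phi : test_function phi -> phi \in Lfun (vol R) 2%:E.
Proof.
move=> [Cphi cphi]; apply: Lfun_continuous_compact (Cphi 0) cphi _ => x nx.
by apply/eqP; apply: contra_notT nx => h; exact: subset_closure.
Qed.

End TestFunctions.

Section SobolevSpace.
Variable R : realType.
Local Notation vol := (vol R).
Local Notation C := R[i].

Lemma Lfun2_mul_integrable (f g : R3 R -> R) :
  f \in Lfun vol 2%:E -> g \in Lfun vol 2%:E ->
  vol.-integrable setT (EFin \o (fun x => f x * g x)).
Proof. by move=> fL gL; apply/Lfun1_integrable; exact: Lfun2_mul_Lfun1. Qed.

Lemma Lfun2_measurable (f : R3 R -> R) :
  f \in Lfun vol 2%:E -> measurable_fun setT f.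
Proof. by case/andP; rewrite inE. Qed.

Lemma ae_Rintegral (f g : R3 R -> R) : measurable_fun setT f ->
  measurable_fun setT g -> {ae vol, forall x, f x = g x} ->
  \int[vol]_x f x = \int[vol]_x g x.
Proof.
move=> mf mg fg; congr fine; apply: ae_eq_integral => //.
- exact/measurable_EFinP.
- exact/measurable_EFinP.
- by apply: filterS fg => x /= -> _.
Qed.

Lemma sqint_re (f : sqint R) : re_part f \in Lfun vol 2%:E.
Proof. by case: f => f /= /[!inE] /andP[]. Qed.

Lemma sqint_im (f : sqint R) : im_part f \in Lfun vol 2%:E.
Proof. by case: f => f /= /[!inE] /andP[]. Qed.

Definition is_weak_partial (i : 'I_3) (f g : L2 R) : Prop :=
  forall phi, test_function phi ->
    cintegral (fun x => repr f x * ('D_(basis_vec R i) phi x)%:C%C) =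
    - cintegral (fun x => repr g x * (phi x)%:C%C).

Definition H1graph : {pred L2 R * ('I_3 -> L2 R)} :=
  [pred u | `[< forall i, is_weak_partial i u.1 (u.2 i) >] ].

Lemma pairing_re (f : R3 R -> C) (psi : R3 R -> R) :
  re_part (fun x => f x * (psi x)%:C%C) = fun x => re_part f x * psi x.
Proof.
by apply/funext => x; rewrite /re_part; case: (f x) => a b /=; rewrite mulr0 subr0.
Qed.

Lemma pairing_im (f : R3 R -> C) (psi : R3 R -> R) :
  im_part (fun x => f x * (psi x)%:C%C) = fun x => im_part f x * psi x.
Proof.
by apply/funext => x; rewrite /im_part; case: (f x) => a b /=; rewrite mulr0 add0r.
Qed.

Lemma pairing_pi (f : sqint R) (psi : R3 R -> R) : psi \in Lfun vol 2%:E ->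
  cintegral (fun x => repr (\pi_(L2 R) f) x * (psi x)%:C%C) =
  cintegral (fun x => f x * (psi x)%:C%C).
Proof.
move=> Lpsi; rewrite /cintegral !pairing_re !pairing_im.
have mpsi := Lfun2_measurable Lpsi.
by congr (_ +i* _)%C; apply: ae_Rintegral;
  (try by apply: measurable_funM => //; apply: Lfun2_measurable;
    exact: sqint_re || exact: sqint_im);
  apply: filterS (repr_ae f) => x; rewrite /re_part /im_part => ->.
Qed.

Lemma pairing_lin (c : C) (f g : L2 R) (psi : R3 R -> R) :
  psi \in Lfun vol 2%:E ->
  cintegral (fun x => repr (c *: f + g) x * (psi x)%:C%C) =
  c * cintegral (fun x => repr f x * (psi x)%:C%C) +
  cintegral (fun x => repr g x * (psi x)%:C%C).
Proof.
move=> Lpsi; elim/L2W: f => f; elim/L2W: g => g.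
have -> : c *: \pi_(L2 R) f + \pi_(L2 R) g = \pi_(L2 R) (c *: f + g).
  by rewrite -[LHS]/(L2add (L2scale c _) _) pi_scale pi_add.
rewrite !pairing_pi // /cintegral !pairing_re !pairing_im.
have re1 : re_part (c *: f + g : sqint R) = fun x =>
    (complex.Re c * re_part f x - complex.Im c * im_part f x) + re_part g x.
  apply/funext => x; rewrite /re_part /im_part.
  have -> : (c *: f + g) x = c * f x + g x by [].
  by case: (c) (f x) (g x) => [a b] [a1 b1] [a2 b2].
have im1 : im_part (c *: f + g : sqint R) = fun x =>
    (complex.Re c * im_part f x + complex.Im c * re_part f x) + im_part g x.
  apply/funext => x; rewrite /re_part /im_part.
  have -> : (c *: f + g) x = c * f x + g x by [].
  by case: (c) (f x) (g x) => [a b] [a1 b1] [a2 b2].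
rewrite re1 im1.
have ifr := Lfun2_mul_integrable (sqint_re f) Lpsi.
have ifi := Lfun2_mul_integrable (sqint_im f) Lpsi.
have igr := Lfun2_mul_integrable (sqint_re g) Lpsi.
have igi := Lfun2_mul_integrable (sqint_im g) Lpsi.
have iZ (a : R) (h : R3 R -> R) : vol.-integrable setT (EFin \o h) ->
    vol.-integrable setT (EFin \o (fun x => a * h x)).
  by move=> ih; apply: eq_integrable (integrableZl measurableT a ih).
have iD (h k : R3 R -> R) : vol.-integrable setT (EFin \o h) ->
    vol.-integrable setT (EFin \o k) ->
    vol.-integrable setT (EFin \o (fun x => h x + k x)).
  by move=> ih ik; apply: eq_integrable (integrableD measurableT ih ik).
have comb (a b : R) (h k l : R3 R -> R) : vol.-integrable setT (EFin \o (fun x => h x * psi x)) ->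
    vol.-integrable setT (EFin \o (fun x => k x * psi x)) ->
    vol.-integrable setT (EFin \o (fun x => l x * psi x)) ->
    \int[vol]_x ((a * h x + b * k x + l x) * psi x) =
    a * \int[vol]_x (h x * psi x) + b * \int[vol]_x (k x * psi x) +
    \int[vol]_x (l x * psi x).
  move=> ih ik il.
  under eq_Rintegral do rewrite !mulrDl -!mulrA.
  rewrite RintegralD//; last by apply: iD; exact: iZ.
  by rewrite RintegralD//; [rewrite !RintegralZl|exact: iZ|exact: iZ].
rewrite comb //.
under eq_Rintegral do rewrite -mulNr.
rewrite comb //.
by case: (c) => a b /=; rewrite mulNr.
Qed.

Lemma H1graph_submod_closed : submod_closed H1graph.
Proof.
split.
  apply/asboolP => i phi tphi /=.
  have e0 (psi : R3 R -> R) : psi \in Lfun vol 2%:E ->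
      cintegral (fun x => repr (0 : L2 R) x * (psi x)%:C%C) = 0.
    move=> Lpsi; have := pairing_lin (-1) 0 0 Lpsi.
    by rewrite scaler0 addr0 mulN1r addNr.
  rewrite !e0 ?oppr0//; [exact: test_function_Lfun|exact: test_function_deriv_Lfun].
move=> c u v /asboolP hu /asboolP hv; apply/asboolP => i phi tphi /=.
have L1 := test_function_deriv_Lfun i tphi.
have L2 := test_function_Lfun tphi.
rewrite (pairing_lin _ _ _ L1) hu// hv//.
rewrite -[(c *: u.2 + v.2) i]/(c *: u.2 i + v.2 i) (pairing_lin _ _ _ L2).
by rewrite opprD mulrN.
Qed.

HB.instance Definition _ := GRing.isSubmodClosed.Build C
  (L2 R * ('I_3 -> L2 R))%type H1graph H1graph_submod_closed.

(* An element of the Sobolev space is a class [f] in L^2 together with its weak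
   partial derivatives.  The latter are uniquely determined by [f], so the first
   projection identifies [H1] with the classes in L^2 all of whose weak partial
   derivatives are in L^2; recording them makes the inner product directly
   definable. *)
Record H1 := MkH1 { H1_val :> L2 R * ('I_3 -> L2 R); _ : H1_val \in H1graph }.
HB.instance Definition _ := [isSub for H1_val].
HB.instance Definition _ := [Choice of H1 by <:].
HB.instance Definition _ := [SubChoice_isSubLmodule of H1 by <:].

(* The L^2 inner product of two elements of the Sobolev space. *)
Definition ip_H1L2 (u v : H1) : C := ip_L2 (H1_val u).1 (H1_val v).1.

Definition ip_H1 (u v : H1) : C :=
  ip_H1L2 u v + \sum_(i < 3) ip_L2 ((H1_val u).2 i) ((H1_val v).2 i).

Definition norm_L2 (u : H1) : R := Num.sqrt (complex.Re (ip_H1L2 u u)).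
Definition norm_H1 (u : H1) : R := Num.sqrt (complex.Re (ip_H1 u u)).

Definition rip (f g : L2 R) : R := complex.Re (ip_L2 f g).

Lemma rip_pi (f g : sqint R) : rip (\pi_(L2 R) f) (\pi_(L2 R) g) =
  \int[vol]_x (re_part f x * re_part g x + im_part f x * im_part g x).
Proof.
rewrite /rip /=.
have E (h k : R3 R -> C) : re_part (fun x => h x * ((k x)^*)%C) =
    fun x => re_part h x * re_part k x + im_part h x * im_part k x.
  apply/funext => x; rewrite /re_part /im_part.
  by case: (h x) (k x) => [a b] [a' b'] /=; rewrite mulrN opprK.
rewrite E; have mre h := Lfun2_measurable (sqint_re h).
have mim h := Lfun2_measurable (sqint_im h).
apply: ae_Rintegral; rewrite ?E.
- by apply: measurable_funD; apply: measurable_funM.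
- by apply: measurable_funD; apply: measurable_funM.
- by move: (repr_ae g); apply: filterS2 (repr_ae f) => x e1 e2;
    rewrite /re_part /im_part e1 e2.
Qed.

Lemma rip_integrable (f g : sqint R) : vol.-integrable setT (EFin \o
  (fun x => re_part f x * re_part g x + im_part f x * im_part g x)).
Proof.
have i1 := Lfun2_mul_integrable (sqint_re f) (sqint_re g).
have i2 := Lfun2_mul_integrable (sqint_im f) (sqint_im g).
by apply: eq_integrable (integrableD measurableT i1 i2).
Qed.

Lemma ripC f g : rip f g = rip g f.
Proof.
elim/L2W: f => f; elim/L2W: g => g; rewrite !rip_pi.
by apply: eq_Rintegral => x _; rewrite mulrC [X in _ + X]mulrC.
Qed.

Lemma ripDl f f' g : rip (f + f') g = rip f g + rip f' g.
Proof.
elim/L2W: f => f; elim/L2W: f' => f'; elim/L2W: g => g.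
rewrite -[_ + _ in LHS]/(L2add _ _) pi_add !rip_pi -RintegralD//;
  [|exact: rip_integrable|exact: rip_integrable].
apply: eq_Rintegral => x _; rewrite /re_part /im_part.
have -> : (f + f') x = f x + f' x by [].
by case: (f x) (f' x) => [a b] [a' b'] /=; rewrite !mulrDl addrACA.
Qed.

Lemma ripZl (r : R) f g : rip (r%:C%C *: f) g = r * rip f g.
Proof.
elim/L2W: f => f; elim/L2W: g => g.
rewrite -[_ *: _ in LHS]/(L2scale _ _) pi_scale !rip_pi -RintegralZl//;
  last exact: rip_integrable.
apply: eq_Rintegral => x _; rewrite /re_part /im_part.
have -> : (r%:C%C *: f) x = r%:C%C * f x by [].
by case: (f x) => [a b] /=; rewrite !mul0r subr0 addr0 mulrDr !mulrA.
Qed.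

Lemma rip_ge0 f : 0 <= rip f f.
Proof.
elim/L2W: f => f; rewrite rip_pi; apply: Rintegral_ge0 => x _.
by rewrite -!expr2 addr_ge0// sqr_ge0.
Qed.

Lemma rip_eq0 f : rip f f = 0 -> f = 0.
Proof.
elim/L2W: f => f; rewrite rip_pi => H; apply/L2P.
have i := rip_integrable f f.
set h := (fun x => _) in H i.
have h0 x : 0 <= h x by rewrite /h -!expr2 addr_ge0// sqr_ge0.
have : (\int[vol]_x `|(EFin \o h) x| = 0)%E.
  have -> : (fun x => `|(EFin \o h) x|)%E = EFin \o h.
    by apply/funext => x /=; rewrite ger0_norm.
  move/eqP: H; rewrite -eqe fineK => [/eqP//|].
  exact: integrable_fin_num.
move/ae_eq_integral_abs => /(_ measurableT).
have /integrableP[mh _] := i => /(_ mh).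
apply: filterS => x /(_ I) [] /eqP; rewrite /h -!expr2 paddr_eq0 ?sqr_ge0//.
rewrite !sqrf_eq0 /re_part /im_part => /andP[/eqP e1 /eqP e2].
by case: (f x) e1 e2 => a b /= -> ->.
Qed.

Definition rip_H1 (u v : H1) : R := complex.Re (ip_H1 u v).

Lemma rip_H1E u v : rip_H1 u v =
  rip (H1_val u).1 (H1_val v).1 + \sum_(i < 3) rip ((H1_val u).2 i) ((H1_val v).2 i).
Proof.
rewrite /rip_H1 /ip_H1 /rip /ip_H1L2.
have ReD (a b : C) : complex.Re (a + b) = complex.Re a + complex.Re b.
  by case: a b => [? ?] [? ?].
rewrite ReD; congr (_ + _); exact: (big_morph (@complex.Re R) ReD).
Qed.

Lemma rip_H1C u v : rip_H1 u v = rip_H1 v u.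
Proof. by rewrite !rip_H1E ripC; congr (_ + _); apply: eq_bigr => i _; rewrite ripC. Qed.

Lemma rip_H1Dl u u' v : rip_H1 (u + u') v = rip_H1 u v + rip_H1 u' v.
Proof.
rewrite !rip_H1E /= ripDl addrACA -big_split; congr (_ + _).
by apply: eq_bigr => i _; exact: ripDl.
Qed.

Lemma rip_H1Zl (r : R) u v : rip_H1 (r%:C%C *: u) v = r * rip_H1 u v.
Proof.
rewrite !rip_H1E /= ripZl mulrDr mulr_sumr; congr (_ + _).
by apply: eq_bigr => i _; exact: ripZl.
Qed.

Lemma rip_H1_ge0 u : 0 <= rip_H1 u u.
Proof. by rewrite rip_H1E addr_ge0 ?rip_ge0// sumr_ge0// => i _; exact: rip_ge0. Qed.

Lemma rip_H1_eq0 u : rip_H1 u u = 0 -> u = 0.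
Proof.
rewrite rip_H1E => /eqP; rewrite paddr_eq0 ?rip_ge0//; last first.
  by rewrite sumr_ge0// => i _; exact: rip_ge0.
rewrite psumr_eq0; last by move=> i _; exact: rip_ge0.
move=> /andP[/eqP/rip_eq0 e1 /allP e2]; apply: val_inj => /=.
rewrite [LHS]surjective_pairing e1 -[RHS]/(0, 0); congr pair.
apply/funext => i; apply: rip_eq0; apply/eqP; exact: (e2 i (mem_index_enum i)).
Qed.

Lemma norm_H1_ge0 u : 0 <= norm_H1 u. Proof. exact: sqrtr_ge0. Qed.

Lemma sqr_norm_H1 u : norm_H1 u ^+ 2 = rip_H1 u u.
Proof. by rewrite sqr_sqrtr// rip_H1_ge0. Qed.

Lemma norm_H1_eq0 u : norm_H1 u = 0 -> u = 0.
Proof. by move=> u0; apply: rip_H1_eq0; rewrite -sqr_norm_H1 u0 expr0n. Qed.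

Lemma norm_H1Z (r : R) u : norm_H1 (r%:C%C *: u) = `|r| * norm_H1 u.
Proof.
rewrite /norm_H1 -/(rip_H1 _ _) -/(rip_H1 _ _) rip_H1Zl rip_H1C rip_H1Zl mulrA -expr2.
by rewrite sqrtrM ?sqr_ge0// sqrtr_sqr.
Qed.

Lemma rip_H1_expand (r : R) u v : rip_H1 (u + r%:C%C *: v) (u + r%:C%C *: v) =
  norm_H1 u ^+ 2 + 2 * r * rip_H1 u v + r ^+ 2 * norm_H1 v ^+ 2.
Proof.
rewrite rip_H1Dl rip_H1Zl [rip_H1 u _]rip_H1C [rip_H1 v _]rip_H1C !rip_H1Dl.
rewrite !rip_H1Zl [rip_H1 v u]rip_H1C !sqr_norm_H1; ring.
Qed.

Lemma CauchySchwarz_H1 u v : rip_H1 u v <= norm_H1 u * norm_H1 v.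
Proof.
have [v0|v0] := eqVneq (norm_H1 v) 0.
  rewrite v0 mulr0 (norm_H1_eq0 v0) rip_H1C.
  have -> : (0 : H1) = (0 : R)%:C%C *: (0 : H1) by rewrite scaler0.
  by rewrite rip_H1Zl mul0r.
have vp : 0 < norm_H1 v by rewrite lt_neqAle eq_sym v0 norm_H1_ge0.
set t := rip_H1 u v / norm_H1 v ^+ 2.
have Et : rip_H1 u v = t * norm_H1 v ^+ 2 by rewrite /t mulfVK// expf_neq0.
have := rip_H1_ge0 (u + (- t)%:C%C *: v); rewrite rip_H1_expand Et => H.
rewrite leNgt; apply/negP => lt.
have tp : norm_H1 u < t * norm_H1 v by move: lt; rewrite expr2 mulrA ltr_pM2r.
have : norm_H1 u ^+ 2 < (t * norm_H1 v) ^+ 2.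
  by rewrite ltr_pXn2r// nnegrE ?norm_H1_ge0// (le_trans (norm_H1_ge0 u))// ltW.
rewrite exprMn; move: (norm_H1 u ^+ 2) (norm_H1 v ^+ 2) H => a b H h.
have : 0 < 0 :> R; last by rewrite ltxx.
apply: le_lt_trans H _; rewrite -subr_gt0 in h; rewrite -subr_gt0.
by apply: lt_le_trans h _; rewrite le_eqVlt; apply/orP; left; apply/eqP; ring.
Qed.

Lemma norm_H1D u v : norm_H1 (u + v) <= norm_H1 u + norm_H1 v.
Proof.
rewrite -(@ler_pXn2r _ 2)// ?nnegrE ?addr_ge0 ?norm_H1_ge0//.
rewrite sqr_norm_H1 rip_H1Dl ![rip_H1 _ (u + v)]rip_H1C !rip_H1Dl.
rewrite sqrrD !sqr_norm_H1 [rip_H1 v u]rip_H1C.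
have := CauchySchwarz_H1 u v; lra.
Qed.

Lemma norm_H1_0 : norm_H1 0 = 0.
Proof.
have -> : (0 : H1) = (0 : R)%:C%C *: (0 : H1) by rewrite scaler0.
by rewrite norm_H1Z normr0 mul0r.
Qed.

End SobolevSpace.

Section BoundedOperators.
Variable R : realType.
Local Notation C := R[i].
Local Notation H1 := (H1 R).

Definition bounded_linear : {pred H1 -> H1} := [pred T | `[<
  (forall (a : C) u v, T (a *: u + v) = a *: T u + T v) /\
  (exists M : R, forall u, norm_H1 (T u) <= M * norm_H1 u) >] ].

Lemma bounded_linear_zmod_closed : zmod_closed bounded_linear.
Proof.
split.
  apply/asboolP; split=> [a u v|]; first by rewrite scaler0 addr0.
  by exists 0 => u; rewrite mul0r norm_H1_0.
move=> S T /asboolP[Sl [M SM]] /asboolP[Tl [N TN]]; apply/asboolP.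
have E u : (S - T) u = S u - T u by [].
split=> [a u v|].
  by rewrite !E Sl Tl scalerBr opprD addrACA.
exists (M + N) => u; rewrite E mulrDl.
have NN (v : H1) : norm_H1 (- v) = norm_H1 v.
  have -> : - v = (-1 : R)%:C%C *: v by rewrite rmorphN rmorph1 scaleN1r.
  by rewrite norm_H1Z normrN1 mul1r.
by rewrite (le_trans (norm_H1D _ _))// NN lerD.
Qed.

HB.instance Definition _ :=
  GRing.isZmodClosed.Build (H1 -> H1) bounded_linear bounded_linear_zmod_closed.

(* Bounded complex-linear operators, made below into a *real* normed space. *)
Record bop := Bop { bop_fun :> H1 -> H1; _ : bop_fun \in bounded_linear }.
HB.instance Definition _ := [isSub for bop_fun].
HB.instance Definition _ := [Choice of bop by <:].
HB.instance Definition _ := [SubChoice_isSubZmodule of bop by <:].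

Lemma bop_eq (S T : bop) : (forall u, S u = T u) -> S = T.
Proof. by move=> E; apply: val_inj; apply/funext. Qed.

Lemma bopP (T : bop) a u v : T (a *: u + v) = a *: T u + T v.
Proof. by case: T => T /= /asboolP[]. Qed.

Lemma bop0 (T : bop) : T 0 = 0.
Proof. by have := bopP T (-1) 0 0; rewrite scaler0 addr0 scaleN1r addNr. Qed.

Lemma bopD (T : bop) u v : T (u + v) = T u + T v.
Proof. by have := bopP T 1 u v; rewrite !scale1r. Qed.

Lemma bopZ (T : bop) a u : T (a *: u) = a *: T u.
Proof. by have := bopP T a u 0; rewrite bop0 !addr0. Qed.

Lemma bop_bound (T : bop) : exists2 M : R, 0 <= M &
  forall u, norm_H1 (T u) <= M * norm_H1 u.
Proof.
case: T => T /= /asboolP[_ [M TM]]; exists (Num.max M 0) => [|u].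
  by rewrite le_max lexx orbT.
by rewrite (le_trans (TM u))// ler_wpM2r ?norm_H1_ge0// le_max lexx.
Qed.

Lemma bop_scale_subproof (r : R) (T : bop) :
  (fun u => r%:C%C *: T u) \in bounded_linear.
Proof.
apply/asboolP; split=> [a u v|].
  by rewrite bopP scalerDr !scalerA mulrC.
have [M M0 TM] := bop_bound T; exists (`|r| * M) => u.
by rewrite norm_H1Z -mulrA ler_wpM2l.
Qed.

Definition bop_scale (r : R) (T : bop) : bop := Bop (bop_scale_subproof r T).

Lemma bop_scaleA a b T : bop_scale a (bop_scale b T) = bop_scale (a * b) T.
Proof. by apply: bop_eq => u /=; rewrite scalerA -rmorphM. Qed.
Lemma bop_scale1 : left_id 1 bop_scale.
Proof. by move=> T; apply: bop_eq => u /=; rewrite rmorph1 scale1r. Qed.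
Lemma bop_scaleDr : right_distributive bop_scale +%R.
Proof.
move=> a S T; apply: bop_eq => u; rewrite -[RHS]/(_ *: S u + _ *: T u) -scalerDr.
by [].
Qed.
Lemma bop_scaleDl T : {morph bop_scale^~ T : a b / a + b}.
Proof.
move=> a b; apply: bop_eq => u; rewrite -[RHS]/(_ *: T u + _ *: T u) -scalerDl.
by rewrite -rmorphD.
Qed.
HB.instance Definition _ := GRing.Zmodule_isLmodule.Build R bop
  bop_scaleA bop_scale1 bop_scaleDr bop_scaleDl.

Lemma bop_one_subproof : idfun \in bounded_linear.
Proof. by apply/asboolP; split=> //; exists 1 => u; rewrite mul1r. Qed.
Definition bop_one : bop := Bop bop_one_subproof.

Lemma bop_mul_subproof (S T : bop) : S \o T \in bounded_linear.
Proof.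
apply/asboolP; split=> [a u v|]; first by rewrite /= !bopP.
have [M M0 SM] := bop_bound S; have [N N0 TN] := bop_bound T.
exists (M * N) => u /=.
by rewrite (le_trans (SM _))// -mulrA ler_wpM2l.
Qed.
Definition bop_mul (S T : bop) : bop := Bop (bop_mul_subproof S T).

Lemma bop_mulA : associative bop_mul.
Proof. by move=> S T U; apply: bop_eq. Qed.
Lemma bop_mul1 : left_id bop_one bop_mul.
Proof. by move=> S; apply: bop_eq. Qed.
Lemma bop_1mul : right_id bop_one bop_mul.
Proof. by move=> S; apply: bop_eq. Qed.
Lemma bop_mulDl : left_distributive bop_mul +%R.
Proof. by move=> S T U; apply: bop_eq. Qed.
Lemma bop_mulDr : right_distributive bop_mul +%R.
Proof. by move=> S T U; apply: bop_eq => u; exact: bopD. Qed.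
HB.instance Definition _ := GRing.Zmodule_isPzRing.Build bop
  bop_mulA bop_mul1 bop_1mul bop_mulDl bop_mulDr.

Definition op_norm (T : bop) : R :=
  sup [set norm_H1 (T u) | u in [set u | norm_H1 u <= 1]].

Lemma op_norm_has_sup (T : bop) :
  has_sup [set norm_H1 (T u) | u in [set u | norm_H1 u <= 1]].
Proof.
split; first by exists (norm_H1 (T 0)); exists 0 => //=; rewrite norm_H1_0 ler01.
have [M M0 TM] := bop_bound T; exists M => _ [u /= u1 <-].
by rewrite (le_trans (TM u))// ler_piMr.
Qed.

Lemma op_norm_ub (T : bop) u : norm_H1 u <= 1 -> norm_H1 (T u) <= op_norm T.
Proof. by move=> u1; apply: (sup_upper_bound (op_norm_has_sup T)); exists u. Qed.

Lemma op_norm_lub (T : bop) M :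
  (forall u, norm_H1 u <= 1 -> norm_H1 (T u) <= M) -> op_norm T <= M.
Proof.
move=> H; apply: ge_sup; first by case: (op_norm_has_sup T).
by move=> _ [u /= u1 <-]; exact: H.
Qed.

Lemma op_norm_ge0 (T : bop) : 0 <= op_norm T.
Proof.
by apply: le_trans (op_norm_ub T (u := 0) _); rewrite ?norm_H1_ge0// norm_H1_0 ler01.
Qed.

Lemma op_normP (T : bop) u : norm_H1 (T u) <= op_norm T * norm_H1 u.
Proof.
have [/norm_H1_eq0 ->|u0] := eqVneq (norm_H1 u) 0.
  by rewrite bop0 norm_H1_0 mulr0.
have up : 0 < norm_H1 u by rewrite lt_neqAle eq_sym u0 norm_H1_ge0.
have := @op_norm_ub T ((norm_H1 u)^-1%:C%C *: u).
rewrite bopZ !norm_H1Z ger0_norm ?invr_ge0 ?norm_H1_ge0// mulVf// => /(_ (lexx _)).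
by rewrite ler_pdivrMl// mulrC.
Qed.

Lemma op_normD S T : op_norm (S + T) <= op_norm S + op_norm T.
Proof.
apply: op_norm_lub => u u1; rewrite -[(S + T) u]/(S u + T u).
by rewrite (le_trans (norm_H1D _ _))// lerD// op_norm_ub.
Qed.

Lemma op_normZ (r : R) T : op_norm (r *: T) = `|r| * op_norm T.
Proof.
have le (s : R) S : op_norm (s *: S) <= `|s| * op_norm S.
  apply: op_norm_lub => u u1; rewrite -[(s *: S) u]/(s%:C%C *: S u) norm_H1Z.
  by rewrite ler_wpM2l// op_norm_ub.
apply/eqP; rewrite eq_le le/=.
have [->|r0] := eqVneq r 0; first by rewrite normr0 mul0r op_norm_ge0.
have := le r^-1 (r *: T); rewrite scalerA mulVf// scale1r normfV.
by rewrite ler_pdivlMl ?normr_gt0.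
Qed.

Lemma op_norm_eq0 T : op_norm T = 0 -> T = 0.
Proof.
move=> T0; apply: bop_eq => u; apply: norm_H1_eq0; apply/eqP.
by rewrite eq_le norm_H1_ge0 andbT; have := op_normP T u; rewrite T0 mul0r.
Qed.

HB.instance Definition _ :=
  Lmodule_isNormed.Build R bop op_normD op_normZ op_norm_eq0.

Definition exp_bop (X : bop) : bop :=
  limn (fun n : nat => \sum_(k < n) (k`!%:R : R)^-1 *: X ^+ k).

Definition is_inverse (S T : bop) : Prop := S * T = 1 /\ T * S = 1.

(* The inverse when it exists, by choice; 0 otherwise. *)
Definition inv_bop (T : bop) : bop := xget 0 [set S | is_inverse S T].

Definition unitary_group : set bop :=
  [set T | (exists S, is_inverse S T) /\ forall u, norm_L2 (T u) = norm_L2 u].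

Definition antihermitian : {pred bop} := [pred X : bop | `[<
  forall u v, ip_H1L2 (X u) v = - ip_H1L2 u (X v) >] ].

Definition has_rank (N : nat) (T : bop) : Prop := exists e : 'I_N -> H1,
  (forall c : 'I_N -> C, \sum_i c i *: e i = 0 -> forall i, c i = 0) /\
  range T = [set u | exists c : 'I_N -> C, u = \sum_i c i *: e i].

Definition grassmannian (N : nat) : set bop :=
  [set P | [/\ has_rank N P, P * P = P &
    forall u v, ip_H1L2 (P u) v = ip_H1L2 u (P v)]].

End BoundedOperators.

Section LieAlgebra.
Variable R : realType.
Local Notation C := R[i].

Lemma Im_ip_L2 (f g : L2 R) : complex.Im (ip_L2 f g) = - rip ('i%C *: f) g.
Proof.
elim/L2W: f => f; elim/L2W: g => g.
have -> : 'i%C *: \pi_(L2 R) f = \pi_(L2 R) ('i%C *: f) by exact: pi_scale.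
rewrite rip_pi -mulN1r -RintegralZl//; last exact: rip_integrable.
rewrite /ip_L2 /cintegral [LHS]/=.
have mre h := Lfun2_measurable (sqint_re h).
have mim h := Lfun2_measurable (sqint_im h).
have E (h k : R3 R -> C) : im_part (fun x => h x * ((k x)^*)%C) =
    fun x => im_part h x * re_part k x - re_part h x * im_part k x.
  apply/funext => x; rewrite /re_part /im_part.
  by case: (h x) (k x) => [a b] [a' b'] /=; rewrite mulrN addrC.
apply: ae_Rintegral; rewrite ?E.
- by apply: measurable_funB; apply: measurable_funM.
- by apply: measurable_funM => //; apply: measurable_funD; apply: measurable_funM.
move: (repr_ae g); apply: filterS2 (repr_ae f) => x e1 e2.
rewrite /re_part /im_part e1 e2.
have -> : ('i%C *: f) x = 'i%C * f x by [].
by case: (f x) (g x) => [a b] [a' b'] /=; ring.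
Qed.

Lemma ip_L2Dl (f f' g : L2 R) : ip_L2 (f + f') g = ip_L2 f g + ip_L2 f' g.
Proof.
apply/eqP; rewrite eq_complex; apply/andP; split; apply/eqP.
  rewrite -[LHS]/(rip _ _) ripDl /rip.
  by case: (ip_L2 f g) (ip_L2 f' g) => [? ?] [? ?].
rewrite Im_ip_L2 scalerDr ripDl opprD -!Im_ip_L2.
by case: (ip_L2 f g) (ip_L2 f' g) => [? ?] [? ?].
Qed.

Lemma ip_L2Zl (r : R) (f g : L2 R) : ip_L2 (r%:C%C *: f) g = r%:C%C * ip_L2 f g.
Proof.
apply/eqP; rewrite eq_complex; apply/andP; split; apply/eqP.
  rewrite -[LHS]/(rip _ _) ripZl /rip.
  by case: (ip_L2 f g) => [? ?] /=; rewrite mul0r subr0.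
rewrite Im_ip_L2 scalerA mulrC -scalerA ripZl -mulrN -Im_ip_L2.
by case: (ip_L2 f g) => [? ?] /=; rewrite mul0r addr0.
Qed.

Lemma ip_L2C (f g : L2 R) : ip_L2 g f = ((ip_L2 f g)^*)%C.
Proof.
rewrite /ip_L2 /cintegral.
have E1 : re_part (fun x => repr g x * ((repr f x)^*)%C) =
    re_part (fun x => repr f x * ((repr g x)^*)%C).
  apply/funext => x; rewrite /re_part.
  by case: (repr f x) (repr g x) => [a b] [a' b'] /=; ring.
have E2 : im_part (fun x => repr g x * ((repr f x)^*)%C) =
    fun x => -1 * im_part (fun x => repr f x * ((repr g x)^*)%C) x.
  apply/funext => x; rewrite /im_part.
  by case: (repr f x) (repr g x) => [a b] [a' b'] /=; ring.
rewrite E1 E2 /=; congr (_ +i* _)%C.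
rewrite RintegralZl// ?mulN1r//.
have i1 := Lfun2_mul_integrable (sqint_im (repr f)) (sqint_re (repr g)).
have i2 := Lfun2_mul_integrable (sqint_re (repr f)) (sqint_im (repr g)).
apply: eq_integrable (integrableB measurableT i1 i2) => // x _.
rewrite /= -EFinB /re_part /im_part.
by case: (repr f x) (repr g x) => [a b] [a' b'] /=; congr EFin; ring.
Qed.

Lemma ip_L2Dr (f g g' : L2 R) : ip_L2 f (g + g') = ip_L2 f g + ip_L2 f g'.
Proof. by rewrite (ip_L2C (g + g')) (ip_L2C g) (ip_L2C g') ip_L2Dl rmorphD. Qed.

Lemma ip_L2Zr (r : R) (f g : L2 R) : ip_L2 f (r%:C%C *: g) = r%:C%C * ip_L2 f g.
Proof. by rewrite (ip_L2C (_ *: g)) (ip_L2C g) ip_L2Zl rmorphM/= oppr0. Qed.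

Lemma antihermitian_submod_closed : submod_closed (@antihermitian R).
Proof.
have iZ := (ip_L2Zl, ip_L2Zr).
split.
  apply/asboolP => u v; rewrite /ip_H1L2.
  have Z w : (H1_val ((0 : bop R) w)).1 = (0 : R)%:C%C *: (0 : L2 R).
    by rewrite scaler0.
  by rewrite !Z !iZ !mul0r oppr0.
move=> r X Y /asboolP hX /asboolP hY; apply/asboolP => u v; rewrite /ip_H1L2.
have E w : (H1_val ((r *: X + Y) w)).1 = r%:C%C *: (H1_val (X w)).1 + (H1_val (Y w)).1.
  by [].
by rewrite !E ip_L2Dl ip_L2Dr !iZ -!/(ip_H1L2 _ _) hX hY mulrN opprD.
Qed.

HB.instance Definition _ := GRing.isSubmodClosed.Build R (bop R)
  (@antihermitian R) antihermitian_submod_closed.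

Record lie_u := LieU { lie_u_val :> bop R; _ : lie_u_val \in @antihermitian R }.
HB.instance Definition _ := [isSub for lie_u_val].
HB.instance Definition _ := [Choice of lie_u by <:].
HB.instance Definition _ := [SubChoice_isSubLmodule of lie_u by <:].

Definition lie_u_norm (X : lie_u) : R := `|X : bop R|.

Lemma lie_u_normD X Y : lie_u_norm (X + Y) <= lie_u_norm X + lie_u_norm Y.
Proof. exact: ler_normD. Qed.
Lemma lie_u_normZ (r : R) X : lie_u_norm (r *: X) = `|r| * lie_u_norm X.
Proof. exact: normrZ. Qed.
Lemma lie_u_norm_eq0 X : lie_u_norm X = 0 -> X = 0.
Proof. by move=> /normr0_eq0 X0; apply: val_inj. Qed.
HB.instance Definition _ :=
  Lmodule_isNormed.Build R lie_u lie_u_normD lie_u_normZ lie_u_norm_eq0.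

End LieAlgebra.

Section Analytic.
Variables (R : realType) (E F : normedModType R).

Definition multilinear (k : nat) (a : ('I_k -> E) -> F) : Prop :=
  forall (i : 'I_k) (h : 'I_k -> E) (c : R) (u v : E),
    let upd w := fun j : 'I_k => if j == i then w else h j in
    a (upd (c *: u + v)) = c *: a (upd u) + a (upd v).

(* [f (x + h)] is, near [h = 0], the sum of a power series in [h] whose k-th term is
   the restriction to the diagonal of a k-linear map of norm at most [M / r ^ k]. *)
Definition analytic_at (f : E -> F) (x : E) : Prop :=
  exists (a : forall k, ('I_k -> E) -> F) (M r : R),
    [/\ 0 < r,
        forall k, multilinear (a k),
        forall k h, `|a k h| <= M * \prod_(i < k) (`|h i| / r) &
        forall h, `|h| < r ->
          (\sum_(k < n) a k (fun=> h)) @[n --> \oo] --> f (x + h)].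

Definition analytic_on (A : set E) (f : E -> F) : Prop :=
  forall x, A x -> analytic_at f x.

End Analytic.

Section Manifolds.
Variable R : realType.

Definition banach (E : normedModType R) : Prop :=
  forall G : set_system E, ProperFilter G -> cauchy G -> cvg G.

Definition linear_subspace (E : normedModType R) (K : set E) : Prop :=
  K 0 /\ forall (c : R) u v, K u -> K v -> K (c *: u + v).

Definition closed_complemented (E : normedModType R) (K : set E) : Prop :=
  closed K /\ exists L : set E,
    [/\ closed L, linear_subspace L, K `&` L = [set 0] &
        forall x, exists u v, [/\ K u, L v & x = u + v]].

(* Manifolds are carried by a subset [M] of an ambient topological space, with the
   relative topology.  The value of [chart_map c] outside [chart_dom c] and that of
   [chart_inv c] outside [chart_cod c] are irrelevant. *)
Record chart (T : Type) := Chart {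
  chart_model : normedModType R;
  chart_dom : set T;
  chart_map : T -> chart_model;
  chart_inv : chart_model -> T }.
Arguments chart_map {T} c _.
Arguments chart_inv {T} c _.

(* A predicate rather than a [set], for universe reasons. *)
Definition atlas (T : Type) := chart T -> Prop.

Definition chart_cod (T : Type) (c : chart T) : set (chart_model c) :=
  chart_map c @` chart_dom c.
Arguments chart_cod {T} c _.

Definition is_chart (T : topologicalType) (M : set T) (c : chart T) : Prop :=
  [/\ exists2 O, open O & chart_dom c = M `&` O,
      open (chart_cod c),
      {in chart_dom c, cancel (chart_map c) (chart_inv c)},
      {within chart_dom c, continuous (chart_map c)} &
      {within chart_cod c, continuous (chart_inv c)}].

Definition compatible (T : Type) (c d : chart T) : Prop :=
  analytic_on (chart_map c @` (chart_dom c `&` chart_dom d))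
    (chart_map d \o chart_inv c).

Definition analytic_manifold (T : topologicalType) (M : set T)
    (A : atlas T) : Prop :=
  [/\ forall c, A c -> is_chart M c /\ banach (chart_model c),
      forall x, M x -> exists c, A c /\ chart_dom c x &
      forall c d, A c -> A d -> compatible c d].

Definition local_rep (T S : Type) (c : chart T) (d : chart S) (f : T -> S) :
  chart_model c -> chart_model d := chart_map d \o f \o chart_inv c.
Arguments local_rep {T S} c d f _.

Definition analytic_map (T S : topologicalType) (M : set T) (A : atlas T)
    (N : set S) (B : atlas S) (f : T -> S) : Prop :=
  [/\ {homo f : x / M x >-> N x},
      {within M, continuous f} &
      forall x, M x -> exists c d, [/\ A c, B d, chart_dom c x,
        chart_dom d (f x) & analytic_at (local_rep c d f) (chart_map c x)]].

Definition submersion (T S : topologicalType) (M : set T) (A : atlas T)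
    (N : set S) (B : atlas S) (f : T -> S) : Prop :=
  analytic_map M A N B f /\
  forall x, M x -> exists c d, [/\ A c, B d, chart_dom c x, chart_dom d (f x) &
    let D : chart_model c -> chart_model d :=
      'd (local_rep c d f) (chart_map c x) in
    (forall v, exists u, D u = v) /\ closed_complemented [set u | D u = 0]].

Definition prod_chart (T S : Type) (c : chart T) (d : chart S) : chart (T * S) :=
  @Chart (T * S)%type (chart_model c * chart_model d)%type
    (chart_dom c `*` chart_dom d)
    (fun p => (chart_map c p.1, chart_map d p.2))
    (fun p => (chart_inv c p.1, chart_inv d p.2)).

Definition prod_atlas (T S : Type) (A : atlas T) (B : atlas S) :
  atlas (T * S) := fun e => exists c d, [/\ A c, B d & e = prod_chart c d].

Definition homogeneous_space (T S : topologicalType)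
    (G : set T) (mul : T -> T -> T) (one : T) (A : atlas T)
    (M : set S) (B : atlas S) (act : T -> S -> S) : Prop :=
  [/\ analytic_manifold M B,
      [/\ forall g x, G g -> M x -> M (act g x),
          forall x, M x -> act one x = x &
          forall g h x, G g -> G h -> M x -> act (mul g h) x = act g (act h x)],
      forall x y, M x -> M y -> exists2 g, G g & act g x = y,
      analytic_map (G `*` M) (prod_atlas A B) M B (fun p => act p.1 p.2) &
      forall x, M x -> submersion G A M B (fun g => act g x)].

Definition analytic_diffeo (E F : normedModType R) (W : set E)
    (Phi : E -> F) (Psi : F -> E) : Prop :=
  [/\ open W, open (Phi @` W), {in W, cancel Phi Psi},
      analytic_on W Phi & analytic_on (Phi @` W) Psi].

(* The charts of [M] obtained by restriction of the analytic charts [Phi] of [E], with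
   values in a product E1 x E2 of Banach spaces, that send [M] to E1 x {0}. *)
Definition submanifold_atlas (E : normedModType R) (M : set E) : atlas E :=
  fun c => exists (E1 E2 : normedModType R) (W : set E)
      (Phi : E -> E1 * E2) (Psi : E1 * E2 -> E),
    [/\ banach E1, banach E2, analytic_diffeo W Phi Psi,
        Phi @` (M `&` W) = Phi @` W `&` [set p | p.2 = 0] &
        c = @Chart E E1 (M `&` W) (fun y => (Phi y).1) (fun u => Psi (u, 0))].

Definition analytic_submanifold (E : normedModType R) (M : set E) : Prop :=
  forall x, M x -> exists c, submanifold_atlas M c /\ chart_dom c x.

End Manifolds.

Section UnitaryAction.
Variable R : realType.

(* The Banach-Lie group structure of the unitary group is given by the exponential
   charts: X |-> V e^X is a homeomorphism from the ball of radius 1/2 of the Lie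
   algebra onto a neighbourhood of V in the group, since 1/2 < log 2. *)
Definition exp_chart (V : bop R) : chart R (bop R) :=
  @Chart R (bop R) (lie_u R)
    [set V * exp_bop (X : bop R) | X in [set X : lie_u R | `|X| < 2^-1]]
    (fun T => xget 0 [set X : lie_u R | `|X| < 2^-1 /\ T = V * exp_bop (X : bop R)])
    (fun X => V * exp_bop (X : bop R)).

Definition unitary_atlas : atlas R (bop R) :=
  fun c => exists2 V, @unitary_group R V & c = exp_chart V.

End UnitaryAction.

(* Main.v *)
Require Import Defs.
From HB Require Import structures.
From mathcomp Require Import all_boot all_order all_algebra complex.
From mathcomp Require Import all_classical all_reals all_analysis.
From mathcomp Require Import measurable_realfun ring lra zify.

Set Implicit Arguments.
Unset Strict Implicit.
Unset Printing Implicit Defensive.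
Import Order.TTheory GRing.Theory Num.Theory.
Import numFieldNormedType.Exports.
Local Open Scope classical_set_scope.
Local Open Scope ring_scope.

(** Near [P] an idempotent [T] that is symmetric for the L2 product is the graph of a
    small off-diagonal operator: with [Q = 1 - P], there is a unique antihermitian [H]
    with [H P + P H = H] such that [T = (1 + H) P (1 + H)^-1], and its lower left block
    is [Q T P (P T P + Q (1 - T) Q)^-1].  This formula makes sense for every bounded
    operator [T] close to [P]; together with [T - (1 + H) P (1 + H)^-1], stripped of its
    lower left block, it gives a chart of B(H1) at [P] that flattens the Grassmannian.
    The adjoint for the L2 product of an arbitrary operator of B(H1) need not exist;
    only the one of [Q X P], of finite rank, is used, and it is bounded in [X] because
    the range of [P] consists of H1 functions.  In the exponential charts of the group
    the derivative of the orbit map at [U] is [X |-> offdiag (U X U^-1)], and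
    [H |-> U^-1 H U] is a bounded right inverse of it, whence the splitting.
    That the L2 product is definite on pairs (u, weak gradient of u) is the uniqueness of
    weak derivatives, for which products of smooth bumps suffice. *)

(** * Analytic maps between normed spaces *)

(** Analyticity is a convergent expansion by multilinear terms at each point, and the explicit maps
    are built from bounded linear and bilinear maps, inversion and the exponential. The hard
    analytic step is therefore the chain rule, a rearrangement of series controlled by counting
    compositions of integers. [analytic_diff] keeps the linear term with the expansion, so the same
    calculus computes the differentials needed for submersions. The exponential charts are used at
    their centres, where the coordinate is 0; only the expansion of exp at 0 and the triviality of
    small solutions of exp X = 1 enter. The flattening chart has an explicit inverse, so its image
    is open without any inverse function theorem. The inverses in its formula come from Neumann
    series, hence from the completeness of B(H1), which rests on Riesz-Fischer and on the closedness
    of the weak gradient. Transitivity is a finite-dimensional matter: the ranges have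
    L2-orthonormal bases made of H1 functions, and reflections that differ from 1 by a rank one
    operator carry one basis to another. *)

Section Tannery.
Variables (R : realType) (F : normedModType R).

Lemma geometric_tail (a : R) (m n : nat) : 0 <= a -> a <= 2^-1 ->
  \sum_(m <= k < n) a ^+ k <= 2 * a ^+ m.
Proof.
move=> a0 a1; have [nm|mn] := leqP n m.
  by rewrite big_geq// mulr_ge0// exprn_ge0.
have /subnKC <- := ltnW mn; move: (n - m)%N => d.
(* The subtracted term makes the induction close: since a is at most 1/2, [a ^+ n] is at most
   [2 * a ^+ n - 2 * a ^+ n.+1]. *)
suff: \sum_(m <= k < m + d) a ^+ k <= 2 * a ^+ m - 2 * a ^+ (m + d).
  by move=> /le_trans; apply; rewrite gerBl mulr_ge0// exprn_ge0.
elim: d => [|d IH]; first by rewrite addn0 big_geq// subrr.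
rewrite addnS big_nat_recr ?leq_addr//=.
have := exprn_ge0 (m + d) a0; rewrite exprS.
move: (a ^+ (m + d)) (a ^+ m) (\sum_(_ <= _ < _) _) IH => x y z H x0.
have : a * x <= 2^-1 * x by rewrite ler_wpM2r.
lra.
Qed.

(** Dominated convergence for series whose truncation grows with n: the geometric bound makes the
    tail small uniformly in n, and finitely many terms converge one by one. In the chain rule m
    counts arguments and n truncates the degree. *)
Lemma cvg_tannery (u : nat -> nat -> F) (l : nat -> F) (L : F) (C a : R) :
  0 <= C -> 0 <= a -> a < 1 ->
  (forall m n, `|u m n| <= C * a ^+ m) ->
  (forall m, u m n @[n --> \oo] --> l m) ->
  (\sum_(m < n) l m) @[n --> \oo] --> L ->
  (\sum_(m < n) u m n) @[n --> \oo] --> L.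
Proof.
move=> C0 a0 a1 ub ul lL.
have lb m : `|l m| <= C * a ^+ m.
  apply: (@closed_cvg _ _ _ _ (fun n => u m n) [set x | `|x| <= C * a ^+ m]) (ul m).
    by apply: (@preimage_closed _ _ (@Num.norm R F) [set y | y <= C * a ^+ m]);
      [move=> x _; exact: norm_continuous|exact: closed_le].
  by apply: nearW => n; exact: ub.
have H : (\sum_(m < n) (u m n - l m)) @[n --> \oo] --> (0 : F).
  apply/cvgrPdist_le => e e0.
  have S : (C * 2 * (a ^+ n / (1 - a))) @[n --> \oo] --> (0 : R).
    have -> : 0 = C * 2 * (0 / (1 - a)) by rewrite mul0r mulr0.
    by apply: cvgMr; apply: cvgMl; apply: cvg_expr; rewrite ger0_norm.
  have e2 : 0 < e / 2 by rewrite divr_gt0.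
  have [K _ KP] := (cvgrPdist_lt _ _ ).1 S _ e2.
  have HK : (\sum_(m < K) `|u m n - l m|) @[n --> \oo] --> (0 : R).
    rewrite [X in _ --> X](_ : 0 = \sum_(m < K) 0); last by rewrite big1.
    apply: cvg_big => [|m _]; first exact: add_continuous.
    rewrite -(normr0 F); apply: cvg_norm.
    rewrite -(subrr (l m)); apply: cvgB => //; exact: cvg_cst.
  have [K1 _ KP1] := (cvgrPdist_lt _ _ ).1 HK _ e2.
  near=> n.
  rewrite sub0r normrN (le_trans (ler_norm_sum _ _ _))//.
  have Kn : (K <= n)%N by near: n; exists K.
  have -> : \sum_(m < n) `|u m n - l m| =
      \sum_(m < K) `|u m n - l m| + \sum_(K <= m < n) `|u m n - l m|.
    by rewrite -!(big_mkord xpredT (fun m => `|u m n - l m|)) -big_cat_nat.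
  rewrite [e]splitr lerD//.
    have : `|0 - \sum_(m < K) `|u m n - l m| | < e / 2.
      by apply: KP1 => /=; near: n; exists K1.
    by rewrite sub0r normrN => /ltW; apply: le_trans; exact: ler_norm.
  apply: (@le_trans _ _ (\sum_(K <= m < n) (C * 2 * a ^+ m))).
    apply: ler_sum_nat => m _; rewrite (le_trans (ler_normB _ _))//.
    by rewrite mulr2n [leRHS](_ : _ = C * a ^+ m + C * a ^+ m) ?lerD//; lra.
  rewrite -mulr_sumr; have := KP K (leqnn K).
  rewrite sub0r normrN => /ltW; apply: le_trans; apply: le_trans (ler_norm _).
  rewrite ler_wpM2l ?mulr_ge0//.
  have /subnKC <- := Kn; move: (n - K)%N => d.
  rewrite -{1}[K]add0n big_addn addKn.
  under eq_bigr do rewrite exprD mulrC.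
  rewrite -mulr_sumr ler_wpM2l ?exprn_ge0//.
  have d1 : 0 < 1 - a by rewrite subr_gt0.
  rewrite big_mkord -(mul1r (_^-1)) ler_pdivlMr// mulrC.
  have -> : (1 - a) * (\sum_(i < d) a ^+ i) = 1 - a ^+ d.
    by rewrite -[in RHS](expr1n _ d) subrXX; congr (_ * _); apply: eq_bigr => i _; rewrite expr1n mul1r.
  by rewrite gerBl exprn_ge0.
rewrite -[L]add0r; apply: cvg_trans (cvgD H lL); apply: near_eq_cvg.
apply: nearW => n; rewrite [RHS](_ : _ = \sum_(m < n) (u m n - l m) + \sum_(m < n) l m)//.
by rewrite -big_split /=; apply: eq_bigr => i _; rewrite subrK.
Unshelve. all: by end_near.
Qed.

Lemma cvg_eventually (T : topologicalType) (u : nat -> T) (l : T) k :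
  (forall n, u (k + n)%N = l) -> u n @[n --> \oo] --> l.
Proof.
move=> H; apply: (cvg_trans (G := cst l n @[n --> \oo])); last exact: cvg_cst.
by apply: near_eq_cvg; exists k => // n /= kn; rewrite -(subnKC kn) H.
Qed.

End Tannery.

(** * Power series and analyticity with a given linear term *)

Section PowerSeries.
Variable R : realType.

(* The k-th term of a power series is a function of sequences that only reads their
   first k entries; this avoids casts between the types 'I_k. *)
Definition upd (E : Type) (h : nat -> E) (p : nat) (w : E) : nat -> E :=
  fun j => if j == p then w else h j.

Definition mlin (E F : normedModType R) (k : nat) (a : (nat -> E) -> F) :=
  (forall p h (c : R) u v, (p < k)%N ->
     a (upd h p (c *: u + v)) = c *: a (upd h p u) + a (upd h p v)) /\
  (forall h h', (forall j, (j < k)%N -> h j = h' j) -> a h = a h').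

Definition pseries (E F : normedModType R) (f : E -> F) (x : E)
    (a : nat -> (nat -> E) -> F) (M r : R) :=
  [/\ 0 <= M /\ 0 < r, forall k, mlin k (a k),
      forall k h, `|a k h| <= M * \prod_(i < k) (`|h i| / r) &
      forall h, `|h| < r -> (\sum_(k < n) a k (fun=> h)) @[n --> \oo] --> f (x + h)].

(* [f] is analytic at [x] with derivative [L]. *)
Definition analytic_diff (E F : normedModType R) (f : E -> F) (x : E) (L : E -> F) :=
  exists a M r, pseries f x a M r /\ forall h, a 1 (fun=> h) = L h.

Lemma analytic_diff_at (E F : normedModType R) (f : E -> F) x L :
  analytic_diff f x L -> analytic_at f x.
Proof.
move=> [a [M [r [[[M0 r0] am ab ac] _]]]].
(* Extension by 0 beyond k; the second half of [mlin] makes the choice of the extension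
   irrelevant. *)
pose ext k (h : 'I_k -> E) j := if insub j is Some i then h i else 0.
have extE k (h : 'I_k -> E) (i : 'I_k) : ext k h i = h i by rewrite /ext valK.
exists (fun k h => a k (ext k h)), M, r; split => //.
- move=> k i h c u v /=.
  have E1 w : a k (ext k (fun j => if j == i then w else h j)) = a k (upd (ext k h) i w).
    apply: (am k).2 => j jk; rewrite -[j]/(val (Ordinal jk)) extE /upd extE.
    by rewrite -val_eqE.
  by rewrite !E1; exact: (am k).1.
- move=> k h; rewrite (le_trans (ab k _))// ler_wpM2l// le_eqVlt; apply/orP; left.
  by apply/eqP; apply: eq_bigr => i _; rewrite extE.
- move=> h hr; apply: cvg_trans (ac h hr); apply: near_eq_cvg; apply: nearW => n.
  apply: eq_bigr => k _; apply: (am k).2 => j jk.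
  by rewrite -[j]/(val (Ordinal jk)) extE.
Qed.

Lemma analytic_at_diff (E F : normedModType R) (f : E -> F) x :
  analytic_at f x -> exists L, analytic_diff f x L.
Proof.
move=> [a [M [r [r0 am ab ac]]]].
exists (fun h => a 1 (fun=> h)), (fun k h => a k (fun i : 'I_k => h i)), `|M|, r.
split => //; split=> //.
- move=> k; split=> [p h c u v pk|h h' hh].
    have := am k (Ordinal pk) (fun i => h i) c u v => /=.
    have E1 w : a k (fun j => if j == Ordinal pk then w else h j) =
       a k (fun i => upd h p w i).
      by congr (a k _); apply/funext => j; rewrite /upd -val_eqE.
    by rewrite !E1.
  by congr (a k _); apply/funext => j; exact: hh.
- move=> k h; rewrite (le_trans (ab k _))// ler_wpM2r ?ler_norm//.
  by apply: prodr_ge0 => i _; rewrite divr_ge0// ltW.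
Qed.

Lemma analytic_diff_near (E F : normedModType R) (f g : E -> F) x L :
  (\forall y \near x, f y = g y) -> analytic_diff f x L -> analytic_diff g x L.
Proof.
move=> /nbhs_ballP[e /= e0 fg] [a [M [r [[[M0 r0] am ab ac] aL]]]].
exists a, M, (Num.min r e); split=> //; split => //.
- by rewrite lt_min r0 e0.
- move=> k h; rewrite (le_trans (ab k _))// ler_wpM2l//; apply: ler_prod => i _.
  rewrite divr_ge0 ?(ltW r0)//= ler_wpM2l// lef_pV2 ?ge_min ?lexx// posrE//.
  by rewrite lt_min r0 e0.
- move=> h; rewrite lt_min => /andP[hr he]; rewrite -fg; first exact: ac.
  by rewrite -ball_normE /= opprD addrA subrr sub0r normrN.
Qed.

Lemma analytic_diff_eq (E F : normedModType R) (f : E -> F) x L L' :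
  L =1 L' -> analytic_diff f x L -> analytic_diff f x L'.
Proof.
by move=> LL' [a [M [r [H aL]]]]; exists a, M, r; split=> // h; rewrite aL LL'.
Qed.

End PowerSeries.

(** * Composition of power series *)

Section Composition.
Variables (R : realType) (E F G : normedModType R).

Definition scons (T : Type) (x : T) (w : nat -> T) : nat -> T :=
  fun j => if j is j'.+1 then w j' else x.

(* The part of degree [n] of [phi (f h - f 0, .., f h - f 0)] ([m] arguments), where
   [f] has Taylor coefficients [a]: a sum over the compositions of [n] in [m] parts. *)
Fixpoint comp_term (a : nat -> (nat -> E) -> F) (m n : nat)
    (phi : (nat -> F) -> G) (h : nat -> E) : G :=
  if m is m'.+1 then
    \sum_(k < n) comp_term a m' (n - k.+1)
      (fun w => phi (scons (a k.+1 h) w)) (fun j => h (k.+1 + j)%N)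
  else if n is 0 then phi (fun=> 0) else 0.

Lemma mlin_scons m (phi : (nat -> F) -> G) x : mlin m.+1 phi ->
  mlin m (fun w => phi (scons x w)).
Proof.
move=> [l d]; split=> [p h c u v pm|h h' hh]; last by apply: d => -[|j]//= jm; exact: hh.
have E1 w : scons x (upd h p w) = upd (scons x h) p.+1 w.
  by apply/funext => -[|j].
by rewrite !E1 l.
Qed.

Lemma mlin_head m (phi : (nat -> F) -> G) w c u v : mlin m.+1 phi ->
  phi (scons (c *: u + v) w) = c *: phi (scons u w) + phi (scons v w).
Proof.
move=> [l _]; have E1 x : scons x w = upd (scons 0 w) 0 x.
  by apply/funext => -[|j].
by rewrite (E1 u) (E1 v) (E1 (_ + _)) l.
Qed.

(** The parts are positive, so n has no composition in more than n parts. *)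
Lemma comp_term_lt a m n phi h : (n < m)%N -> comp_term a m n phi h = 0.
Proof.
elim: m n phi h => [//|m IH] n phi h nm /=.
by apply: big1 => k _; apply: IH; have := ltn_ord k; lia.
Qed.

Lemma comp_term_lin a m n phi psi c h :
  comp_term a m n (fun w => c *: phi w + psi w) h =
  c *: comp_term a m n phi h + comp_term a m n psi h.
Proof.
elim: m n phi psi h => [|m IH] [|n] phi psi h //=; rewrite ?big_ord0 ?scaler0 ?addr0//.
rewrite scaler_sumr -big_split /=; apply: eq_bigr => k _; exact: IH.
Qed.

Variables (a : nat -> (nat -> E) -> F).
Hypothesis am : forall k, mlin k (a k).

Lemma comp_term_mlin m n phi : mlin m phi -> mlin n (comp_term a m n phi).
Proof.
elim: m n phi => [|m IH] n phi phim; first by case: n => [|n]; split=> //= *; rewrite scaler0 addr0.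
split=> [p h c u v pn|h h' hh] /=; last first.
  apply: eq_bigr => k _; have kn := ltn_ord k.
  have -> : a k.+1 h = a k.+1 h' by apply: (am k.+1).2 => j jk; apply: hh; lia.
  by apply: (IH _ _ (mlin_scons _ phim)).2 => j jk; apply: hh; lia.
rewrite scaler_sumr -big_split /=; apply: eq_bigr => k _; have kn := ltn_ord k.
(* The slot p lies either in the first block, read by [a k.+1], or in one of the later blocks,
   handled by induction. *)
have [pk|kp] := ltnP p k.+1.
  have E1 w : (fun j => upd h p w (k.+1 + j)%N) = (fun j => h (k.+1 + j)%N).
    by apply/funext => j; rewrite /upd ifN_eq//; lia.
  rewrite !E1 -comp_term_lin; congr comp_term; apply/funext => w.
  by rewrite (am k.+1).1// (mlin_head _ _ _ _ phim).
have E1 w : (fun j => upd h p w (k.+1 + j)%N) = upd (fun j => h (k.+1 + j)%N) (p - k.+1) w.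
  apply/funext => j; rewrite /upd; congr (if _ then _ else _); apply/eqP/eqP; lia.
have E2 w : a k.+1 (upd h p w) = a k.+1 h.
  by apply: (am k.+1).2 => j jk; rewrite /upd ifN_eq//; lia.
by rewrite !E1 !E2; apply: (IH _ _ (mlin_scons _ phim)).1; lia.
Qed.

Variables M r s : R.
Hypotheses (M0 : 0 <= M) (r0 : 0 < r) (s0 : 0 < s)
  (ab : forall k h, `|a k h| <= M * \prod_(i < k) (`|h i| / r)).

(** Each of the m parts contributes M, from the bound on [a], and 1 / s, from the bound on [phi].
    The factor [2 ^+ n] dominates the number of compositions of n. *)
Lemma comp_term_bound m n (phi : (nat -> F) -> G) (C : R) h : 0 <= C ->
  (forall w, `|phi w| <= C * \prod_(i < m) (`|w i| / s)) ->
  `|comp_term a m n phi h| <= C * (M / s) ^+ m * 2 ^+ n * \prod_(i < n) (`|h i| / r).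
Proof.
elim: m n phi C h => [|m IH] n phi C h C0 phib /=.
  case: n => [|n] /=; first by rewrite !expr0 !mulr1 big_ord0 mulr1 (le_trans (phib _))// big_ord0 mulr1.
  rewrite normr0 !mulr_ge0 ?exprn_ge0 ?divr_ge0 ?(ltW s0)//.
  by apply: prodr_ge0 => i _; rewrite divr_ge0// ltW.
have P0 (q : nat) (g : nat -> E) : 0 <= \prod_(i < q) (`|g i| / r).
  by apply: prodr_ge0 => i _; rewrite divr_ge0// ltW.
have Ms0 : 0 <= M / s by rewrite divr_ge0// ltW.
apply: le_trans (ler_norm_sum _ _ _) _.
apply: (@le_trans _ _ (\sum_(k < n) (C * (M / s) ^+ m.+1 * \prod_(i < n) (`|h i| / r)) * 2 ^+ (n - k.+1))).
  apply: ler_sum => k _; have kn := ltn_ord k.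
  apply: le_trans (IH _ _ (C * (`|a k.+1 h| / s)) _ _ _) _.
  - by rewrite mulr_ge0// divr_ge0// ltW.
  - move=> w; apply: le_trans (phib _) _; rewrite big_ord_recl /= [leLHS]mulrA.
    by [].
  have -> : \prod_(i < n) (`|h i| / r) = \prod_(i < k.+1) (`|h i| / r) *
      \prod_(i < n - k.+1) (`|h (k.+1 + i)%N| / r).
    rewrite -!(big_mkord xpredT (fun i => `|h i| / r)) (big_cat_nat (n := k.+1))//=.
    congr (_ * _); rewrite -{1}[k.+1]add0n big_addn big_mkord.
    by apply: eq_bigr => i _; rewrite addnC.
  rewrite [leLHS](_ : _ = (C * ((M / s) ^+ m * (2 ^+ (n - k.+1) *
    \prod_(i < n - k.+1) (`|h (k.+1 + i)%N| / r)))) * (`|a k.+1 h| / s)); last by ring.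
  rewrite [leRHS](_ : _ = (C * ((M / s) ^+ m * (2 ^+ (n - k.+1) *
    \prod_(i < n - k.+1) (`|h (k.+1 + i)%N| / r)))) *
      (M * \prod_(i < k.+1) (`|h i| / r) / s)); last by rewrite exprS; ring.
  apply: ler_wpM2l; first by rewrite !mulr_ge0 ?exprn_ge0 ?(P0 _ (fun i => h (k.+1 + i)%N)).
  by rewrite ler_wpM2r ?ab// invr_ge0 ltW.
rewrite -mulr_sumr [leRHS]mulrAC ler_wpM2l ?mulr_ge0 ?exprn_ge0 ?P0//.
suff -> : \sum_(k < n) (2 : R) ^+ (n - k.+1) = 2 ^+ n - 1 by rewrite gerBl.
elim: n {IH} => [|n IHn]; first by rewrite big_ord0 expr0 subrr.
rewrite big_ord_recl /= subn1 /= -/(bump _ _).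
under eq_bigr do rewrite /bump /= add1n subSS.
by rewrite IHn exprS; lra.
Qed.

(** Regroups the compositions of all n < N by the size k.+1 of their first part, which leaves a
    total degree below N - k.+1. *)
Lemma comp_term_triangle m phi x N :
  \sum_(n < N) comp_term a m.+1 n phi (fun=> x) =
  \sum_(k < N) \sum_(j < N - k.+1) comp_term a m j (fun w => phi (scons (a k.+1 (fun=> x)) w)) (fun=> x).
Proof.
elim: N => [|N IH]; first by rewrite !big_ord0.
rewrite big_ord_recr IH [RHS]big_ord_recr /= subnn [X in _ = _ + X]big_ord0 addr0.
rewrite -big_split /=; apply: eq_bigr => k _; have kN := ltn_ord k.
by rewrite subSn// big_ord_recr.
Qed.

Lemma comp_term_cst_bound m n (phi : (nat -> F) -> G) (C : R) x (t : R) : 0 <= C ->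
  `|x : E| / r = t ->
  (forall w, `|phi w| <= C * \prod_(i < m) (`|w i| / s)) ->
  `|comp_term a m n phi (fun=> x)| <= C * (M / s) ^+ m * (2 * t) ^+ n.
Proof.
move=> C0 tE phib; apply: le_trans (comp_term_bound n (fun=> x) C0 phib) _.
by rewrite prodr_const card_ord tE [(2 * t) ^+ n]exprMn -!mulrA.
Qed.

(** Only degrees n >= m contribute, so the sum is a geometric tail starting at m. The resulting
    bound is uniform in N and geometric in m: it is the domination that Tannery's theorem asks
    for. *)
Lemma comp_term_partial m N (phi : (nat -> F) -> G) (C : R) x (t : R) : 0 <= C ->
  `|x : E| / r = t -> 2 * t <= 2^-1 ->
  (forall w, `|phi w| <= C * \prod_(i < m) (`|w i| / s)) ->
  `|\sum_(n < N) comp_term a m n phi (fun=> x)| <= 2 * C * ((M / s) * (2 * t)) ^+ m.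
Proof.
move=> C0 tE t1 phib.
have t0 : 0 <= 2 * t by rewrite -tE mulr_ge0// divr_ge0// ltW.
have Ms0 : 0 <= M / s by rewrite divr_ge0// ltW.
apply: le_trans (ler_norm_sum _ _ _) _.
have [Nm|mN] := leqP N m.
  rewrite big1; first by apply: mulr_ge0; rewrite ?exprn_ge0 ?(mulr_ge0 Ms0)// mulr_ge0.
  by move=> i _; rewrite comp_term_lt ?normr0// (leq_trans (ltn_ord i)).
rewrite -(big_mkord xpredT (fun n => `|comp_term a m n phi (fun=> x)|)).
rewrite (big_cat_nat (n := m)) ?(ltnW mN)//= big_nat big1 ?add0r; last first.
  by move=> i /andP[_ im]; rewrite comp_term_lt ?normr0.
apply: (@le_trans _ _ (\sum_(m <= n < N) (C * (M / s) ^+ m * (2 * t) ^+ n))).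
  by apply: ler_sum_nat => n _; exact: comp_term_cst_bound.
rewrite -mulr_sumr [(_ * (2 * t)) ^+ m]exprMn [leRHS](_ : _ = C * (M / s) ^+ m * (2 * (2 * t) ^+ m)); last by ring.
by rewrite ler_wpM2l ?mulr_ge0 ?exprn_ge0// geometric_tail.
Qed.

(** Induction on the number of arguments: grouping by the first part leaves inner series with one
    argument fewer, and Tannery's theorem exchanges their limits with the sum over the first part.
    Linearity and continuity in the first slot then sum the [a k.+1] to y. *)
Lemma comp_term_cvg m (phi : (nat -> F) -> G) (C : R) x y (t : R) : mlin m phi ->
  0 <= C -> `|x : E| / r = t -> 2 * t <= 2^-1 ->
  (forall w, `|phi w| <= C * \prod_(i < m) (`|w i| / s)) ->
  (\sum_(k < n) a k.+1 (fun=> x)) @[n --> \oo] --> y ->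
  (\sum_(n < N) comp_term a m n phi (fun=> x)) @[N --> \oo] --> phi (fun=> y).
Proof.
move=> + + tE t1 + ay; have t0 : 0 <= t by rewrite -tE divr_ge0// ltW.
have Ms0 : 0 <= M / s by rewrite divr_ge0// ltW.
have abx k : `|a k.+1 (fun=> x)| <= M * t ^+ k.+1.
  by rewrite (le_trans (ab _ _))// prodr_const card_ord tE.
elim: m phi C => [|m IH] phi C phim C0 phib.
  have -> : phi (fun=> y) = phi (fun=> 0) by apply: phim.2.
  by apply: (@cvg_eventually _ _ _ 1) => n; rewrite big_ord_recl /= big1 ?addr0.
under eq_cvg do rewrite comp_term_triangle.
have phib' k w : `|phi (scons (a k.+1 (fun=> x)) w)| <=
    C * (M * t ^+ k.+1 / s) * \prod_(i < m) (`|w i| / s).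
  rewrite (le_trans (phib _))// big_ord_recl /= [leLHS]mulrA.
  apply: ler_wpM2r.
    by apply: prodr_ge0 => i _; rewrite divr_ge0// ltW.
  by rewrite ler_wpM2l// ler_wpM2r// invr_ge0 ltW.
have cb k : 0 <= C * (M * t ^+ k.+1 / s).
  by rewrite mulr_ge0// divr_ge0// ?(ltW s0)// mulr_ge0// exprn_ge0.
(* [q * t ^+ k] is the bound of [comp_term_partial] once the first argument is fixed to [a k.+1],
   which turns the constant C into [C * (M * t ^+ k.+1 / s)]. *)
pose q := 2 * (C * (M / s) * t) * ((M / s) * (2 * t)) ^+ m.
have q0 : 0 <= q by rewrite /q mulr_ge0 ?exprn_ge0 ?(mulr_ge0 Ms0)// mulr_ge0// mulr_ge0// mulr_ge0.
apply: (@cvg_tannery R G (fun k N => \sum_(j < N - k.+1) comp_term a m j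
    (fun w => phi (scons (a k.+1 (fun=> x)) w)) (fun=> x))
    (fun k => phi (scons (a k.+1 (fun=> x)) (fun=> y))) _ q t) => //.
- by lra.
- move=> k N; apply: le_trans (comp_term_partial (N - k.+1) (cb k) tE t1 (phib' k)) _.
  by rewrite /q exprS le_eqVlt; apply/orP; left; apply/eqP; ring.
- move=> k; have := IH _ _ (mlin_scons (a k.+1 (fun=> x)) phim) (cb k) (phib' k).
  move=> H; apply: (cvg_comp _ _ _ H); apply/cvgnyPge => A; near=> N.
  have : (A + k.+1 <= N)%N by near: N; exists (A + k.+1)%N.
  by lia.
have lin N : \sum_(k < N) phi (scons (a k.+1 (fun=> x)) (fun=> y)) =
    phi (scons (\sum_(k < N) a k.+1 (fun=> x)) (fun=> y)).
  elim: N => [|N IHN].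
    have := mlin_head (fun=> y) (-1) 0 0 phim.
    by rewrite scaler0 addr0 scaleN1r addNr !big_ord0.
  rewrite !big_ord_recr IHN /=.
  have := mlin_head (fun=> y) 1 (\sum_(k < N) a k.+1 (fun=> x)) (a N.+1 (fun=> x)) phim.
  by rewrite !scale1r.
under eq_cvg do rewrite lin.
have -> : phi (fun=> y) = phi (scons y (fun=> y)) by congr phi; apply/funext => -[|j].
pose D := C * ((\prod_(i < m) (`|y| / s)) / s).
have D0 : 0 <= D.
  rewrite mulr_ge0// divr_ge0// ?(ltW s0)//; apply: prodr_ge0 => i _.
  by rewrite divr_ge0// ltW.
have lip u v : `|phi (scons u (fun=> y)) - phi (scons v (fun=> y))| <= D * `|u - v|.
  have <- : phi (scons (u - v) (fun=> y)) = phi (scons u (fun=> y)) - phi (scons v (fun=> y)).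
    have := mlin_head (fun=> y) (-1) v u phim.
    by rewrite !scaleN1r ![- _ + _]addrC.
  rewrite (le_trans (phib _))// big_ord_recl /= /D le_eqVlt; apply/orP; left; apply/eqP; ring.
apply/cvgrPdist_le => e e0.
have eD : 0 < e / (D + 1) by rewrite divr_gt0// ltr_wpDl.
near=> N; rewrite (le_trans (lip _ _))//.
have : `|y - \sum_(k < N) a k.+1 (fun=> x)| <= e / (D + 1).
  by near: N; apply: (cvgrPdist_le _ _).1 ay _ eD.
move=> /(ler_wpM2l D0)/le_trans; apply.
rewrite mulrA ler_pdivrMr ?ltr_wpDl// mulrC ler_wpM2l ?(ltW e0)//; lra.
Unshelve. all: by end_near.
Qed.

End Composition.

(** * Calculus of analytic maps *)

Section AnalyticCalculus.
Variable R : realType.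
Implicit Types E F G : normedModType R.

Lemma cvg_norm_le F (u : nat -> F) (l : F) (B : R) k :
  (forall n, `|u (k + n)%N| <= B) -> u n @[n --> \oo] --> l -> `|l| <= B.
Proof.
move=> uB ul; apply: (@closed_cvg _ _ _ _ u [set z | `|z| <= B] _ _ _ ul).
  apply: (@preimage_closed _ _ (@Num.norm R F) [set y | y <= B]); last exact: closed_le.
  by move=> z _; exact: norm_continuous.
by exists k => // n /= kn; rewrite -(subnKC kn).
Qed.

Lemma pseries_weaken E F (f : E -> F) x a M r M' r' : M <= M' -> 0 < r' -> r' <= r ->
  pseries f x a M r -> pseries f x a M' r'.
Proof.
move=> MM' r'0 r'r [[M0 r0] am ab ac]; split=> //; first by split=> //; exact: le_trans MM'.
  have P0 (q : R) k (g : nat -> E) : 0 < q -> 0 <= \prod_(i < k) (`|g i| / q).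
    by move=> q0; apply: prodr_ge0 => i _; rewrite divr_ge0// ltW.
  move=> k h; rewrite (le_trans (ab k h))// ler_pM ?P0//.
  apply: ler_prod => i _; rewrite divr_ge0 ?(ltW r0)//= ler_wpM2l// lef_pV2// posrE.
by move=> h hr; apply: ac; exact: lt_le_trans r'r.
Qed.

Lemma pseries0 E F (f : E -> F) x a M r h : pseries f x a M r -> a 0 h = f x.
Proof.
move=> [[M0 r0] am ab ac].
have {ac} := ac 0; rewrite normr0 addr0 => /(_ r0) ac.
have -> : a 0 h = a 0 (fun=> 0) by apply: (am 0%N).2.
apply: (cvg_unique _ _ ac) => //.
apply: (@cvg_eventually _ _ _ 1) => n; rewrite big_ord_recl /= big1 ?addr0// => i _.
apply/eqP; rewrite -normr_eq0 eq_le normr_ge0 andbT (le_trans (ab _ _))//.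
by rewrite big_ord_recl normr0 !mul0r mulr0.
Qed.

Lemma pseries_cvg_shift E F (f : E -> F) x a M r h : pseries f x a M r -> `|h| < r ->
  (\sum_(k < n) a k.+1 (fun=> h)) @[n --> \oo] --> f (x + h) - f x.
Proof.
move=> S hr; have [_ _ _ /(_ _ hr)] := S.
rewrite -cvg_shiftS => H.
have {}H : (\sum_(k < n.+1) a k (fun=> h) - f x) @[n --> \oo] --> f (x + h) - f x.
  by apply: cvgB => //; exact: cvg_cst.
apply: cvg_trans H; apply: near_eq_cvg; apply: nearW => n.
by rewrite big_ord_recl (pseries0 (fun=> h) S) addrAC subrr add0r.
Qed.

Lemma analytic_diff_taylor E F (f : E -> F) x L : analytic_diff f x L ->
  exists2 C, 0 <= C & exists2 d, 0 < d & forall h, `|h| < d ->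
    `|f (x + h) - f x - L h| <= C * `|h| ^+ 2.
Proof.
move=> [a [M [r [S aL]]]]; have [[M0 r0] am ab ac] := S.
(* On the radius r / 2 the ratio t = |h| / r is at most 1/2, so the terms of degree at least 2 sum
   to at most [2 * M * t ^+ 2]. *)
exists (2 * M / r ^+ 2); first by rewrite divr_ge0 ?mulr_ge0 ?exprn_ge0// ltW.
exists (r / 2); first by rewrite divr_gt0.
move=> h hr; have hr1 : `|h| < r by apply: lt_le_trans hr _; lra.
pose t := `|h| / r; have t0 : 0 <= t by rewrite divr_ge0// ltW.
have t1 : t <= 2^-1 by rewrite ler_pdivrMr// mulrC ltW.
have := pseries_cvg_shift S hr1 => H.
have {}H : (\sum_(k < n) a k.+1 (fun=> h) - L h) @[n --> \oo] --> f (x + h) - f x - L h.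
  by apply: cvgB => //; exact: cvg_cst.
apply: (cvg_norm_le (k := 1) _ H) => n.
rewrite big_ord_recl /= aL addrAC subrr add0r.
apply: le_trans (ler_norm_sum _ _ _) _.
apply: (@le_trans _ _ (M * \sum_(2 <= k < n.+2) t ^+ k)).
  rewrite (big_addn 0 _ 2) subn2 /= big_mkord mulr_sumr; apply: ler_sum => k _.
  by rewrite (le_trans (ab _ _))// prodr_const card_ord addn2.
rewrite [leRHS](_ : _ = M * (2 * t ^+ 2)); last first.
  by rewrite /t exprMn exprVn; ring.
by rewrite ler_wpM2l// geometric_tail.
Qed.

Lemma analytic_diff_bounded E F (f : E -> F) x L : analytic_diff f x L ->
  (forall (c : R) u v, L (c *: u + v) = c *: L u + L v) /\
  exists2 C, 0 <= C & forall h, `|L h| <= C * `|h|.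
Proof.
move=> [a [M [r [[[M0 r0] am ab ac] aL]]]]; split.
  move=> c u v; rewrite -!aL.
  have E1 w : a 1 (fun=> w) = a 1 (upd (fun=> 0) 0 w) by apply: (am 1%N).2 => -[].
  by rewrite !E1 (am 1%N).1.
exists (M / r); first by rewrite divr_ge0// ltW.
by move=> h; rewrite -aL (le_trans (ab _ _))// big_ord1 mulrCA mulrC.
Qed.

Lemma analytic_diff_continuous E F (f : E -> F) x L :
  analytic_diff f x L -> {for x, continuous f}.
Proof.
move=> H; have [C C0 [d d0 Hd]] := analytic_diff_taylor H.
have [_ [D D0 HD]] := analytic_diff_bounded H.
apply/cvgrPdist_le => e e0.
have q0 : 0 < C + D + 1 by rewrite ltr_wpDl// addr_ge0.
apply/nbhs_ballP; exists (Num.min (Num.min d 1) (e / (C + D + 1))) => /=.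
  by rewrite !lt_min d0 ltr01 divr_gt0.
move=> y; rewrite -ball_normE /= !lt_min distrC => /andP[/andP[yd y1] ye].
have -> : y = x + (y - x) by rewrite addrC subrK.
move: (y - x) yd y1 ye => h hd h1 he; rewrite distrC.
have -> : f (x + h) - f x = (f (x + h) - f x - L h) + L h by rewrite subrK.
rewrite (le_trans (ler_normD _ _))// (le_trans (lerD (Hd _ hd) (HD _)))//.
apply: (@le_trans _ _ ((C + D + 1) * `|h|)); last first.
  by rewrite mulrC -ler_pdivlMr// ltW.
rewrite !mulrDl mul1r -addrA lerD//.
  by rewrite ler_wpM2l// expr2 ler_piMl// ltW.
by rewrite lerDl.
Qed.

(** Identifies the linear term of an expansion with the differential ['d] that [submersion] is
    stated with; the quadratic remainder of [analytic_diff_taylor] gives it. *)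
Lemma analytic_diff_diff E F (f : E -> F) x L : analytic_diff f x L -> 'd f x =1 L.
Proof.
move=> H; have [C C0 [d d0 Hd]] := analytic_diff_taylor H.
have [lL [D D0 HD]] := analytic_diff_bounded H.
pose L1 : {linear E -> F} := HB.pack L (GRing.isLinear.Build R E F *:%R L lL).
have cL : continuous L1.
  apply/linear_bounded_continuous; apply/bounded_funP => r; exists (D * `|r|) => z zr.
  by rewrite (le_trans (HD z))// ler_wpM2l// (le_trans zr)// ler_norm.
move=> h; rewrite -[RHS]/(L1 h); congr (_ h); apply: diff_unique => //.
apply/eqaddoP => e e0; apply/nbhs_ballP.
exists (Num.min d (e / (C + 1))) => /=; first by rewrite lt_min d0 divr_gt0// ltr_wpDl.
move=> y; rewrite -ball_normE /= sub0r normrN lt_min => /andP[yd ye].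
have := Hd y yd; rewrite -[(_ - (_ + _)) y]/(f (y + x) - (f x + L y)) opprD addrA [y + x]addrC => /le_trans; apply.
rewrite expr2 mulrA ler_wpM2r//.
rewrite (le_trans (ler_wpM2l C0 (ltW ye)))// mulrA ler_pdivrMr ?ltr_wpDl//.
by rewrite mulrC ler_wpM2l ?(ltW e0)//; lra.
Qed.

Lemma analytic_diff_lin E F (L : E -> F) C x :
  (forall (c : R) u v, L (c *: u + v) = c *: L u + L v) ->
  (forall h, `|L h| <= C * `|h|) -> analytic_diff L x L.
Proof.
move=> lL LC.
have L0 : L 0 = 0 by have := lL (-1) 0 0; rewrite scaler0 addr0 scaleN1r addNr.
exists (fun k h => match k with 0 => L x | 1 => L (h 0%N) | _ => 0 end),
  (Num.max `|C| `|L x|), 1; split => //; split=> //.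
- move=> [|[|k]]; split=> //=.
  + by move=> [|//] h c u v _; rewrite /upd /= lL.
  + by move=> h h' ->.
  + by move=> *; rewrite scaler0 addr0.
- move=> [|[|k]] h.
  + by rewrite big_ord0 mulr1 le_max lexx orbT.
  + rewrite big_ord1 divr1 (le_trans (LC _))// ler_wpM2r// le_max.
    by rewrite ler_norm.
  + rewrite normr0 mulr_ge0 ?le_max ?normr_ge0//; apply: prodr_ge0 => i _.
    by rewrite divr1.
- move=> h _; apply: (@cvg_eventually _ _ _ 2) => n; rewrite 2!big_ord_recl /= big1// addr0.
  by have := lL 1 x h; rewrite !scale1r.
Qed.

Lemma analytic_diff_cst E F (c : F) (x : E) : analytic_diff (fun=> c) x (fun=> 0).
Proof.
exists (fun k h => match k with 0 => c | _ => 0 end), `|c|, 1; split => //; split=> //.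
- by move=> [|k]; split=> //= *; rewrite scaler0 addr0.
- move=> [|k] h; first by rewrite big_ord0 mulr1.
  by rewrite normr0 mulr_ge0//; apply: prodr_ge0 => i _; rewrite divr1.
- move=> h _; apply: (@cvg_eventually _ _ _ 1) => n.
  by rewrite big_ord_recl /= big1// addr0.
Qed.

Lemma analytic_diff_pair E F G (f : E -> F) (g : E -> G) x L K :
  analytic_diff f x L -> analytic_diff g x K ->
  analytic_diff (fun y => (f y, g y)) x (fun h => (L h, K h)).
Proof.
move=> [a [M [r [S aL]]]] [b [N [s [T bK]]]].
have [[M0 r0] _ _ _] := S; have [[N0 s0] _ _ _] := T.
have m0 : 0 < Num.min r s by rewrite lt_min r0 s0.
have [||[[_ _] am ab ac]] := @pseries_weaken _ _ _ _ _ _ _ (Num.max M N) _ _ m0 _ S.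
  by rewrite le_max lexx.
  by rewrite ge_min lexx.
have [||[[_ _] bm bb bc]] := @pseries_weaken _ _ _ _ _ _ _ (Num.max M N) _ _ m0 _ T.
  by rewrite le_max lexx orbT.
  by rewrite ge_min lexx orbT.
exists (fun k h => (a k h, b k h)), (Num.max M N), (Num.min r s); split; last first.
  by move=> h; rewrite aL bK.
split=> //; first by rewrite le_max M0.
- move=> k; split=> [p h c u v pk|h h' hh].
    by rewrite (am k).1// (bm k).1.
  by rewrite ((am k).2 _ _ hh) ((bm k).2 _ _ hh).
- by move=> k h; rewrite prod_normE/= ge_max ab bb.
- move=> h hr.
  have -> : (fun n => \sum_(k < n) (a k (fun=> h), b k (fun=> h))) =
    (fun n => (\sum_(k < n) a k (fun=> h), \sum_(k < n) b k (fun=> h))).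
    apply/funext => n; elim: n => [|n IH]; first by rewrite !big_ord0.
    by rewrite !big_ord_recr IH.
  by apply: cvg_pair; [exact: ac|exact: bc].
Qed.

Lemma analytic_diff_bilin E F G (B : E -> F -> G) C (x : E * F) : 0 <= C ->
  (forall v (c : R) u u', B (c *: u + u') v = c *: B u v + B u' v) ->
  (forall u (c : R) v v', B u (c *: v + v') = c *: B u v + B u v') ->
  (forall u v, `|B u v| <= C * `|u| * `|v|) ->
  analytic_diff (fun p => B p.1 p.2) x (fun h => B x.1 h.2 + B h.1 x.2).
Proof.
move=> C0 lB rB BC; case: x => x y /=.
have n1 (h : E * F) : `|h.1| <= `|h| by rewrite prod_normE le_max lexx.
have n2 (h : E * F) : `|h.2| <= `|h| by rewrite prod_normE le_max lexx orbT.
have C1 u v u' v' : `|u| <= u' -> `|v| <= v' -> `|B u v| <= C * u' * v'.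
  move=> uu vv; rewrite (le_trans (BC _ _))// -!mulrA ler_wpM2l// ler_pM//.
pose M := C * `|x| * `|y| + C * `|x| + C * `|y| + C.
have M0 : 0 <= M by rewrite !addr_ge0 ?mulr_ge0.
(* The coefficients come from expanding B (x + h) (y + k); the quadratic one is left unsymmetrised.
   M adds up the bounds of all degrees so that the radius 1 works. *)
exists (fun k h => match k with
    | 0 => B x y | 1 => B x (h 0%N).2 + B (h 0%N).1 y
    | 2 => B (h 0%N).1 (h 1%N).2 | _ => 0 end), M, 1; split => //; split=> //.
- move=> [|[|[|k]]]; split=> //=.
  + move=> [|//] h c u v _; rewrite /upd /= lB rB scalerDr !addrA; congr (_ + _).
    by rewrite addrAC.
  + by move=> h h' ->.
  + by move=> [|[|//]] h c u v _; rewrite /upd /= ?lB ?rB.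
  + by move=> h h' hh; rewrite !hh.
  + by move=> *; rewrite scaler0 addr0.
- move=> [|[|[|k]]] h.
  + rewrite big_ord0 mulr1 (le_trans (BC _ _))// /M -!addrA lerDl !addr_ge0 ?mulr_ge0//.
  + rewrite big_ord1 divr1 (le_trans (ler_normD _ _))//.
    apply: le_trans (lerD (C1 _ _ _ _ (lexx _) (n2 _)) (C1 _ _ _ _ (n1 _) (lexx _))) _.
    rewrite -[leRHS]/(M * `|h 0%N|) [leLHS](_ : _ = (C * `|x| + C * `|y|) * `|h 0%N|).
      have := mulr_ge0 (mulr_ge0 C0 (normr_ge0 x)) (normr_ge0 y).
      by move=> xy0; rewrite ler_wpM2r// /M [leRHS](_ : _ = C * `|x| + C * `|y| + (C * `|x| * `|y| + C)) ?lerDl ?addr_ge0//; ring.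
    by ring.
  + rewrite !big_ord_recl big_ord0 !divr1 mulr1 mulrA.
    apply: le_trans (C1 _ _ _ _ (n1 _) (n2 _)) _.
    rewrite ler_wpM2r// ler_wpM2r// /M lerDr !addr_ge0 ?mulr_ge0//.
  + rewrite normr0 mulr_ge0//; apply: prodr_ge0 => i _.
    by rewrite divr1.
- move=> [h k] _; apply: (@cvg_eventually _ _ _ 3) => n; rewrite 3!big_ord_recl /= big1// addr0.
  have := lB (y + k) 1 x h; rewrite !scale1r => ->.
  have := rB x 1 y k; rewrite !scale1r => ->.
  have := rB h 1 y k; rewrite !scale1r => ->.
  by rewrite !addrA.
Qed.

Lemma analytic_diff_comp E F G (f : E -> F) (g : F -> G) x L K :
  analytic_diff f x L -> analytic_diff g (f x) K ->
  analytic_diff (g \o f) x (K \o L).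
Proof.
move=> [a [M [r [S aL]]]] [b [N [s [T bK]]]].
have [[M0 r0] am ab ac] := S; have [[N0 s0] bm bb bc] := T.
(* Origin of the radius r / (4 q): a factor 2 for the number of compositions of n, a factor 2 for
   the n.+1 values of m, and q for the powers of M / s; as q is at least 1, [(M / s) ^+ m <= q ^+ n]
   for m <= n. *)
pose q := Num.max 1 (M / s); have q1 : 1 <= q by rewrite le_max lexx.
have q0 : 0 < q by exact: lt_le_trans ltr01 q1.
have Ms0 : 0 <= M / s by rewrite divr_ge0// ltW.
have Msq : M / s <= q by rewrite le_max lexx orbT.
have r'0 : 0 < r / (4 * q) by rewrite divr_gt0// mulr_gt0.
exists (fun n h => \sum_(m < n.+1) comp_term a m n (b m) h), N, (r / (4 * q)).
split; last first.
  move=> h; rewrite !big_ord_recl big_ord0 /= add0r addr0 big_ord1 /=.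
  by rewrite -bK -aL; apply: (bm 1%N).2 => -[].
split=> //.
- move=> n; split=> [p h c u v pn|h h' hh].
    rewrite scaler_sumr -big_split; apply: eq_bigr => m _ /=.
    by rewrite (comp_term_mlin am n (bm m)).1.
  apply: eq_bigr => m _; exact: (comp_term_mlin am n (bm m)).2.
- move=> n h; apply: le_trans (ler_norm_sum _ _ _) _.
  have P0 : 0 <= \prod_(i < n) (`|h i| / r).
    by apply: prodr_ge0 => i _; rewrite divr_ge0// ltW.
  apply: (@le_trans _ _ (\sum_(m < n.+1) (N * q ^+ n * 2 ^+ n * \prod_(i < n) (`|h i| / r)))).
    apply: ler_sum => m _.
    apply: le_trans (comp_term_bound M0 r0 s0 ab n h N0 (bb m)) _.
    rewrite ler_wpM2r// ler_wpM2r ?exprn_ge0// ler_wpM2l//.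
    apply: (@le_trans _ _ (q ^+ m)); first by rewrite lerXn2r// nnegrE ltW.
    by rewrite ler_weXn2l// -ltnS.
  rewrite sumr_const card_ord -[leLHS]mulr_natr.
  have -> : \prod_(i < n) (`|h i| / (r / (4 * q))) =
      (4 * q) ^+ n * \prod_(i < n) (`|h i| / r).
    have -> : (4 * q) ^+ n = \prod_(i < n) (4 * q) by rewrite prodr_const card_ord.
    rewrite -big_split; apply: eq_bigr => i _ /=.
    by rewrite invf_div mulrCA; congr (_ * _); rewrite mulrC.
  have -> : (4 * q) ^+ n = q ^+ n * (2 ^+ n * 2 ^+ n).
    by rewrite -!exprMn; congr (_ ^+ n); ring.
  rewrite [leRHS](_ : _ = (N * q ^+ n * 2 ^+ n * \prod_(i < n) (`|h i| / r)) * 2 ^+ n); last by ring.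
  rewrite ler_wpM2l ?mulr_ge0 ?exprn_ge0 ?(ltW q0)//.
  by rewrite -natrX ler_nat; exact: ltn_expl.
- move=> h hr; pose t := `|h| / r.
  have tq : t * (4 * q) < 1 by rewrite /t mulrAC ltr_pdivrMr// mul1r -ltr_pdivlMr// mulr_gt0.
  have t0 : 0 <= t by rewrite divr_ge0// ltW.
  have t1 : 2 * t <= 2^-1.
    have : t <= t * q by rewrite ler_peMr.
    lra.
  have Mst : M / s * (2 * t) <= 2^-1.
    have : M / s * t <= t * q by rewrite mulrC ler_wpM2l.
    lra.
  have hr1 : `|h| < r by move: t1; rewrite /t => t1; rewrite -[ltRHS]mul1r -ltr_pdivrMr//; lra.
  have ay := pseries_cvg_shift S hr1; set y := _ - _ in ay.
  (* The increment of f stays inside the convergence radius of g: it is at most [M * (2 * t)], hence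
     at most s / 2. *)
  have ys : `|y| < s.
    apply: (@le_lt_trans _ _ (s * 2^-1)); last by lra.
    apply: (cvg_norm_le (k := 0) _ ay) => n; apply: le_trans (ler_norm_sum _ _ _) _.
    apply: (@le_trans _ _ (M * \sum_(1 <= k < n.+1) t ^+ k)).
      rewrite (big_addn 0 _ 1) subn1 /= big_mkord mulr_sumr; apply: ler_sum => k _.
      by rewrite (le_trans (ab _ _))// prodr_const card_ord addn1.
    apply: (@le_trans _ _ (M * (2 * t ^+ 1))).
      by rewrite ler_wpM2l// geometric_tail//; lra.
    by rewrite expr1 -[M](divfK (lt0r_neq0 s0)) mulrAC [leRHS]mulrC ler_wpM2r ?(ltW s0).
  have bcy := bc y ys.
  have -> : (g \o f) (x + h) = g (f x + y) by rewrite /y /= [f x + _]addrC subrK.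
  (* Terms with more parts than the degree vanish, so the triangle m <= k can be completed to a
     square, to which Tannery's theorem applies. *)
  have tri n : \sum_(k < n) (\sum_(m < k.+1) comp_term a m k (b m) (fun=> h)) =
      \sum_(m < n) \sum_(k < n) comp_term a m k (b m) (fun=> h).
    rewrite exchange_big /=; apply: eq_bigr => k _.
    rewrite (big_ord_widen n (fun m => comp_term a m k (b m) (fun=> h)) (ltn_ord k)).
    rewrite big_mkcond; apply: eq_bigr => m _; case: ifP => // /negbT.
    by rewrite -leqNgt => km; rewrite comp_term_lt.
  under eq_cvg do rewrite tri.
  apply: (@cvg_tannery R G (fun m n => \sum_(k < n) comp_term a m k (b m) (fun=> h))
    (fun m => b m (fun=> y)) _ (2 * N) 2^-1) => //.
  + by rewrite mulr_ge0.
  + by rewrite invf_lt1// ltr1n.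
  + move=> m n; apply: le_trans (comp_term_partial M0 r0 s0 ab n N0 (erefl _) t1 (bb m)) _.
    apply: ler_wpM2l; first by rewrite mulr_ge0.
    by apply: lerXn2r => //; rewrite nnegrE ?invr_ge0//; apply: mulr_ge0 => //; apply: mulr_ge0.
  + move=> m; have H := comp_term_cvg M0 r0 s0 ab (bm m) N0 (erefl t) t1 (bb m) ay.
    exact H.
Qed.

End AnalyticCalculus.

(** * Completeness of L2, H1 and B(H1) *)

Section RieszFischer.
Context d (T : measurableType d) (R : realType) (mu : {measure set T -> \bar R}).

(** Cauchy-Schwarz with weights 2^k, whose inverses sum to at most 2 / 2^n from n on; the induction
    uses (a + b)^2 <= 2 a^2 + 2 b^2. *)
Lemma sqr_sum_geometric (u : nat -> R) (j n : nat) :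
  (\sum_(k < j) u (n + k)%N) ^+ 2 <=
  2 * 2^-1 ^+ n * \sum_(k < j) 2 ^+ (n + k) * u (n + k)%N ^+ 2.
Proof.
elim: j n => [|j IH] n; first by rewrite !big_ord0 expr0n mulr0.
rewrite !big_ord_recl /= !addn0.
under eq_bigr do rewrite /bump /= addnA addn1.
under [in leRHS]eq_bigr do rewrite /bump /= addnA addn1.
set S := \sum_(i < j) u _; set W := (X in _ <= _ * (_ + X)).
have {IH} : S ^+ 2 <= 2^-1 ^+ n * W.
  have := IH n.+1; rewrite -/S -/W => /le_trans; apply.
  by rewrite exprS [X in X * W](_ : _ = 2^-1 ^+ n)// mulrA mulfV ?mul1r// pnatr_eq0.
have p1 : 2^-1 ^+ n * 2 ^+ n = 1 :> R by rewrite -exprMn mulVf ?expr1n// pnatr_eq0.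
move=> H; rewrite mulrDr -mulrA [X in 2 * X + _]mulrA p1 mul1r -mulrA.
apply: (@le_trans _ _ (2 * u n ^+ 2 + 2 * S ^+ 2)); last by rewrite lerD2l ler_wpM2l.
rewrite -subr_ge0 [leRHS](_ : _ = (u n - S) ^+ 2) ?sqr_ge0//; ring.
Qed.

(** Riesz-Fischer. The squared increments weighted by 2^k have a sum W with integral at most 2 C;
    where W is finite the sequence is Cauchy, with squared distance from the n-th term to the limit
    at most 2 W / 2^n. Integrating this pointwise bound gives the rate. *)
Lemma fast_cauchy_ae (g : nat -> T -> R) (C : R) :
  (forall n, measurable_fun setT (g n)) -> 0 <= C ->
  (forall n, \int[mu]_x ((g n.+1 x - g n x) ^+ 2)%:E <= (C * 4^-1 ^+ n)%:E)%E ->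
  exists2 G : T -> R, measurable_fun setT G &
    forall n, (\int[mu]_x ((G x - g n x) ^+ 2)%:E <= (4 * C * 2^-1 ^+ n)%:E)%E.
Proof.
move=> mg C0 gC.
pose w k x := (2 ^+ k * (g k.+1 x - g k x) ^+ 2)%:E : \bar R.
have w0 k x : (0 <= w k x)%E by rewrite lee_fin mulr_ge0 ?sqr_ge0 ?exprn_ge0.
have msq (f h : T -> R) : measurable_fun setT f -> measurable_fun setT h ->
    measurable_fun setT (fun x => ((f x - h x) ^+ 2)%:E).
  by move=> mf mh; apply/measurable_EFinP; apply: measurable_funX; exact: measurable_funB.
have mw k : measurable_fun setT (w k).
  apply/measurable_EFinP; apply: measurable_funM; first exact: measurable_cst.
  by apply: measurable_funX; exact: measurable_funB.
pose W x := (\sum_(k <oo) w k x)%E.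
have mW : measurable_fun setT W by apply: ge0_emeasurable_sum => // k x _ _.
have W0 x : (0 <= W x)%E by apply: nneseries_ge0 => k _ _.
have IW : (\int[mu]_x W x <= (2 * C)%:E)%E.
  rewrite integral_nneseries//; apply: lime_le.
    by apply: is_cvg_nneseries => k _ _; exact: integral_ge0.
  apply: nearW => n; apply: (@le_trans _ _ (\sum_(0 <= k < n) (C * 2^-1 ^+ k)%:E)%E).
    apply: lee_sum => k _; rewrite /w; under eq_integral do rewrite EFinM.
    rewrite [leLHS](_ : _ = (2 ^+ k)%:E * \int[mu]_x ((g k.+1 x - g k x) ^+ 2)%:E)%E; last first.
      apply: ge0_integralZl => //; solve [exact: msq | by move=> x _; rewrite lee_fin sqr_ge0
        | by rewrite lee_fin exprn_ge0].
    apply: le_trans (lee_wpmul2l _ (gC k)) _; first by rewrite lee_fin exprn_ge0.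
    rewrite -EFinM lee_fin mulrCA ler_wpM2l// -exprMn.
    by rewrite (_ : 2 * 4^-1 = 2^-1)//; field.
  rewrite sumEFin lee_fin -mulr_sumr mulrC ler_wpM2r//.
  by have := @geometric_tail R 2^-1 0 n; rewrite expr0 mulr1; apply; rewrite ?invr_ge0.
have Wfin : {ae mu, forall x, (W x < +oo)%E}.
  have : mu.-integrable setT W.
    apply/integrableP; split=> //; under eq_integral do rewrite gee0_abs//.
    by rewrite (le_lt_trans IW)// ltry.
  move/(integrable_ae measurableT); apply: filterS => x /(_ I) /fineK <-.
  exact: ltry.
pose A := [set x | (W x < +oo)%E].
have mA : measurable A by rewrite -[A]setTI; exact: emeasurable_fun_infty_o.
have bound x n j : A x -> (g (n + j)%N x - g n x) ^+ 2 <= 2 * 2^-1 ^+ n * fine (W x).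
  move=> Ax; have -> : g (n + j)%N x - g n x = \sum_(k < j) (g (n + k).+1 x - g (n + k)%N x).
    elim: j => [|j IH]; first by rewrite addn0 subrr big_ord0.
    by rewrite big_ord_recr -IH /= addnS addrC addrA subrK.
  have Wf : W x \is a fin_num by rewrite fin_numE (gt_eqF (lt_le_trans (ltNy0) (W0 x))) lt_eqF.
  apply: le_trans (sqr_sum_geometric (fun k => g k.+1 x - g k x) j n) _.
  rewrite ler_wpM2l ?mulr_ge0 ?exprn_ge0//.
  rewrite -lee_fin fineK//; apply: le_trans (nneseries_lim_ge (n + j) (fun k _ _ => w0 k x)).
  rewrite sumEFin lee_fin (big_cat_nat (n := n)) ?leq_addr//=.
  rewrite -[leLHS]add0r lerD//.
    by apply: sumr_ge0 => k _; rewrite mulr_ge0 ?sqr_ge0 ?exprn_ge0.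
  rewrite -[X in _ <= \sum_(X <= i < _) _]add0n big_addn addKn big_mkord.
  by apply: ler_sum => k _; rewrite addnC.
have small x : (2 * 2^-1 ^+ n * fine (W x)) @[n --> \oo] --> (0 : R).
  rewrite (_ : 0 = 2 * 0 * fine (W x)); last by rewrite mulr0 mul0r.
  apply: cvgMr_tmp; apply: cvgMl_tmp; apply: cvg_expr.
  by rewrite ger0_norm ?invr_ge0// invf_lt1// ltr1n.
(* Cutting off outside A makes the sequence converge at every point, so that its limit is
   measurable. *)
pose h n x := g n x * \1_A x.
have hcvg x : cvgn (h ^~ x).
  have [Ax|nAx] := pselect (A x); last first.
    rewrite (_ : h ^~ x = cst 0); first exact: is_cvg_cst.
    by apply/funext => n; rewrite /h indicE memNset ?mulr0.
  apply/cauchy_cvgP; apply: cauchy_exP => e e0.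
  have e20 : 0 < e ^+ 2 by rewrite exprn_gt0.
  have [K _ /(_ K (leqnn K)) HK] := (cvgrPdist_lt _ _ ).1 (small x) _ e20.
  exists (h K x); exists K => // n /= Kn; rewrite -ball_normE /= distrC /h indicE mem_set// !mulr1.
  rewrite -(subnKC Kn) -(@ltr_pXn2r _ 2)// ?nnegrE ?(ltW e0)//.
  rewrite real_normK ?num_real// (le_lt_trans (bound _ _ _ Ax))//.
  by move: HK; rewrite sub0r normrN => /(le_lt_trans (ler_norm _)).
pose G x := limn (h ^~ x).
have mh n : measurable_fun setT (h n).
  by apply: measurable_funM => //; exact: measurable_indic.
have mG : measurable_fun setT G.
  by apply: (measurable_fun_cvg mh) => x _; exact: hcvg.
exists G => // n.
have Gb x : A x -> (G x - g n x) ^+ 2 <= 2 * 2^-1 ^+ n * fine (W x).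
  move=> Ax; have cG : (h m x - g n x) ^+ 2 @[m --> \oo] --> (G x - g n x) ^+ 2.
    have H : (h m x - g n x) @[m --> \oo] --> G x - g n x.
      by apply: cvgB; [exact: hcvg|exact: cvg_cst].
    by under eq_cvg do rewrite expr2; rewrite expr2; exact: cvgM.
  apply: (@closed_cvg _ _ _ _ _ [set z | z <= 2 * 2^-1 ^+ n * fine (W x)] _ _ _ cG).
    exact: closed_le.
  exists n => // m /= nm; rewrite /h indicE mem_set// mulr1 -(subnKC nm); exact: bound.
apply: (@le_trans _ _ (\int[mu]_x ((2 * 2^-1 ^+ n)%:E * W x))%E).
  apply: ae_ge0_le_integral => //.
  - by move=> x _; rewrite lee_fin sqr_ge0.
  - exact: msq.
  - by move=> x _; rewrite mule_ge0// lee_fin mulr_ge0 ?exprn_ge0.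
  - exact: measurable_funeM.
  apply: filterS Wfin => x Wx _.
  have Wf : W x \is a fin_num by rewrite fin_numE (gt_eqF (lt_le_trans (ltNy0) (W0 x))) lt_eqF.
  by rewrite -(fineK Wf) -EFinM lee_fin; exact: Gb.
rewrite [leLHS](_ : _ = (2 * 2^-1 ^+ n)%:E * \int[mu]_x W x)%E; last first.
  by apply: ge0_integralZl => //; solve [done | by rewrite lee_fin mulr_ge0 ?exprn_ge0].
apply: le_trans (lee_wpmul2l _ IW) _; first by rewrite lee_fin mulr_ge0 ?exprn_ge0.
by rewrite -EFinM lee_fin le_eqVlt; apply/orP; left; apply/eqP; ring.
Qed.

End RieszFischer.

(** [banach] speaks of Cauchy filters. Balls of radius 2^-n / 4 that belong to G have centres
    forming a fast sequence, because two members of G always meet, and the limit of the centres is a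
    limit of G. *)
Lemma banach_fast_cauchy (R : realType) (E : normedModType R) :
  (forall u : nat -> E, (forall n, `|u n.+1 - u n| <= 2^-1 ^+ n) ->
    exists l : E, u @ \oo --> l) -> banach E.
Proof.
move=> H G PG /cauchyP cG.
have e0 n : 0 < (4^-1 : R) * 2^-1 ^+ n by rewrite mulr_gt0// exprn_gt0// invr_gt0.
have /choice[u uG] : forall n, exists x, G (ball x (4^-1 * 2^-1 ^+ n : R)).
  by move=> n; exact: cG (e0 n).
have [n|l ul] := H u.
  have [z [/= z1 z2]] := filter_ex (filterI (uG n.+1) (uG n)).
  move: z1 z2; rewrite -!ball_normE /= => z1 z2.
  rewrite -(subrK z (u n.+1)) -addrA (le_trans (ler_normD _ _))//.
  rewrite [`|z - _|]distrC (le_trans (lerD (ltW z1) (ltW z2)))// exprS.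
  have : 0 <= (2^-1 : R) ^+ n by rewrite exprn_ge0// invr_ge0.
  by move: ((2^-1 : R) ^+ n) => y y0; lra.
apply/cvg_ex; exists l; apply/cvgrPdist_lt => e e00.
have e20 : 0 < e / 2 by rewrite divr_gt0.
have [K1 _ HK1] := (cvgrPdist_lt _ _).1 ul _ e20.
have c0 : (2^-1 : R) ^+ n @[n --> \oo] --> (0 : R).
  by apply: cvg_expr; rewrite ger0_norm ?invr_ge0// invf_lt1// ltr1n.
have [K2 _ HK2] := (cvgrPdist_lt _ _).1 c0 _ e20.
have := HK1 (maxn K1 K2) (leq_maxl _ _).
have := HK2 (maxn K1 K2) (leq_maxr _ _).
move: (maxn K1 K2) => n; rewrite sub0r normrN ger0_norm ?exprn_ge0 ?invr_ge0// => h2 h1.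
apply: filterS (uG n) => z; rewrite -ball_normE /= => z1.
rewrite -(subrK (u n) l) -addrA (le_lt_trans (ler_normD _ _))// [e]splitr ltrD//.
apply: lt_le_trans z1 _; apply: le_trans (ltW h2); rewrite ler_piMl ?exprn_ge0 ?invr_ge0//.
by rewrite invf_le1 ?ler1n.
Qed.

Section Completeness.
Local Open Scope quotient_scope.
Variable R : realType.
Local Notation C := R[i].
Local Notation vol := (vol R).

Lemma Lfun2_sqr (h : R3 R -> R) : measurable_fun setT h ->
  (\int[vol]_x ((h x) ^+ 2)%:E < +oo)%E -> h \in Lfun vol 2%:E.
Proof.
move=> mh hoo; apply/andP; split; rewrite inE//=.
rewrite /finite_norm unlock /=; apply: poweR_lty.
apply: le_lt_trans hoo; rewrite le_eqVlt; apply/orP; left; apply/eqP.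
apply: eq_integral => x _; rewrite /= powR_mulrn//.
by rewrite real_normK ?num_real.
Qed.

Lemma L2piB (f g : sqint R) : \pi_(L2 R) f - \pi_(L2 R) g = \pi_(L2 R) (f - g).
Proof. by rewrite -[LHS]/(L2add _ (L2opp _)) Defs.pi_opp Defs.pi_add. Qed.

Lemma rip_piB (f g : sqint R) :
  (rip (\pi_(L2 R) f - \pi_(L2 R) g) (\pi_(L2 R) f - \pi_(L2 R) g))%:E =
  (\int[vol]_x ((re_part f x - re_part g x) ^+ 2)%:E +
   \int[vol]_x ((im_part f x - im_part g x) ^+ 2)%:E)%E.
Proof.
have E1 x : re_part (f - g : sqint R) x = re_part f x - re_part g x.
  by rewrite /re_part; have -> : (f - g) x = f x - g x by []; case: (f x) (g x) => [? ?] [? ?].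
have E2 x : im_part (f - g : sqint R) x = im_part f x - im_part g x.
  by rewrite /im_part; have -> : (f - g) x = f x - g x by []; case: (f x) (g x) => [? ?] [? ?].
have i1 := Lfun2_mul_integrable (sqint_re (f - g)) (sqint_re (f - g)).
have i2 := Lfun2_mul_integrable (sqint_im (f - g)) (sqint_im (f - g)).
rewrite L2piB rip_pi RintegralD// EFinD /Rintegral !fineK; last 2 first.
  exact: (integrable_fin_num measurableT i2).
  exact: (integrable_fin_num measurableT i1).
by congr (_ + _)%E; apply: eq_integral => x _; rewrite ?E1 ?E2 expr2.
Qed.

Lemma L2_complete (f : nat -> L2 R) (c : R) : 0 <= c ->
  (forall n, rip (f n.+1 - f n) (f n.+1 - f n) <= c * 4^-1 ^+ n) ->
  exists F : L2 R, forall n, rip (F - f n) (F - f n) <= 8 * c * 2^-1 ^+ n.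
Proof.
move=> c0 fc; pose s n := repr (f n).
have fE n : f n = \pi_(L2 R) (s n) by rewrite reprK.
have int0 (h : R3 R -> R) : (0 <= \int[vol]_x ((h x) ^+ 2)%:E)%E.
  by apply: integral_ge0 => x _; rewrite lee_fin sqr_ge0.
have mre n := Lfun2_measurable (sqint_re (s n)).
have mim n := Lfun2_measurable (sqint_im (s n)).
have [n|G mG GP] := fast_cauchy_ae (mu := vol) mre c0.
  apply: le_trans (_ : ((rip (f n.+1 - f n) (f n.+1 - f n))%:E <= _)%E); last by rewrite lee_fin fc.
  by rewrite !fE rip_piB leeDl.
have [n|K mK KP] := fast_cauchy_ae (mu := vol) mim c0.
  apply: le_trans (_ : ((rip (f n.+1 - f n) (f n.+1 - f n))%:E <= _)%E); last by rewrite lee_fin fc.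
  by rewrite !fE rip_piB leeDr.
have LG : G \in Lfun vol 2%:E.
  have -> : G = (fun x => 1 * (G x - re_part (s 0) x) + 1 * re_part (s 0) x).
    by apply/funext => x; rewrite !mul1r subrK.
  apply: Lfun2_lin; last exact: sqint_re.
  apply: Lfun2_sqr; first exact: measurable_funB.
  by apply: le_lt_trans (GP 0) _; rewrite ltry.
have LK : K \in Lfun vol 2%:E.
  have -> : K = (fun x => 1 * (K x - im_part (s 0) x) + 1 * im_part (s 0) x).
    by apply/funext => x; rewrite !mul1r subrK.
  apply: Lfun2_lin; last exact: sqint_im.
  apply: Lfun2_sqr; first exact: measurable_funB.
  by apply: le_lt_trans (KP 0) _; rewrite ltry.
have LF : (fun x => (G x +i* K x)%C) \in @L2fun R by apply/andP; split.
exists (\pi_(L2 R) (Sqint LF)) => n; rewrite fE -lee_fin rip_piB.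
apply: le_trans (leeD (GP n) (KP n)) _.
by rewrite -EFinD lee_fin le_eqVlt; apply/orP; left; apply/eqP; ring.
Qed.

Lemma rip_CS (f g : L2 R) : rip f g ^+ 2 <= rip f f * rip g g.
Proof.
have [g0|g0] := eqVneq (rip g g) 0.
  rewrite (rip_eq0 g0) [rip f _]ripC.
  have -> : (0 : L2 R) = (0 : R)%:C%C *: (0 : L2 R) by rewrite scaler0.
  by rewrite !ripZl !mul0r expr0n mulr0.
have gp : 0 < rip g g by rewrite lt_neqAle eq_sym g0 rip_ge0.
have := rip_ge0 ((rip g g)%:C%C *: f + (- rip f g)%:C%C *: g).
rewrite ripDl !ripZl ![rip _ (_ + _)]ripC !ripDl !ripZl [rip g f]ripC.
rewrite [X in 0 <= X](_ : _ = rip g g * (rip f f * rip g g - rip f g ^+ 2)); last by ring.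
by rewrite pmulr_rge0// subr_ge0.
Qed.

Lemma rip_i (f g : L2 R) : rip ('i%C *: f) ('i%C *: g) = rip f g.
Proof.
elim/L2W: f => f; elim/L2W: g => g.
have E (h : sqint R) : 'i%C *: \pi_(L2 R) h = \pi_(L2 R) ('i%C *: h) by exact: Defs.pi_scale.
rewrite !E !rip_pi; apply: eq_Rintegral => x _; rewrite /re_part /im_part.
have -> : ('i%C *: f) x = 'i%C * f x by [].
have -> : ('i%C *: g) x = 'i%C * g x by [].
by case: (f x) (g x) => [a b] [a' b'] /=; ring.
Qed.

Lemma real_sqint_subproof (psi : R3 R -> R) : psi \in Lfun vol 2%:E ->
  (fun x => (psi x)%:C%C) \in @L2fun R.
Proof.
move=> Lpsi; apply/andP; split; first exact: Lpsi.
by have [] := Lfun_submod_closed vol (le12 R).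
Qed.

(** Writes the pairing with a test function through real inner products with p and i p, which are
    continuous in f by [rip_cvg]; weak derivatives thus pass to L2 limits. *)
Lemma pairing_rip (f : L2 R) (psi : R3 R -> R) (Lpsi : psi \in Lfun vol 2%:E) :
  let p := \pi_(L2 R) (Sqint (real_sqint_subproof Lpsi)) in
  cintegral (fun x => repr f x * (psi x)%:C%C) = (rip f p +i* rip f ('i%C *: p))%C.
Proof.
move=> p; elim/L2W: f => f; rewrite pairing_pi// /cintegral pairing_re pairing_im.
have -> : 'i%C *: p = \pi_(L2 R) ('i%C *: Sqint (real_sqint_subproof Lpsi)) by exact: Defs.pi_scale.
rewrite !rip_pi; congr (_ +i* _)%C; apply: eq_Rintegral => x _; rewrite /re_part /im_part.
  by rewrite /= mulr0 addr0.
have -> : ('i%C *: Sqint (real_sqint_subproof Lpsi)) x = 'i%C * (psi x)%:C%C by [].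
by case: (f x) => a b /=; ring.
Qed.

Lemma rip_cvg (f : nat -> L2 R) (F p : L2 R) :
  rip (F - f n) (F - f n) @[n --> \oo] --> 0 ->
  rip (f n) p @[n --> \oo] --> rip F p.
Proof.
move=> fF; apply/cvgrPdist_lt => e e0.
have e20 : 0 < e ^+ 2 / (rip p p + 1) by rewrite divr_gt0 ?exprn_gt0// ltr_wpDl// rip_ge0.
have [K _ KP] := (cvgrPdist_lt _ _).1 fF _ e20.
exists K => // n /= /KP; rewrite sub0r normrN ger0_norm ?rip_ge0// => Hn.
have -> : rip F p - rip (f n) p = rip (F - f n) p.
  rewrite ripDl; have -> : - f n = (-1 : R)%:C%C *: f n by rewrite rmorphN rmorph1 scaleN1r.
  by rewrite ripZl mulN1r.
rewrite -(@ltr_pXn2r _ 2)// ?nnegrE ?(ltW e0)//.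
rewrite real_normK ?num_real// (le_lt_trans (rip_CS _ _))//.
apply: (@le_lt_trans _ _ (rip (F - f n) (F - f n) * (rip p p + 1))).
  by rewrite ler_wpM2l ?rip_ge0// lerDl.
by rewrite -ltr_pdivlMr// ltr_wpDl// rip_ge0.
Qed.

Lemma geometric_cvg0 (c : R) : c * 2^-1 ^+ n @[n --> \oo] --> 0.
Proof.
rewrite (_ : 0 = c * 0); last by rewrite mulr0.
by apply: cvgMl_tmp; apply: cvg_expr; rewrite ger0_norm ?invr_ge0// invf_lt1// ltr1n.
Qed.

(** The graph of the weak gradient is closed in a product of four copies of L2, each controlled by
    [L2_complete]; 32 is 4 times its constant 8. *)
Lemma H1_complete (v : nat -> H1 R) (c : R) : 0 <= c ->
  (forall n, rip_H1 (v n.+1 - v n) (v n.+1 - v n) <= c * 4^-1 ^+ n) ->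
  exists w : H1 R, forall n, rip_H1 (w - v n) (w - v n) <= 32 * c * 2^-1 ^+ n.
Proof.
move=> c0 vc.
have val1 (u w : H1 R) : (H1_val (u - w)).1 = (H1_val u).1 - (H1_val w).1 by [].
have val2 (u w : H1 R) i : (H1_val (u - w)).2 i = (H1_val u).2 i - (H1_val w).2 i by [].
have [n|F FP] := @L2_complete (fun n => (H1_val (v n)).1) c c0.
  apply: le_trans (vc n); rewrite rip_H1E val1 lerDl sumr_ge0// => i _; exact: rip_ge0.
have /choice[G GP] i : exists G, forall n, rip (G - (H1_val (v n)).2 i) (G - (H1_val (v n)).2 i)
    <= 8 * c * 2^-1 ^+ n.
  apply: L2_complete => // n; apply: le_trans (vc n).
  rewrite rip_H1E val1 (bigD1 i)// val2 addrCA lerDl addr_ge0 ?rip_ge0//.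
  by rewrite sumr_ge0// => j _; exact: rip_ge0.
have lim0 (f : nat -> L2 R) H : (forall n, rip (H - f n) (H - f n) <= 8 * c * 2^-1 ^+ n) ->
    rip (H - f n) (H - f n) @[n --> \oo] --> 0.
  move=> Hf; apply: (@squeeze_cvgr _ _ _ _ (cst 0) (fun n => 8 * c * 2^-1 ^+ n)).
  - by apply: nearW => n; rewrite rip_ge0 Hf.
  - exact: cvg_cst.
  - exact: geometric_cvg0.
have Fc := lim0 _ _ FP; have Gc i := lim0 _ _ (GP i).
have FG : (F, G) \in @H1graph R.
  apply/asboolP => i phi tphi /=.
  have L1 := test_function_deriv_Lfun i tphi; have L2 := test_function_Lfun tphi.
  rewrite (pairing_rip _ L1) (pairing_rip _ L2).
  set p := \pi_(_) _; set q := \pi_(_) _.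
  have H n : rip (H1_val (v n)).1 p = - rip ((H1_val (v n)).2 i) q /\
      rip (H1_val (v n)).1 ('i%C *: p) = - rip ((H1_val (v n)).2 i) ('i%C *: q).
    case: (v n) => u /= /asboolP/(_ i phi tphi).
    by rewrite (pairing_rip _ L1) (pairing_rip _ L2) => -[].
  have lim2 r s : (forall n, rip (H1_val (v n)).1 r = - rip ((H1_val (v n)).2 i) s) ->
      rip F r = - rip (G i) s.
    move=> rs.
    have c1 : rip (H1_val (v n)).1 r @[n --> \oo] --> rip F r by exact: rip_cvg.
    have c2 : - rip ((H1_val (v n)).2 i) s @[n --> \oo] --> - rip (G i) s.
      by apply: cvgN; exact: (rip_cvg (f := fun n => (H1_val (v n)).2 i)).
    rewrite (funext rs) in c1.
    by apply: (cvg_unique _ c1 c2).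
  rewrite (lim2 p q (fun n => (H n).1)) (lim2 _ _ (fun n => (H n).2)).
  by [].
exists (MkH1 FG) => n; rewrite rip_H1E val1.
apply: le_trans (lerD (FP n) (ler_sum _ (fun i _ => GP i n))) _.
rewrite sumr_const card_ord -mulr_natr le_eqVlt; apply/orP; left; apply/eqP; ring.
Qed.

Lemma norm_H1_i (u : H1 R) : norm_H1 ('i%C *: u) = norm_H1 u.
Proof.
rewrite /norm_H1 -!/(rip_H1 _ _) !rip_H1E /= rip_i; congr (Num.sqrt (_ + _)).
by apply: eq_bigr => i _; rewrite rip_i.
Qed.

Lemma norm_H1ZC (a : C) (u : H1 R) :
  norm_H1 (a *: u) <= (`|complex.Re a| + `|complex.Im a|) * norm_H1 u.
Proof.
have -> : a *: u = (complex.Re a)%:C%C *: u + (complex.Im a)%:C%C *: ('i%C *: u).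
  rewrite scalerA -scalerDl; congr (_ *: _); case: a => x y /=.
  by apply/eqP; rewrite eq_complex /=; apply/andP; split; apply/eqP; ring.
by rewrite (le_trans (norm_H1D _ _))// !norm_H1Z norm_H1_i mulrDl.
Qed.

Lemma norm_H1N (u : H1 R) : norm_H1 (- u) = norm_H1 u.
Proof.
have -> : - u = (-1 : R)%:C%C *: u by rewrite rmorphN rmorph1 scaleN1r.
by rewrite norm_H1Z normrN1 mul1r.
Qed.

Lemma norm_bopE (T : bop R) : `|T| = op_norm T. Proof. by []. Qed.

Lemma bopB (S T : bop R) u : (S - T) u = S u - T u. Proof. by []. Qed.

Lemma banach_bop : banach (bop R).
Proof.
apply: banach_fast_cauchy => U UC.
have q0 n : 0 <= (2^-1 : R) ^+ n by rewrite exprn_ge0// invr_ge0.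
(* The square root of the rate in [H1_complete], applied to the orbit of a vector v with constant
   [norm_H1 v ^+ 2]. *)
pose dl n := Num.sqrt (32 * 2^-1 ^+ n : R).
have dl0 n : 0 <= dl n by exact: sqrtr_ge0.
have dlc : dl n @[n --> \oo] --> 0.
  rewrite -(@sqrtr0 R); apply: continuous_cvg; first exact: sqrt_continuous.
  exact: geometric_cvg0.
have /choice[T TP] v : exists w, forall n, norm_H1 (w - U n v) <= dl n * norm_H1 v.
  have [n|w wP] := @H1_complete (fun n => U n v) (norm_H1 v ^+ 2) (sqr_ge0 _).
    rewrite -sqr_norm_H1 -bopB.
    have := le_trans (op_normP (U n.+1 - U n) v) (ler_wpM2r (norm_H1_ge0 v) (UC n)).
    move=> H; apply: (@le_trans _ _ ((2^-1 ^+ n * norm_H1 v) ^+ 2)).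
      by rewrite lerXn2r// ?nnegrE ?norm_H1_ge0 ?mulr_ge0 ?norm_H1_ge0.
    rewrite exprMn mulrC ler_wpM2l ?sqr_ge0// -exprM mulnC exprM.
    by rewrite (_ : 2^-1 ^+ 2 = 4^-1)//; field.
  exists w => n.
  have -> : dl n * norm_H1 v = Num.sqrt (32 * 2^-1 ^+ n * norm_H1 v ^+ 2).
    by rewrite sqrtrM ?mulr_ge0// sqrtr_sqr ger0_norm ?norm_H1_ge0.
  rewrite -[leLHS]/(Num.sqrt (rip_H1 _ _)) ler_sqrt ?mulr_ge0 ?sqr_ge0 ?norm_H1_ge0//.
  by apply: le_trans (wP n) _; rewrite mulrAC.
(* Linearity of the pointwise limit T follows: the defect of T equals a combination of errors T - U
   n, each of order dl n. *)
have zero (x : H1 R) K : (forall n, norm_H1 x <= dl n * K) -> x = 0.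
  move=> xK; apply: norm_H1_eq0; apply/eqP; rewrite eq_le norm_H1_ge0 andbT.
  have H : dl n * K @[n --> \oo] --> 0 * K by apply: cvgMr_tmp.
  rewrite -(mul0r K); apply: (@closed_cvg _ _ _ _ _ [set z | norm_H1 x <= z] _ _ _ H).
    exact: closed_ge.
  by apply: nearW.
have Tlin (a : C) u v : T (a *: u + v) = a *: T u + T v.
  apply/eqP; rewrite -subr_eq0; apply/eqP.
  apply: (zero _ (norm_H1 (a *: u + v) + ((`|complex.Re a| + `|complex.Im a|) * norm_H1 u + norm_H1 v))) => n.
  have -> : T (a *: u + v) - (a *: T u + T v) = (T (a *: u + v) - U n (a *: u + v)) -
      (a *: (T u - U n u) + (T v - U n v)).
    rewrite bopP scalerBr !opprD !opprK !addrA.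
    rewrite -[RHS]addrA; rewrite !addrA.
    by rewrite [RHS](ACl (1*4*6*(2*5)*(3*7)))/= !addNr !addr0.
  rewrite (le_trans (norm_H1D _ _))// norm_H1N mulrDr lerD// mulrDr.
  rewrite (le_trans (norm_H1D _ _))// lerD// (le_trans (norm_H1ZC _ _))//.
  by rewrite [leRHS]mulrCA ler_wpM2l// addr_ge0.
have Tb : T \in @bounded_linear R.
  apply/asboolP; split=> //; exists (dl 0 + `|U 0%N|) => v.
  rewrite -(subrK (U 0%N v) (T v)) (le_trans (norm_H1D _ _))// mulrDl lerD//.
  exact: op_normP.
exists (Bop Tb); apply/cvgrPdist_le => e e0.
have [K _ KP] := (cvgrPdist_le _ _).1 dlc _ e0.
exists K => // n /= /KP; rewrite sub0r normrN => /(le_trans (ler_norm _)) Hn.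
rewrite norm_bopE; apply: op_norm_lub => v v1; rewrite bopB.
by apply: le_trans (TP v n) _; apply: le_trans Hn; rewrite ler_piMr.
Qed.

End Completeness.

(** * Test functions and uniqueness of weak derivatives *)

Section Bump.
Variable R : realType.

Fixpoint Ck1 (k : nat) (f : R -> R) : Prop :=
  if k is k'.+1 then
    exists2 f' : R -> R, forall x : R, is_derive x 1 f (f' x) & Ck1 k' f' else True.

Lemma Ck1W k f : Ck1 k.+1 f -> Ck1 k f.
Proof.
elim: k f => [//|k IH] f [f' df Cf']; exists f' => //; exact: IH.
Qed.

Lemma Ck1D k f g : Ck1 k f -> Ck1 k g -> Ck1 k (fun x => f x + g x).
Proof.
elim: k f g => [//|k IH] f g [f' df Cf] [g' dg Cg]; exists (fun x => f' x + g' x); last exact: IH.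
by move=> x; exact: is_deriveD.
Qed.

Lemma Ck1Z k c f : Ck1 k f -> Ck1 k (fun x => c * f x).
Proof.
elim: k f => [//|k IH] f [f' df Cf]; exists (fun x => c * f' x); last exact: IH.
by move=> x; exact: is_deriveZ.
Qed.

Lemma Ck1M k f g : Ck1 k f -> Ck1 k g -> Ck1 k (fun x => f x * g x).
Proof.
elim: k f g => [//|k IH] f g Hf Hg; have := Hf; have := Hg => -[g' dg Cg] [f' df Cf].
exists (fun x => f x * g' x + g x * f' x); first by move=> x; exact: is_deriveM.
by apply: Ck1D; apply: IH => //; exact: Ck1W.
Qed.

Lemma is_derive1P (f : R -> R) (x df : R) :
  is_derive x 1 f df <-> (h^-1 * (f (h + x) - f x)) @[h --> 0^'] --> df.
Proof.
have E : (fun h : R => h^-1 *: ((f \o shift x) (h *: (1 : R)) - f x)) =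
    (fun h => h^-1 * (f (h + x) - f x)).
  by apply/funext => h; rewrite /= -[h *: 1]/(h * 1) mulr1.
split=> [[+ <-]|H]; first by rewrite /derivable /derive E.
apply: DeriveDef; first by rewrite /derivable E; apply/cvg_ex; exists df.
by rewrite /derive E; apply: cvg_lim.
Qed.

Lemma is_derive_affine (f : R -> R) (a b x df : R) : is_derive (a * x + b) 1 f df ->
  is_derive x 1 (fun y => f (a * y + b)) (a * df).
Proof.
have [->|a0] := eqVneq a 0.
  move=> _; rewrite mul0r (_ : (fun _ => _) = cst (f b)); first exact: is_derive_cst.
  by apply/funext => y /=; rewrite mul0r add0r.
move=> /is_derive1P H; apply/is_derive1P.
have S : a * h @[h --> 0^'] --> (0 : R)^'.
  move=> A [e /= e0 eA]; exists (e / `|a|) => /=; first by rewrite divr_gt0// normr_gt0.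
  move=> y /=; rewrite /ball_ /= sub0r normrN => ye y0; apply: eA.
    by rewrite /ball_ /= sub0r normrN normrM mulrC -ltr_pdivlMr// normr_gt0.
  by rewrite mulf_neq0.
apply: cvg_trans (cvgMl_tmp (a := a) (cvg_comp _ _ S H)).
apply: near_eq_cvg; near=> h; have h0 : h != 0 by near: h; exact: nbhs_dnbhs_neq.
rewrite -[LHS]/(a * ((a * h)^-1 * (f (a * h + (a * x + b)) - f (a * x + b)))).
by rewrite [a * (h + x)]mulrDr -[a * h + a * x + b]addrA invfM mulrA [a * (_ * _)]mulrA mulfV// mul1r.
Unshelve. all: by end_near.
Qed.

Lemma Ck1_affine k f a b : Ck1 k f -> Ck1 k (fun x => f (a * x + b)).
Proof.
elim: k f => [//|k IH] f [f' df Cf]; exists (fun x => a * f' (a * x + b)).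
  by move=> x; exact: is_derive_affine.
exact/Ck1Z/IH.
Qed.

(** The classical flat function exp (-1/t) is the case k = 0; the powers of 1/t make the family
    stable under differentiation up to linear combinations. *)
Definition flat (k : nat) (t : R) : R :=
  if 0 < t then t^-1 ^+ k * expR (- t^-1) else 0.

(** exp (1/t) dominates the term of degree k + 2 of its series. Two powers of t are kept so that the
    difference quotient at 0 tends to 0. *)
Lemma flat_bound k : exists2 C : R, 0 <= C & forall t, `|flat k t| <= C * t ^+ 2.
Proof.
exists (k.+2)`!%:R => // t; rewrite /flat; case: ifPn => t0; last first.
  by rewrite normr0 mulr_ge0 ?sqr_ge0.
rewrite ger0_norm ?mulr_ge0 ?expR_ge0 ?exprn_ge0 ?invr_ge0 ?(ltW t0)//.
have := @expR_ge1Dxn R t^-1 k.+1; rewrite invr_ge0 (ltW t0) => /(_ isT).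
move=> /(le_trans _) H; have {}H : t^-1 ^+ k.+2 <= (k.+2)`!%:R * expR t^-1.
  rewrite mulrC -ler_pdivrMr ?ltr0n ?fact_gt0//; apply: H.
  by rewrite -lerBlDr subrr lerDr || rewrite lerDr.
rewrite expRN ler_pdivrMr ?expR_gt0// mulrAC -ler_pdivrMr ?exprn_gt0//.
by rewrite -exprVn -exprD addn2.
Qed.

Lemma flat_derive k (t : R) : is_derive t 1 (flat k) (flat k.+2 t - k%:R * flat k.+1 t).
Proof.
have [t0|t0|->] := ltgtP t 0.
- rewrite /flat ltNge (ltW t0) /= mulr0 subr0.
  apply: near_eq_is_derive (is_derive_cst (0 : R) t (1 : R)).
  near=> s; have s0 : s < 0 by near: s; exact: lt_nbhsl.
  by rewrite ltNge (ltW s0).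
- have tn0 : t != 0 by rewrite gt_eqF.
  have dV : is_derive t 1 (fun s : R => s^-1) (- t^-1 ^+ 2).
    have := @is_deriveV R id t 1 1 tn0 (is_derive_id _ _).
    by rewrite /= -[_ *: 1]/(_ * 1) mulr1 exprVn.
  have de : is_derive t 1 (fun s => expR (- s^-1)) (t^-1 ^+ 2 * expR (- t^-1)).
    have dNV : is_derive t 1 (fun s : R => - s^-1) (t^-1 ^+ 2).
      by rewrite -[_ ^+ 2]opprK; exact: is_deriveN.
    have := @is_derive1_comp R expR (fun s => - s^-1) t _ _ (is_derive_expR _) dNV.
    by rewrite mulrC.
  have main : is_derive t 1 (fun s => s^-1 ^+ k * expR (- s^-1))
      (t^-1 ^+ k.+2 * expR (- t^-1) - k%:R * (t^-1 ^+ k.+1 * expR (- t^-1))).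
    elim: k => [|k IH].
      rewrite mul0r subr0; under eq_fun do rewrite expr0 mul1r.
      exact: de.
    have := is_deriveM dV IH.
    rewrite (_ : (fun s : R => s^-1) * _ = (fun s => s^-1 ^+ k.+1 * expR (- s^-1))); last first.
      by apply/funext => s; rewrite -[LHS]/(s^-1 * (_ * _)) exprS mulrA.
    set d1 := (X in is_derive _ _ _ X -> _); set d2 := (X in _ -> is_derive _ _ _ X).
    suff -> : d1 = d2 by [].
    rewrite /d1 /d2 -[_ *: (_ - _)]/(_ * _) -[_ *: - _]/(_ * _).
    by rewrite -[k.+1%:R]natr1 !exprS; ring.
  rewrite /flat t0; apply: near_eq_is_derive main.
  near=> s; have s0 : 0 < s by near: s; exact: lt_nbhsr.
  by rewrite s0.
rewrite /flat ltxx mulr0 subr0; apply/is_derive1P.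
have [C C0 HC] := flat_bound k.
apply/cvgrPdist_lt => e e0; near=> h.
have h0 : h != 0 by near: h; exact: nbhs_dnbhs_neq.
rewrite sub0r normrN addr0 -/(flat k h) ltxx subr0 normrM normfV.
rewrite ltr_pdivrMl ?normr_gt0// (le_lt_trans (HC h))//.
rewrite -(@real_normK R h) ?num_real// expr2 mulrA [ltRHS]mulrC ltr_pM2r ?normr_gt0//.
apply: (@le_lt_trans _ _ ((C + 1) * `|h|)); first by rewrite ler_wpM2r// lerDl.
rewrite mulrC -ltr_pdivlMr ?ltr_wpDl//.
near: h; apply: dnbhs0_lt; rewrite divr_gt0// ltr_wpDl//.
Unshelve. all: by end_near.
Qed.

Lemma Ck1_flat n k : Ck1 n (flat k).
Proof.
elim: n k => [//|n IH] k; exists (fun t => flat k.+2 t - k%:R * flat k.+1 t).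
  by move=> t; exact: flat_derive.
apply: Ck1D => //; under eq_fun do rewrite -mulNr.
exact: Ck1Z.
Qed.

(** The dilation by n.+1 makes these bumps, with values in [0, 1], increase to the indicator of the
    open interval. *)
Definition smooth_bump (a b : R) (n : nat) (x : R) : R :=
  flat 0 (n.+1%:R * (x - a)) * flat 0 (n.+1%:R * (b - x)).

Lemma Ck1_bump a b n k : Ck1 k (smooth_bump a b n).
Proof.
rewrite /smooth_bump; apply: Ck1M.
  under eq_fun do rewrite mulrBr.
  exact/Ck1_affine/Ck1_flat.
under eq_fun do rewrite mulrBr addrC -mulNr.
exact/Ck1_affine/Ck1_flat.
Qed.

Lemma flat0_ge0 t : 0 <= flat 0 t.
Proof. by rewrite /flat; case: ifP => // _; rewrite mulr_ge0 ?expR_ge0. Qed.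

Lemma flat0_le1 t : flat 0 t <= 1.
Proof.
rewrite /flat; case: ifPn => // t0; rewrite expr0 mul1r -expR0 ler_expR.
by rewrite oppr_le0 invr_ge0 ltW.
Qed.

Lemma bump_ge0 a b n x : 0 <= smooth_bump a b n x.
Proof. by rewrite mulr_ge0 ?flat0_ge0. Qed.

Lemma bump_out a b n x : ~ `]a, b[%classic x -> smooth_bump a b n x = 0.
Proof.
rewrite /= in_itv /= => /negP; rewrite negb_and -!leNgt => /orP[xa|bx]; rewrite /smooth_bump /flat.
  by rewrite ifN ?mul0r// -leNgt mulr_ge0_le0// subr_le0.
by rewrite [X in _ * X]ifN ?mulr0// -leNgt mulr_ge0_le0// subr_le0.
Qed.

Lemma bump_le1 a b n x : smooth_bump a b n x <= 1.
Proof. by rewrite mulr_ile1 ?flat0_ge0 ?flat0_le1. Qed.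

Lemma flat0_cvg (y : R) : 0 < y -> flat 0 (n.+1%:R * y) @[n --> \oo] --> (1 : R).
Proof.
move=> y0.
have -> : (fun n => flat 0 (n.+1%:R * y)) = (fun n => expR (- (n.+1%:R^-1 * y^-1))).
  by apply/funext => n; rewrite /flat pmulr_rgt0// y0 expr0 mul1r invfM.
rewrite -[X in _ --> X]expR0; apply: continuous_cvg; first exact: continuous_expR.
rewrite -oppr0; apply: cvgN; rewrite -(mul0r y^-1); apply: cvgMr_tmp.
exact: cvg_harmonic.
Qed.

Lemma bump_cvg a b x : smooth_bump a b n x @[n --> \oo] --> (\1_(`]a, b[%classic) x : R).
Proof.
have [xI|xI] := pselect (`]a, b[%classic x).
  rewrite indicE mem_set// -[X in _ --> X](mulr1 (1 : R)).
  move: xI; rewrite /= in_itv /= => /andP[ax xb].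
  by apply: cvgM; apply: flat0_cvg; rewrite subr_gt0.
rewrite indicE memNset//; under eq_cvg do rewrite bump_out//.
exact: cvg_cst.
Qed.

End Bump.

(** * Products of bumps and the fundamental lemma of the calculus of variations *)

Section TestFunctionDensity.
Variable R : realType.
Local Notation vol := (vol R).
Local Notation MR := (measurableTypeR R).

Definition tensor (a b c : R -> R) (x : R3 R) : R := a x.1.1 * b x.1.2 * c x.2.

Lemma is_derive_tensor (a b c : R -> R) (x : R3 R) :
  [/\ forall a', is_derive (x.1.1 : R) 1 a (a' x.1.1) ->
        is_derive x (basis_vec R (@Ordinal 3 0 isT)) (tensor a b c) (tensor a' b c x),
      forall b', is_derive (x.1.2 : R) 1 b (b' x.1.2) ->
        is_derive x (basis_vec R (@Ordinal 3 1 isT)) (tensor a b c) (tensor a b' c x) &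
      forall c', is_derive (x.2 : R) 1 c (c' x.2) ->
        is_derive x (basis_vec R (@Ordinal 3 2 isT)) (tensor a b c) (tensor a b c' x)].
Proof.
have gen (f : R -> R) (y df k : R) (v : R3 R) : is_derive y 1 f df ->
    (forall h : R, h^-1 *: ((tensor a b c \o shift x) (h *: v) - tensor a b c x) =
       h^-1 * (f (h + y) - f y) * k) ->
    is_derive x v (tensor a b c) (df * k).
  move=> /is_derive1P H E.
  have {}H : h^-1 *: ((tensor a b c \o shift x) (h *: v) - tensor a b c x) @[h --> 0^'] --> df * k.
    by rewrite (funext E); apply: cvgMr_tmp.
  apply: DeriveDef; first by apply/cvg_ex; exists (df * k).
  exact: cvg_lim.
split=> f' Hf.
- rewrite (_ : tensor f' b c x = f' x.1.1 * (b x.1.2 * c x.2)); last by rewrite /tensor mulrA.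
  apply: gen Hf _ => h; rewrite /tensor /= -[LHS]/(h^-1 * (a (h * 1 + x.1.1) * b (h * 0 + x.1.2) * c (h * 0 + x.2) - _)).
  by rewrite mulr1 !mulr0 !add0r; ring.
- rewrite (_ : tensor a f' c x = f' x.1.2 * (a x.1.1 * c x.2)); last by rewrite /tensor; ring.
  apply: gen Hf _ => h; rewrite /tensor /= -[LHS]/(h^-1 * (a (h * 0 + x.1.1) * b (h * 1 + x.1.2) * c (h * 0 + x.2) - _)).
  by rewrite mulr1 !mulr0 !add0r; ring.
- rewrite (_ : tensor a b f' x = f' x.2 * (a x.1.1 * b x.1.2)); last by rewrite /tensor; ring.
  apply: gen Hf _ => h; rewrite /tensor /= -[LHS]/(h^-1 * (a (h * 0 + x.1.1) * b (h * 0 + x.1.2) * c (h * 1 + x.2) - _)).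
  by rewrite mulr1 !mulr0 !add0r; ring.
Qed.

Lemma Ck1_continuous k f : Ck1 k.+1 f -> continuous (f : R -> R).
Proof.
move=> [f' df _] x; apply: differentiable_continuous; apply/derivable1_diffP.
by case: (df x).
Qed.

Lemma tensor_continuous (a b c : R -> R) : continuous a -> continuous b -> continuous c ->
  continuous (tensor a b c).
Proof.
move=> ca cb cc x; apply: cvgM; first apply: cvgM.
- apply: (cvg_comp _ _ (cvg_comp _ _ cvg_fst cvg_fst)); exact: ca.
- apply: (cvg_comp _ _ (cvg_comp _ _ cvg_fst cvg_snd)); exact: cb.
- apply: (cvg_comp _ _ cvg_snd); exact: cc.
Qed.

(** One derivative more is asked of the factors, since the continuity of the last derivative is read
    off from its derivability. *)
Lemma C_k_tensor k (a b c : R -> R) : Ck1 k.+1 a -> Ck1 k.+1 b -> Ck1 k.+1 c ->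
  C_k k (tensor a b c).
Proof.
elim: k a b c => [|k IH] a b c Ha Hb Hc.
  apply: tensor_continuous; [exact: Ck1_continuous Ha|exact: Ck1_continuous Hb|exact: Ck1_continuous Hc].
split.
  apply: tensor_continuous; [exact: Ck1_continuous Ha|exact: Ck1_continuous Hb|exact: Ck1_continuous Hc].
have [a' da Ca] := Ha; have [b' db Cb] := Hb; have [c' dc Cc] := Hc.
have step v (t : R3 R -> R) : (forall x, is_derive x v (tensor a b c) (t x)) -> C_k k t ->
    (forall x, derivable (tensor a b c) x v) /\ C_k k (fun x => 'D_v (tensor a b c) x).
  move=> Hd Ct; split=> [x|]; first by case: (Hd x).
  by rewrite (_ : (fun x => _) = t)//; apply/funext => x; case: (Hd x).
case=> -[|[|[|//]]] i3.
- rewrite (_ : Ordinal i3 = @Ordinal 3 0 isT); last exact: val_inj.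
  apply: (step _ (tensor a' b c)); last by apply: IH => //; exact: Ck1W.
  by move=> x; have [H _ _] := is_derive_tensor a b c x; exact: H.
- rewrite (_ : Ordinal i3 = @Ordinal 3 1 isT); last exact: val_inj.
  apply: (step _ (tensor a b' c)); last by apply: IH => //; exact: Ck1W.
  by move=> x; have [_ H _] := is_derive_tensor a b c x; exact: H.
- rewrite (_ : Ordinal i3 = @Ordinal 3 2 isT); last exact: val_inj.
  apply: (step _ (tensor a b c')); last by apply: IH => //; exact: Ck1W.
  by move=> x; have [_ _ H] := is_derive_tensor a b c x; exact: H.
Qed.

Definition box (p q : R3 R) : set (R3 R) :=
  (`]p.1.1, q.1.1[%classic `*` `]p.1.2, q.1.2[%classic) `*` `]p.2, q.2[%classic.

Definition box_bump (p q : R3 R) (n : nat) : R3 R -> R :=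
  tensor (smooth_bump p.1.1 q.1.1 n) (smooth_bump p.1.2 q.1.2 n) (smooth_bump p.2 q.2 n).

Lemma box_bump_out p q n x : ~ box p q x -> box_bump p q n x = 0.
Proof.
move=> nb; rewrite /box_bump /tensor.
have [h1|/bump_out->] := pselect (`]p.1.1, q.1.1[%classic x.1.1); last by rewrite !mul0r.
have [h2|/bump_out->] := pselect (`]p.1.2, q.1.2[%classic x.1.2); last by rewrite mulr0 mul0r.
have [h3|/bump_out->] := pselect (`]p.2, q.2[%classic x.2); last by rewrite mulr0.
by case: nb.
Qed.

Lemma test_function_box_bump p q n : test_function (box_bump p q n).
Proof.
split=> [k|]; first by apply: C_k_tensor; exact: Ck1_bump.
pose K : set (R3 R) :=
  (`[p.1.1, q.1.1]%classic `*` `[p.1.2, q.1.2]%classic) `*` `[p.2, q.2]%classic.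
have cK : compact K.
  by apply: compact_setX; [apply: compact_setX|]; exact: segment_compact.
apply: (subclosed_compact _ cK); first exact: closed_closure.
apply: (@subset_trans _ (closure K)); last first.
  rewrite -(proj1 (closure_id _)); first by [].
  by apply: compact_closed cK; exact: norm_hausdorff.
apply: closure_subset => x /= /eqP bx.
have [[[h1 h2] h3]|/box_bump_out/bx//] := pselect (box p q x).
by split; [split|]; apply: subset_itv_oo_cc.
Qed.

Lemma measurable_box p q : measurable (box p q).
Proof. by apply: measurableX => //; exact: measurableX. Qed.

Lemma vol_box_lty p q : (vol (box p q) < +oo)%E.
Proof.
rewrite /Defs.vol /box /=.
have mI (a b : R) : measurable (`]a, b[%classic : set MR) by [].
rewrite product_measure1E//=; last exact: measurableX.
rewrite product_measure1E//= !lebesgue_measure_itv /=.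
by do 3 case: ifP => _; rewrite -?EFinD -?EFinM ?mul0e ?mule0 ?mul0e ltry.
Qed.

Lemma box_bump_cvg p q x : box_bump p q n x @[n --> \oo] --> (\1_(box p q) x : R).
Proof.
rewrite (_ : \1_(box p q) x = \1_(`]p.1.1, q.1.1[%classic) x.1.1 *
  \1_(`]p.1.2, q.1.2[%classic) x.1.2 * \1_(`]p.2, q.2[%classic) x.2); last first.
  by rewrite /box !indicE !in_setX; do 3 case: (_ \in _); rewrite /= ?mulr1 ?mulr0.
by apply: cvgM; [apply: cvgM|]; exact: bump_cvg.
Qed.

Lemma box_bump_le p q n x : `|box_bump p q n x| <= \1_(box p q) x.
Proof.
have [xb|xb] := pselect (box p q x); last by rewrite box_bump_out// normr0 indicE.
rewrite indicE mem_set// ger0_norm; last first.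
  by apply: mulr_ge0; [apply: mulr_ge0|]; exact: bump_ge0.
apply: mulr_ile1; [by apply: mulr_ge0; exact: bump_ge0|exact: bump_ge0| |exact: bump_le1].
by apply: mulr_ile1; (exact: bump_ge0 || exact: bump_le1).
Qed.

Lemma Lfun_indic_box p q : (\1_(box p q) : R3 R -> R) \in Lfun vol 2%:E.
Proof.
apply: Lfun2_sqr; first exact: measurable_indic (measurable_box _ _).
rewrite (_ : (fun x => _) = (EFin \o \1_(box p q))); last first.
  by apply/funext => x /=; rewrite indicE; case: (_ \in _); rewrite ?expr1n ?expr0n.
rewrite integral_indic//; last exact: measurable_box.
by rewrite setIT vol_box_lty.
Qed.

Variable g : R3 R -> R.
Hypothesis Lg : g \in Lfun vol 2%:E.
Hypothesis g0 : forall phi, test_function phi -> \int[vol]_x (g x * phi x) = 0.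

(** Bumps converge to the indicator of the box and are dominated by it, and g times that indicator
    is integrable as a product of two L2 functions. *)
Lemma integral_box_eq0 p q : (\int[vol]_x (g x * \1_(box p q) x)%:E = 0)%E.
Proof.
have mg := Lfun2_measurable Lg.
have Lb := Lfun_indic_box p q.
have mb := Lfun2_measurable Lb.
have mn n : measurable_fun setT (box_bump p q n).
  by apply: continuous_measurable_R3; exact: (test_function_box_bump p q n).1 0%N.
have i1 := Lfun2_mul_integrable Lg Lb.
have i2 := integrable_abse i1.
have [] := @dominated_convergence _ _ _ vol setT measurableT
  (fun n x => (g x * box_bump p q n x)%:E) (fun x => (g x * \1_(box p q) x)%:E) _ _ _ _ i2.
- by move=> n; apply/measurable_EFinP; exact: measurable_funM.
- by apply/measurable_EFinP; exact: measurable_funM.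
- apply: nearW => x _; apply: cvg_EFin; first exact: nearW.
  by apply: cvgMl_tmp; exact: box_bump_cvg.
- apply: nearW => x n _ /=; rewrite lee_fin (normrM (g x) (box_bump p q n x)) (normrM (g x) (\1_(box p q) x)) ler_wpM2l//.
  by rewrite [leRHS]ger0_norm ?box_bump_le// indicE.
move=> _ _ H; apply/esym; apply: (cvg_unique _ _ H) => //.
rewrite (_ : [sequence _]_n = cst 0%E); first exact: cvg_cst.
apply/funext => n /=; have tb := test_function_box_bump p q n.
have := g0 tb; rewrite /Rintegral => H0.
have i3 := Lfun2_mul_integrable Lg (test_function_Lfun tb).
by rewrite -[LHS]fineK ?(integrable_fin_num measurableT i3)// H0.
Qed.

Definition boxes : set (set (R3 R)) := [set A | exists p q, A = box p q].

Lemma setI_closed_boxes : setI_closed boxes.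
Proof.
move=> _ _ [p [q ->]] [p' [q' ->]].
exists ((Num.max p.1.1 p'.1.1, Num.max p.1.2 p'.1.2), Num.max p.2 p'.2),
  ((Num.min q.1.1 q'.1.1, Num.min q.1.2 q'.1.2), Num.min q.2 q'.2).
have I (a b a' b' : R) : `]a, b[%classic `&` `]a', b'[%classic = `]Num.max a a', Num.min b b'[%classic.
  apply/seteqP; split=> x /=; rewrite !in_itv /= gt_max lt_min.
    by move=> [/andP[-> ->] /andP[-> ->]].
  by move=> /andP[/andP[-> ->] /andP[-> ->]].
rewrite /box /= -!I; apply/seteqP; split=> x /=.
  by move=> [[[? ?] ?] [[? ?] ?]].
by move=> [[[? ?] [? ?]] [? ?]].
Qed.

(** Each half-space x_i > a is a countable union of boxes, so the coordinates, and with them the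
    identity, are measurable for the generated sigma-algebra. *)
Lemma measurable_boxes : (@measurable _ (R3 R)) `<=` <<s boxes >>.
Proof.
pose S : Type := g_sigma_algebraType boxes.
have bb (f : S -> MR) (F : R -> nat -> set (R3 R)) : (forall a n, boxes (F a n)) ->
    (forall a, f @^-1` `]a, +oo[%classic = \bigcup_n (F a n)) -> measurable_fun setT f.
  move=> bF fF; apply: (measurability _ (RGenOInfty.measurableE R)) => //.
  move=> /= _ [_ [a ->] <-]; rewrite setTI fF; apply: bigcup_measurable => n _.
  by apply: sub_sigma_algebra; exact: bF.
have big (x y z : R) : exists n : nat, [/\ x < n%:R, y < n%:R & z < n%:R] /\
    [/\ - n%:R < x, - n%:R < y & - n%:R < z].
  exists (Num.trunc (`|x| + `|y| + `|z|)).+1.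
  have h : `|x| + `|y| + `|z| < (Num.trunc (`|x| + `|y| + `|z|)).+1%:R.
    by apply: truncnS_gt.
  have nx := normr_ge0 x; have ny := normr_ge0 y; have nz := normr_ge0 z.
  have hx : `|x| < (Num.trunc (`|x| + `|y| + `|z|)).+1%:R by apply: le_lt_trans h; lra.
  have hy : `|y| < (Num.trunc (`|x| + `|y| + `|z|)).+1%:R by apply: le_lt_trans h; lra.
  have hz : `|z| < (Num.trunc (`|x| + `|y| + `|z|)).+1%:R by apply: le_lt_trans h; lra.
  move: hx hy hz; rewrite !ltr_norml => /andP[-> ->] /andP[-> ->] /andP[-> ->].
  by [].
have m1 : measurable_fun setT (fun x : S => (x : R3 R).1.1 : MR).
  apply: (bb _ (fun a n => box ((a, - n%:R), - n%:R) ((n%:R, n%:R), n%:R))) => [a n|a].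
    by do 2 eexists.
  apply/seteqP; split=> [[[x y] z] /=|[[x y] z] [n _]]; rewrite /box /= !in_itv /= ?andbT.
    move=> ax; have [n [[h1 h2 h3] [h4 h5 h6]]] := big x y z; exists n => //=.
    by rewrite !in_itv /= ax h1 h2 h3 h5 h6.
  by move=> [[/andP[]]].
have m2 : measurable_fun setT (fun x : S => (x : R3 R).1.2 : MR).
  apply: (bb _ (fun a n => box ((- n%:R, a), - n%:R) ((n%:R, n%:R), n%:R))) => [a n|a].
    by do 2 eexists.
  apply/seteqP; split=> [[[x y] z] /=|[[x y] z] [n _]]; rewrite /box /= !in_itv /= ?andbT.
    move=> ax; have [n [[h1 h2 h3] [h4 h5 h6]]] := big x y z; exists n => //=.
    by rewrite !in_itv /= ax h1 h2 h3 h4 h6.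
  by move=> [[_ /andP[]]].
have m3 : measurable_fun setT (fun x : S => (x : R3 R).2 : MR).
  apply: (bb _ (fun a n => box ((- n%:R, - n%:R), a) ((n%:R, n%:R), n%:R))) => [a n|a].
    by do 2 eexists.
  apply/seteqP; split=> [[[x y] z] /=|[[x y] z] [n _]]; rewrite /box /= !in_itv /= ?andbT.
    move=> ax; have [n [[h1 h2 h3] [h4 h5 h6]]] := big x y z; exists n => //=.
    by rewrite !in_itv /= ax h1 h2 h3 h4 h5.
  by move=> [_ /andP[]].
have mid : measurable_fun setT (fun x : S => x : R3 R).
  have := measurable_fun_pair (measurable_fun_pair m1 m2) m3.
  by congr (measurable_fun _ _); apply/funext => -[[x y] z].
move=> A mA; have := mid measurableT A mA.
by rewrite setTI preimage_id.
Qed.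

Lemma orthogonal_test_functions_ae0 : {ae vol, forall x, g x = 0}.
Proof.
pose Q n := box ((- n%:R, - n%:R), - n%:R) ((n%:R, n%:R), n%:R).
(* An L2 function on the whole space need not be integrable; its restriction to a cube is. *)
pose gn n x := (g x * \1_(Q n) x)%:E : \bar R.
have mg := Lfun2_measurable Lg.
have ig n : vol.-integrable setT (gn n) by exact: Lfun2_mul_integrable Lg (Lfun_indic_box _ _).
have igA n A : measurable A -> vol.-integrable A (gn n).
  by move=> mA; apply: integrableS (ig n).
have all0 n A : measurable A -> (\int[vol]_(x in A) gn n x = 0)%E.
  move=> mA.
  (* The sets with zero integral form a Dynkin system that contains the boxes, a class stable under
     intersection. *)
  pose H : set (set (R3 R)) := [set A | measurable A /\ (\int[vol]_(x in A) gn n x = 0)%E].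
  suff : H A by case.
  have dH : dynkin H.
    split.
    - by split=> //; exact: integral_box_eq0.
    - move=> B [mB B0]; split; first exact: measurableC.
      have : (\int[vol]_x gn n x = 0)%E by exact: integral_box_eq0.
      rewrite -(setUv B) integral_setU_EFin//; last 3 first.
      + exact: measurableC.
      + rewrite setUv; apply: measurable_funM => //.
        exact: measurable_indic (measurable_box _ _).
      + exact/disj_setPCl.
      by rewrite B0 add0e.
    - move=> F tF HF; split; first by apply: bigcup_measurable => k _; case: (HF k).
      rewrite integral_bigcup//.
      + by apply: eseries0 => k _ _; case: (HF k).
      + by move=> k; case: (HF k).
      + by apply: igA; apply: bigcup_measurable => k _; case: (HF k).
  have := measurable_boxes mA.
  rewrite -(setI_closed_g_dynkin_g_sigma_algebra setI_closed_boxes); apply => //.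
  split=> // _ [p [q ->]]; split; first exact: measurable_box.
  have [p' [q' E]] := setI_closed_boxes (ex_intro _ p (ex_intro _ q erefl) : boxes (box p q))
    (ex_intro _ _ (ex_intro _ _ erefl) : boxes (Q n)).
  rewrite integral_mkcond -[RHS](integral_box_eq0 p' q'); apply: eq_integral => x _.
  rewrite -E /patch /gn !indicE in_setI; case: (x \in box p q) => //=.
  by rewrite mulr0.
have ae0 n : {ae vol, forall x, gn n x = 0%E}.
  have := @integral_ae_eq _ _ _ vol setT measurableT (cst 0%E) (gn n) (ig n).
  have mc : measurable_fun setT (cst 0%E : R3 R -> \bar R) by exact: measurable_cst.
  move=> /(_ mc) /(_ _)/wrap[].
    by move=> E _ mE; rewrite all0// integral0.
  by apply: filterS => x /(_ I).
have := (ae_foralln (mu := vol) (P := fun n x => gn n x = 0%E)) ae0.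
apply: filterS => x Hx.
pose n := (Num.trunc (`|x.1.1| + `|x.1.2| + `|x.2|)).+1.
have h : `|x.1.1| + `|x.1.2| + `|x.2| < n%:R by apply: truncnS_gt.
have := Hx n; rewrite /gn indicE mem_set ?mulr1 => [[]//|].
have nx := normr_ge0 x.1.1; have ny := normr_ge0 x.1.2; have nz := normr_ge0 x.2.
have hx : `|x.1.1| < n%:R by apply: le_lt_trans h; lra.
have hy : `|x.1.2| < n%:R by apply: le_lt_trans h; lra.
have hz : `|x.2| < n%:R by apply: le_lt_trans h; lra.
by rewrite /Q /box /=; split; [split|]; rewrite /= in_itv /= -ltr_norml.
Qed.

End TestFunctionDensity.

(** * The Banach algebra B(H1) *)

Section AnalyticLinear.
Variable R : realType.
Implicit Types E F G : normedModType R.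

Lemma norm_fst_le E F (p : E * F) : `|p.1| <= `|p|.
Proof. by rewrite prod_normE le_max lexx. Qed.

Lemma norm_snd_le E F (p : E * F) : `|p.2| <= `|p|.
Proof. by rewrite prod_normE le_max lexx orbT. Qed.

Lemma analytic_diff_fst E F (x : E * F) : analytic_diff (@fst E F) x (@fst E F).
Proof.
apply: (@analytic_diff_lin _ _ _ _ 1) => // h.
by rewrite mul1r norm_fst_le.
Qed.

Lemma analytic_diff_snd E F (x : E * F) : analytic_diff (@snd E F) x (@snd E F).
Proof.
apply: (@analytic_diff_lin _ _ _ _ 1) => // h.
by rewrite mul1r norm_snd_le.
Qed.

Lemma analytic_diff_opp E F (f : E -> F) x L : analytic_diff f x L ->
  analytic_diff (fun y => - f y) x (fun h => - L h).
Proof.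
move=> Hf; apply: (analytic_diff_comp Hf (g := fun y => - y) (K := fun h => - h)).
apply: (@analytic_diff_lin _ _ _ _ 1) => [c u v|h]; first by rewrite opprD scalerN.
by rewrite normrN mul1r.
Qed.

Lemma analytic_diff_add E F (f g : E -> F) x L K :
  analytic_diff f x L -> analytic_diff g x K ->
  analytic_diff (fun y => f y + g y) x (fun h => L h + K h).
Proof.
move=> Hf Hg; have H := analytic_diff_pair Hf Hg.
apply: (analytic_diff_comp H (g := fun p => p.1 + p.2) (K := fun p => p.1 + p.2)).
apply: (@analytic_diff_lin _ _ _ _ 2) => [c u v|h].
  by rewrite /= scalerDr addrACA.
rewrite (le_trans (ler_normD _ _))// [leRHS](_ : _ = `|h| + `|h|); last by ring.
by rewrite lerD ?norm_fst_le ?norm_snd_le.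
Qed.

Lemma analytic_diff_sub E F (f g : E -> F) x L K :
  analytic_diff f x L -> analytic_diff g x K ->
  analytic_diff (fun y => f y - g y) x (fun h => L h - K h).
Proof. by move=> Hf Hg; apply: analytic_diff_add => //; exact: analytic_diff_opp. Qed.

Lemma analytic_diff_id E (x : E) : analytic_diff id x id.
Proof. by apply: (@analytic_diff_lin _ _ _ _ 1) => // h; rewrite mul1r. Qed.

End AnalyticLinear.

(** * Products, power series and inverses of operators *)

Section OperatorAlgebra.
Variable R : realType.
Local Notation B := (bop R).
Implicit Types (S T X Y : B) (r : R).

Lemma norm_bopM S T : `|S * T| <= `|S| * `|T|.
Proof.
apply: op_norm_lub => u u1; apply: le_trans (op_normP S (T u)) _.
rewrite ler_wpM2l ?op_norm_ge0//; exact: op_norm_ub.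
Qed.

Lemma norm_bop1 : `|1 : B| <= 1.
Proof. by apply: op_norm_lub => u u1. Qed.

Lemma bop_scaleAl r S T : (r *: S) * T = r *: (S * T).
Proof. exact: bop_eq. Qed.

Lemma bop_scaleAr r S T : S * (r *: T) = r *: (S * T).
Proof. by apply: bop_eq => u; exact: bopZ. Qed.

Lemma norm_bop_prod n (h : nat -> B) : `|\prod_(i < n) h i| <= \prod_(i < n) `|h i|.
Proof.
elim: n => [|n IH]; first by rewrite !big_ord0 norm_bop1.
rewrite !big_ord_recr /=; apply: le_trans (norm_bopM _ _) _.
by rewrite ler_wpM2r.
Qed.

Lemma norm_bopX n X : `|X ^+ n| <= `|X| ^+ n.
Proof.
elim: n => [|n IH]; first by rewrite !expr0 norm_bop1.
by rewrite !exprS (le_trans (norm_bopM _ _))// ler_wpM2l.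
Qed.

Lemma analytic_diff_mul (E : normedModType R) (f g : E -> B) x L K :
  analytic_diff f x L -> analytic_diff g x K ->
  analytic_diff (fun y => f y * g y) x (fun h => f x * K h + L h * g x).
Proof.
move=> Hf Hg; have H := analytic_diff_pair Hf Hg.
apply: (analytic_diff_comp H (g := fun p : B * B => p.1 * p.2)
  (K := fun h : B * B => f x * h.2 + h.1 * g x)).
apply: (@analytic_diff_bilin _ _ _ _ (fun S T => S * T) 1 (f x, g x)) => //.
- by move=> v c u u'; rewrite mulrDl bop_scaleAl.
- by move=> u c v v'; rewrite mulrDr bop_scaleAr.
- by move=> u v; rewrite mul1r norm_bopM.
Qed.

(** Common form of the exponential, with coefficients 1 / k!, and of the Neumann series, with
    coefficients 1. Coefficients bounded by 1 give convergence for |X| <= 1/2. *)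
Definition power_series (c : nat -> R) X : B := limn (fun n => \sum_(k < n) c k *: X ^+ k).

Lemma power_series_cvg (c : nat -> R) X : (forall k, `|c k| <= 1) -> `|X| <= 2^-1 ->
  (\sum_(k < n) c k *: X ^+ k) @[n --> \oo] --> power_series c X.
Proof.
move=> c1 X1; suff : cvg ((\sum_(k < n) c k *: X ^+ k) @[n --> \oo]) by [].
apply: banach_bop; apply: cauchy_exP => e e0.
have C := @geometric_cvg0 R 2; have [N _ HN] := (cvgrPdist_lt _ _).1 C _ e0.
exists (\sum_(k < N) c k *: X ^+ k); exists N => // n /= Nn; rewrite -ball_normE /= distrC.
rewrite -!(big_mkord xpredT (fun k => c k *: X ^+ k)) (big_cat_nat (n := N))//= addrAC subrr add0r.
apply: le_lt_trans (ler_norm_sum _ _ _) _.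
apply: (@le_lt_trans _ _ (2 * `|X| ^+ N)).
  apply: le_trans (geometric_tail N n (normr_ge0 X) X1).
  apply: ler_sum => k _; rewrite normrZ (le_trans _ (norm_bopX k X))//.
  by rewrite ler_piMl.
have := HN N (leqnn N); rewrite sub0r normrN => /(le_lt_trans (ler_norm _)); apply: le_lt_trans.
by rewrite ler_wpM2l// lerXn2r// nnegrE.
Qed.

Lemma analytic_diff_power_series (c : nat -> R) : (forall k, `|c k| <= 1) ->
  analytic_diff (power_series c) (0 : B) (fun X => c 1%N *: X).
Proof.
move=> c1; exists (fun k (h : nat -> B) => c k *: \prod_(i < k) h i), 1, 2^-1.
split; last by move=> h; rewrite big_ord1.
split.
- by rewrite ler01 invr_gt0.
- move=> k; split=> [p h r u v pk|h h' hh]; last first.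
    by congr (_ *: _); apply: eq_bigr => i _; exact: hh.
  have split_prod w : \prod_(i < k) upd h p w i =
      (\prod_(i < p) h i) * (w * \prod_(p.+1 <= i < k) h i).
    rewrite -(big_mkord xpredT (upd h p w)) (big_cat_nat (n := p)) ?(ltnW pk)//=.
    rewrite (big_ltn pk) {2}/upd eqxx; congr (_ * (_ * _)).
      by rewrite big_mkord; apply: eq_bigr => i _; rewrite /upd ltn_eqF.
    by rewrite big_nat [RHS]big_nat; apply: eq_bigr => i /andP[pi _]; rewrite /upd gtn_eqF.
  rewrite !split_prod mulrDl mulrDr bop_scaleAl bop_scaleAr scalerDr.
  by rewrite !scalerA mulrC.
- move=> k h; rewrite mul1r normrZ.
  apply: (@le_trans _ _ `|\prod_(i < k) h i|); first by rewrite ler_piMl.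
  apply: le_trans (norm_bop_prod _ _) _; apply: ler_prod => i _.
  by rewrite normr_ge0 invrK ler_peMr// ler1n.
- move=> h hr; rewrite add0r.
  have E n : \sum_(k < n) c k *: \prod_(i < k) h = \sum_(k < n) c k *: h ^+ k.
    by apply: eq_bigr => k _; rewrite prodr_const card_ord.
  by under eq_cvg do rewrite E; apply: power_series_cvg => //; exact: ltW.
Qed.

Lemma analytic_diff_exp : analytic_diff (@exp_bop R) (0 : B) id.
Proof.
have H := @analytic_diff_power_series (fun k => (k`!%:R : R)^-1).
apply: analytic_diff_eq (H _) => [h|k]; first by rewrite invr1 scale1r.
by rewrite normfV normr_nat invf_le1 ?ltr0n ?fact_gt0// ler1n fact_gt0.
Qed.

Lemma exp_bop0 : exp_bop (0 : B) = 1.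
Proof.
apply: cvg_lim => //; apply: (@cvg_eventually _ _ _ 1) => n.
rewrite big_ord_recl /= fact0 invr1 scale1r expr0 big1 ?addr0// => i _.
by rewrite expr0n scaler0.
Qed.

(** If exp X = 1 then X is minus the tail of the series from degree 2, whence |X| <= |X|^2. This
    settles the choice hidden in the chart map of [exp_chart] at its centre. *)
Lemma exp_bop_eq1 X : `|X| < 2^-1 -> exp_bop X = 1 -> X = 0.
Proof.
move=> X1 eX.
have c1 k : `|(k`!%:R : R)^-1| <= 1.
  by rewrite normfV normr_nat invf_le1 ?ltr0n ?fact_gt0// ler1n fact_gt0.
have := power_series_cvg c1 (ltW X1); rewrite [power_series _ _]eX => H.
have {}H : (1 + X - \sum_(k < n) (k`!%:R : R)^-1 *: X ^+ k) @[n --> \oo] --> 1 + X - 1.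
  by apply: cvgB => //; exact: cvg_cst.
rewrite [1 + X]addrC addrK in H.
have : `|X| <= `|X| ^+ 2.
  apply: (cvg_norm_le (k := 2) _ H) => n.
  rewrite -(big_mkord xpredT (fun k => (k`!%:R : R)^-1 *: X ^+ k)) big_ltn// big_ltn//.
  rewrite fact0 invr1 expr0 expr1 !scale1r addrA [1 + X]addrC opprD addrA subrr sub0r normrN.
  apply: le_trans (ler_norm_sum _ _ _) _.
  apply: (@le_trans _ _ (2^-1 * \sum_(2 <= k < (2 + n)%N) `|X| ^+ k)).
    rewrite mulr_sumr; apply: ler_sum_nat => k /andP[k2 _].
    rewrite normrZ; apply: ler_pM => //; last exact: norm_bopX.
    rewrite normfV normr_nat lef_pV2 ?posrE ?ltr0n ?fact_gt0// ler_nat.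
    by apply: leq_trans (fact_geq k).
  rewrite mulrC ler_pdivrMr// mulrC; apply: geometric_tail => //; exact: ltW.
rewrite expr2 => H2; apply/eqP; rewrite -normr_eq0; apply: contraTT H2 => X0.
have Xp : 0 < `|X| by rewrite normr_gt0 -normr_eq0.
by rewrite -ltNge gtr_pMl// (lt_trans X1)// invf_lt1// ltr1n.
Qed.

Definition invb T := exists S : B, is_inverse S T.

Lemma inv_bopE S T : is_inverse S T -> inv_bop T = S.
Proof.
move=> ST; have [S1 S2] := ST; rewrite /inv_bop; case: xgetP => [U _ [U1 U2]|/(_ S)//].
by rewrite -[U]mulr1 -S2 mulrA U1 mul1r.
Qed.

Lemma inv_bopP T : invb T -> is_inverse (inv_bop T) T.
Proof. by move=> [S ST]; rewrite (inv_bopE ST). Qed.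

Lemma mulVb T : invb T -> inv_bop T * T = 1. Proof. by move=> /inv_bopP[]. Qed.
Lemma mulbV T : invb T -> T * inv_bop T = 1. Proof. by move=> /inv_bopP[]. Qed.

Lemma invb1 : invb 1. Proof. by exists 1; split; rewrite mulr1. Qed.

Lemma inv_bop1 : inv_bop (1 : B) = 1.
Proof. by apply: inv_bopE; split; rewrite mulr1. Qed.

Lemma is_inverseM S T : invb S -> invb T -> is_inverse (inv_bop T * inv_bop S) (S * T).
Proof.
move=> iS iT; split.
  by rewrite -mulrA [_ * (S * T)]mulrA mulVb// mul1r mulVb.
by rewrite -mulrA [T * _]mulrA mulbV// mul1r mulbV.
Qed.

Lemma invbM S T : invb S -> invb T -> invb (S * T).
Proof. by move=> iS iT; eexists; exact: is_inverseM. Qed.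

Lemma inv_bopM S T : invb S -> invb T -> inv_bop (S * T) = inv_bop T * inv_bop S.
Proof. by move=> iS iT; apply: inv_bopE; exact: is_inverseM. Qed.

Lemma neumann X : `|X| <= 2^-1 -> is_inverse (power_series (fun=> 1) X) (1 - X).
Proof.
move=> X1; have c1 (k : nat) : `|1 : R| <= 1 by rewrite normr1.
have H := @power_series_cvg (fun=> 1) X c1 X1; set S := power_series _ X in H *.
have tele n : (1 - X) * (\sum_(k < n) (1 : R) *: X ^+ k) = 1 - X ^+ n.
  elim: n => [|n IH]; first by rewrite big_ord0 mulr0 expr0 subrr.
  by rewrite big_ord_recr mulrDr IH scale1r mulrBl mul1r -exprS addrA subrK.
have tele' n : (\sum_(k < n) (1 : R) *: X ^+ k) * (1 - X) = 1 - X ^+ n.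
  elim: n => [|n IH]; first by rewrite big_ord0 mul0r expr0 subrr.
  by rewrite big_ord_recr mulrDl IH scale1r mulrBr mulr1 -exprSr addrA subrK.
have X0 : 1 - X ^+ n @[n --> \oo] --> (1 : B).
  apply/cvgrPdist_lt => e e0; have [N _ HN] := (cvgrPdist_lt _ _).1 (@geometric_cvg0 R 1) _ e0.
  exists N => // n /= /HN; rewrite sub0r normrN mul1r => /(le_lt_trans (ler_norm _)) hn.
  rewrite opprB addrCA subrr addr0; apply: le_lt_trans hn.
  by rewrite (le_trans (norm_bopX _ _))// lerXn2r// nnegrE.
(* Covers left and right multiplication by [1 - X], so both telescoped products pass to the
   limit. *)
have lip (f : B -> B) : (forall U V, f U - f V = f (U - V)) ->
    (forall U, `|f U| <= `|1 - X| * `|U|) ->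
    (f (\sum_(k < n) (1 : R) *: X ^+ k)) @[n --> \oo] --> f S.
  move=> fB fl; apply/cvgrPdist_lt => e e0.
  have q0 : 0 < e / (`|1 - X| + 1) by rewrite divr_gt0// ltr_wpDl.
  have [N _ HN] := (cvgrPdist_lt _ _).1 H _ q0.
  exists N => // n /= /HN hn; rewrite fB (le_lt_trans (fl _))//.
  apply: (@le_lt_trans _ _ ((`|1 - X| + 1) * `|S - \sum_(k < n) (1 : R) *: X ^+ k|)).
    by rewrite ler_wpM2r// lerDl.
  by rewrite mulrC -ltr_pdivlMr// ltr_wpDl.
split.
  have := lip (fun U => U * (1 - X)) (fun U V => esym (mulrBl _ _ _)).
  move=> /(_ (fun U => _)) => K.
  have {}K : (\sum_(k < n) (1 : R) *: X ^+ k) * (1 - X) @[n --> \oo] --> S * (1 - X).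
    by apply: K => U; rewrite mulrC norm_bopM.
  rewrite (funext tele') in K; exact: (cvg_unique _ K X0).
have := lip (fun U => (1 - X) * U) (fun U V => esym (mulrBr _ _ _)) (norm_bopM _).
by rewrite (funext tele) => K; exact: (cvg_unique _ K X0).
Qed.

(** T = A (1 - X) with X = A^-1 (A - T) small, so the Neumann series inverts it. The inverse becomes
    locally a power series in T, which is what makes inversion analytic. *)
Lemma inv_bop_near A : invb A ->
  \forall T \near A, invb T /\ inv_bop T = power_series (fun=> 1) (inv_bop A * (A - T)) * inv_bop A.
Proof.
move=> iA; have q0 : 0 < 2^-1 / (`|inv_bop A| + 1) by rewrite divr_gt0// ltr_wpDl.
apply/nbhs_ballP; exists (2^-1 / (`|inv_bop A| + 1)) => //= T; rewrite -ball_normE /= => AT.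
set X := inv_bop A * (A - T).
have X1 : `|X| <= 2^-1.
  apply: le_trans (norm_bopM _ _) _.
  apply: (@le_trans _ _ ((`|inv_bop A| + 1) * `|A - T|)); first by rewrite ler_wpM2r// lerDl.
  by rewrite mulrC -ler_pdivlMr ?ltr_wpDl// ltW.
have N := neumann X1.
have TE : T = A * (1 - X).
  by rewrite /X mulrBr mulr1 mulrA mulbV// mul1r opprB addrC subrK.
have i1 : invb (1 - X) by eexists; exact: N.
by split; rewrite TE; [exact: invbM|rewrite inv_bopM// (inv_bopE N)].
Qed.

Lemma open_invb : open [set T | invb T].
Proof.
rewrite openE => A /= iA; rewrite /interior /=; move: (inv_bop_near iA).
by apply: filterS => T [].
Qed.

Lemma analytic_diff_inv A : invb A ->
  analytic_diff (@inv_bop R) A (fun H => - (inv_bop A * H * inv_bop A)).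
Proof.
move=> iA.
have e : \forall T \near A, power_series (fun=> 1) (inv_bop A * (A - T)) * inv_bop A = inv_bop T.
  by move: (inv_bop_near iA); apply: filterS => T [_ ->].
apply: analytic_diff_near e _.
have H2 := analytic_diff_sub (analytic_diff_cst A A) (analytic_diff_id A).
have H3 := analytic_diff_mul (analytic_diff_cst (inv_bop A) A) H2.
have c1 (k : nat) : `|1 : R| <= 1 by rewrite normr1.
have H4 := @analytic_diff_power_series (fun=> 1) c1.
have E0 : inv_bop A * (A - A) = 0 by rewrite subrr mulr0.
have H5 := analytic_diff_comp H3 (g := power_series (fun=> 1)) (K := fun X => 1 *: X).
rewrite /= E0 in H5.
have H6 := analytic_diff_mul (H5 H4) (analytic_diff_cst (inv_bop A) A).
apply: analytic_diff_eq H6 => h /=.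
by rewrite mulr0 add0r mul0r addr0 scale1r add0r mulrN mulNr.
Qed.

End OperatorAlgebra.

(** * Adjoints for the L2 product *)

Section Hermitian.
Variable R : realType.
Local Notation C := R[i].
Local Notation H1 := (H1 R).
Local Notation B := (bop R).
Local Notation ip := (@ip_H1L2 R).
Local Open Scope quotient_scope.

Lemma L2_orthogonal_test_eq0 (f : L2 R) :
  (forall phi, test_function phi -> cintegral (fun x => repr f x * (phi x)%:C%C) = 0) -> f = 0.
Proof.
move=> f0; have key phi : test_function phi ->
    \int[vol R]_x (re_part (repr f) x * phi x) = 0 /\
    \int[vol R]_x (im_part (repr f) x * phi x) = 0.
  by move=> /f0; rewrite /cintegral pairing_re pairing_im => -[-> ->].
have re0 := orthogonal_test_functions_ae0 (sqint_re (repr f)) (fun phi t => (key phi t).1).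
have im0 := orthogonal_test_functions_ae0 (sqint_im (repr f)) (fun phi t => (key phi t).2).
rewrite -[f]reprK; apply/L2P; apply: filterS2 re0 im0 => x.
by rewrite /re_part /im_part; case: (repr f x) => a b /= -> ->.
Qed.

Lemma H1_eq0 (u : H1) : (H1_val u).1 = 0 -> u = 0.
Proof.
case: u => -[f G] /= H f0; apply: val_inj => /=.
move: H; rewrite f0 => /asboolP H; rewrite -[RHS]/(0, 0); congr pair.
apply/funext => i; apply: L2_orthogonal_test_eq0 => phi tphi.
have := H i phi tphi; rewrite (pairing_rip _ (test_function_deriv_Lfun i tphi)).
have z g : rip (0 : L2 R) g = 0.
  have -> : (0 : L2 R) = (0 : R)%:C%C *: (0 : L2 R) by rewrite scaler0.
  by rewrite ripZl mul0r.
by rewrite !z /= => /esym/eqP; rewrite oppr_eq0 => /eqP.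
Qed.

Lemma complexE (a : C) : a = (complex.Re a)%:C%C + (complex.Im a)%:C%C * 'i%C.
Proof. by case: a => x y; apply/eqP; rewrite eq_complex /=; apply/andP; split; apply/eqP; ring. Qed.

Lemma ipC u v : ip v u = ((ip u v)^*)%C. Proof. exact: ip_L2C. Qed.

Lemma ipDl u u' v : ip (u + u') v = ip u v + ip u' v. Proof. exact: ip_L2Dl. Qed.

Lemma ip_i u v : ip ('i%C *: u) v = 'i%C * ip u v.
Proof.
rewrite /ip_H1L2; move: (H1_val v).1 => g.
have -> : (H1_val ('i%C *: u)).1 = 'i%C *: (H1_val u).1 by [].
move: (H1_val u).1 => f; have := Im_ip_L2 ('i%C *: f) g; have := Im_ip_L2 f g.
have -> : 'i%C *: ('i%C *: f) = (-1 : R)%:C%C *: f.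
  by rewrite scalerA; congr (_ *: _); apply/eqP;
    rewrite eq_complex /=; apply/andP; split; apply/eqP; ring.
rewrite ripZl mulN1r opprK /rip; case: (ip_L2 ('i%C *: f) g) => a b; case: (ip_L2 f g) => c d /=.
move=> -> ->; apply/eqP; rewrite eq_complex /=; apply/andP; split; apply/eqP; ring.
Qed.

Lemma ipZl (a : C) u v : ip (a *: u) v = a * ip u v.
Proof.
have rZ (r : R) w : ip (r%:C%C *: w) v = r%:C%C * ip w v by exact: ip_L2Zl.
rewrite {1}[a]complexE scalerDl -scalerA ipDl !rZ ip_i.
by rewrite mulrA -mulrDl -complexE.
Qed.

Lemma ipDr u v v' : ip u (v + v') = ip u v + ip u v'. Proof. exact: ip_L2Dr. Qed.

Lemma ipZr (a : C) u v : ip u (a *: v) = (a^*)%C * ip u v.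
Proof. by rewrite ipC ipZl rmorphM [in RHS]ipC. Qed.

Lemma ip0l v : ip 0 v = 0.
Proof. by rewrite -(scale0r (0 : H1)) ipZl mul0r. Qed.

Lemma ip0r v : ip v 0 = 0.
Proof. by rewrite ipC ip0l conjc0. Qed.

Lemma ipNl u v : ip (- u) v = - ip u v.
Proof. by rewrite -scaleN1r ipZl mulN1r. Qed.

Lemma ipNr u v : ip u (- v) = - ip u v.
Proof. by rewrite ipC ipNl rmorphN [in RHS]ipC. Qed.

Lemma ip_suml n (e : nat -> H1) v : ip (\sum_(i < n) e i) v = \sum_(i < n) ip (e i) v.
Proof.
elim: n => [|n IH]; first by rewrite !big_ord0 ip0l.
by rewrite !big_ord_recr ipDl IH.
Qed.

Lemma ip_real u : ip u u = (complex.Re (ip u u))%:C%C.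
Proof.
have := ipC u u; case: (ip u u) => a b /= [] /eqP; rewrite -subr_eq0 opprK -mulr2n mulrn_eq0.
by move=> /= /eqP ->.
Qed.

Lemma norm_L2_sqr u : norm_L2 u ^+ 2 = complex.Re (ip u u).
Proof. by rewrite sqr_sqrtr//; exact: rip_ge0. Qed.

Lemma norm_L2_eq0 (u : H1) : norm_L2 u = 0 -> u = 0.
Proof.
move=> u0; apply: H1_eq0; apply: rip_eq0.
by rewrite -[LHS]/(complex.Re (ip u u)) -norm_L2_sqr u0 expr0n.
Qed.

Lemma ip_injr v w : (forall u, ip u v = ip u w) -> v = w.
Proof.
move=> H; apply/eqP; rewrite -subr_eq0; apply/eqP/norm_L2_eq0.
apply/eqP; rewrite -sqrf_eq0 norm_L2_sqr ipDr ipNr H subrr.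
by [].
Qed.

Lemma norm_L2_le (u : H1) : norm_L2 u <= norm_H1 u.
Proof.
rewrite ler_sqrt; last exact: rip_H1_ge0.
rewrite -[leRHS]/(rip_H1 u u) rip_H1E lerDl sumr_ge0// => i _; exact: rip_ge0.
Qed.

Lemma Re_ip_le u v : `|complex.Re (ip u v)| <= norm_H1 u * norm_H1 v.
Proof.
apply: (@le_trans _ _ (norm_L2 u * norm_L2 v)); last first.
  by rewrite ler_pM ?norm_L2_le ?sqrtr_ge0.
rewrite -(@ler_pXn2r _ 2)// ?nnegrE ?mulr_ge0 ?sqrtr_ge0//.
rewrite real_normK ?num_real// exprMn !norm_L2_sqr; exact: rip_CS.
Qed.

Lemma Im_ip_le u v : `|complex.Im (ip u v)| <= norm_H1 u * norm_H1 v.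
Proof.
have := Re_ip_le ('i%C *: u) v; rewrite norm_H1_i ip_i.
by case: (ip u v) => a b /=; rewrite mul0r mul1r sub0r normrN.
Qed.

(** A relation, because not every operator has an adjoint; [adj_uniq] makes it single-valued, and
    adjoints are later identified through it. *)
Definition adj (X Y : B) := forall u v, ip (X u) v = ip u (Y v).

Lemma adj_sym X Y : adj X Y -> adj Y X.
Proof. by move=> XY u v; rewrite ipC -XY -ipC. Qed.

Lemma adj_uniq X Y Y' : adj X Y -> adj X Y' -> Y = Y'.
Proof. by move=> XY XY'; apply: bop_eq => v; apply: ip_injr => u; rewrite -XY XY'. Qed.

Lemma adjM X X' Y Y' : adj X Y -> adj X' Y' -> adj (X * X') (Y' * Y).
Proof. by move=> XY XY' u v; rewrite -[(X * X') u]/(X (X' u)) XY XY'. Qed.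

Lemma adjD X X' Y Y' : adj X Y -> adj X' Y' -> adj (X + X') (Y + Y').
Proof.
move=> XY XY' u v; rewrite -[(X + X') u]/(X u + X' u) -[(Y + Y') v]/(Y v + Y' v).
by rewrite ipDl ipDr XY XY'.
Qed.

Lemma adjN X Y : adj X Y -> adj (- X) (- Y).
Proof.
by move=> XY u v; rewrite -[(- X) u]/(- X u) -[(- Y) v]/(- Y v) ipNl ipNr XY.
Qed.

Lemma adjB X X' Y Y' : adj X Y -> adj X' Y' -> adj (X - X') (Y - Y').
Proof. by move=> XY XY'; apply: adjD => //; exact: adjN. Qed.

Lemma adj1 : adj 1 1. Proof. by []. Qed.

Lemma adjV X Y : adj X Y -> invb X -> invb Y -> adj (inv_bop X) (inv_bop Y).
Proof.
move=> XY iX iY u v.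
have -> : v = Y (inv_bop Y v) by rewrite -[RHS]/((Y * inv_bop Y) v) mulbV.
rewrite -XY -[X _]/((X * inv_bop X) u) mulbV//.
by congr ip; rewrite -[RHS]/((inv_bop Y * Y) _) mulVb.
Qed.

Lemma antihermitianP X : X \in @antihermitian R <-> adj X (- X).
Proof.
split=> [/asboolP H u v|H]; first by rewrite H -[(- X) v]/(- X v) ipNr.
by apply/asboolP => u v; rewrite H -[(- X) v]/(- X v) ipNr.
Qed.

Lemma rank_one_subproof (f e : H1) : (fun u => ip u f *: e) \in @bounded_linear R.
Proof.
apply/asboolP; split=> [a u v|]; first by rewrite ipDl ipZl scalerDl scalerA.
exists (2 * norm_H1 f * norm_H1 e) => u; apply: le_trans (norm_H1ZC _ _) _.
rewrite mulrAC ler_wpM2r ?norm_H1_ge0// mulrC.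
rewrite [leRHS](_ : _ = norm_H1 u * norm_H1 f + norm_H1 u * norm_H1 f); last by ring.
by rewrite lerD ?Re_ip_le ?Im_ip_le.
Qed.

Definition rank_one (f e : H1) : B := Bop (rank_one_subproof f e).

Lemma norm_rank_one f e : `|rank_one f e| <= 2 * norm_H1 f * norm_H1 e.
Proof.
apply: op_norm_lub => u u1; apply: le_trans (norm_H1ZC _ _) _.
rewrite ler_wpM2r ?norm_H1_ge0//.
apply: (@le_trans _ _ (norm_H1 u * norm_H1 f + norm_H1 u * norm_H1 f)).
  by rewrite lerD ?Re_ip_le ?Im_ip_le.
have : norm_H1 u * norm_H1 f <= norm_H1 f by rewrite ler_piMl ?norm_H1_ge0.
by move: (norm_H1 u * _) => z; lra.
Qed.

Definition orthonormal n (e : nat -> H1) :=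
  forall i j, (i < n)%N -> (j < n)%N -> ip (e i) (e j) = (i == j)%:R.

Definition lspan n (e : nat -> H1) : set H1 :=
  [set u | exists c : nat -> C, u = \sum_(i < n) c i *: e i].

Lemma ip_orthonormal n e (c : nat -> C) j : orthonormal n e -> (j < n)%N ->
  ip (\sum_(i < n) c i *: e i) (e j) = c j.
Proof.
move=> on jn; rewrite (ip_suml n (fun i => c i *: e i)) (bigD1 (Ordinal jn))//= big1.
  by rewrite ipZl on// eqxx mulr1 addr0.
move=> i ij; rewrite ipZl on// [_ == _](_ : _ = false) ?mulr0//.
by apply: contra_neqF ij => /eqP ij; apply: val_inj.
Qed.

Lemma lspan_mem n e j : (j < n)%N -> lspan n e (e j).
Proof.
move=> jn; exists (fun i => (i == j)%:R); rewrite (bigD1 (Ordinal jn))//= big1.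
  by rewrite eqxx scale1r addr0.
move=> i ij; rewrite [_ == _](_ : _ = false) ?scale0r//.
by apply: contra_neqF ij => /eqP ij; apply: val_inj.
Qed.

Lemma lspan_lin n e (a : C) u v : lspan n e u -> lspan n e v -> lspan n e (a *: u + v).
Proof.
move=> [c ->] [d ->]; exists (fun i => a * c i + d i).
by rewrite scaler_sumr -big_split; apply: eq_bigr => i _; rewrite scalerDl scalerA.
Qed.

Lemma lspanS n e u : lspan n.+1 e u <-> exists a : C, exists2 v, lspan n e v & u = v + a *: e n.
Proof.
split=> [[c ->]|[a [v [c ->] ->]]].
  by exists (c n), (\sum_(i < n) c i *: e i); [exists c|rewrite big_ord_recr].
exists (fun i => if i == n then a else c i); rewrite big_ord_recr /= eqxx; congr (_ + _).
by apply: eq_bigr => i _; rewrite ltn_eqF.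
Qed.

Lemma lspan_eq n e f u : (forall i, (i < n)%N -> e i = f i) -> lspan n e u -> lspan n f u.
Proof. by move=> ef [c ->]; exists c; apply: eq_bigr => i _; rewrite ef. Qed.

Lemma gram_schmidt n (e : nat -> H1) :
  (forall c : nat -> C, \sum_(i < n) c i *: e i = 0 -> forall i, (i < n)%N -> c i = 0) ->
  exists2 f, orthonormal n f & lspan n e = lspan n f.
Proof.
elim: n => [|n IH] fr; first by exists e => //.
have [c c0 i iN|f on ef] := IH.
  have := fr (fun j => if j == n then 0 else c j); rewrite big_ord_recr /= eqxx scale0r addr0.
  have -> : \sum_(j < n) (if j == n :> nat then 0 else c j) *: e j = 0.
    by rewrite -[RHS]c0; apply: eq_bigr => j _; rewrite ltn_eqF.
  by move=> /(_ erefl i (ltnW iN)); rewrite ltn_eqF.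
pose w := e n - \sum_(i < n) ip (e n) (f i) *: f i.
have en : e n = \sum_(i < n) ip (e n) (f i) *: f i + w by rewrite addrC subrK.
have wf i : (i < n)%N -> ip w (f i) = 0.
  by move=> iN; rewrite ipDl ipNl (ip_orthonormal (fun i => ip (e n) (f i)))// subrr.
(* Otherwise e n would be in the span of the earlier vectors, and the coefficient -1 in front of it
   would contradict freeness. *)
have w0 : norm_L2 w != 0.
  apply/eqP => /norm_L2_eq0 w0; have : lspan n e (e n).
    by rewrite ef en w0 addr0; exists (fun i => ip (e n) (f i)).
  move=> [c ec]; have := fr (fun j => if j == n then -1 else c j).
  rewrite big_ord_recr /= eqxx scaleN1r.
  have -> : \sum_(j < n) (if j == n :> nat then -1 else c j) *: e j = e n.
    by rewrite ec; apply: eq_bigr => j _; rewrite ltn_eqF.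
  rewrite subrr => /(_ erefl n (ltnSn n)); rewrite eqxx => /eqP.
  by rewrite oppr_eq0 oner_eq0.
pose g i := if i == n then (norm_L2 w)^-1%:C%C *: w else f i.
have gf i : (i < n)%N -> g i = f i by move=> iN; rewrite /g ltn_eqF.
have gn : g n = (norm_L2 w)^-1%:C%C *: w by rewrite /g eqxx.
exists g.
  have gg i : (i < n)%N -> ip (g n) (g i) = 0 by move=> iN; rewrite gn gf// ipZl wf// mulr0.
  move=> i j; rewrite !ltnS (leq_eqVlt i n) (leq_eqVlt j n) => /orP[/eqP->|iN] /orP[/eqP->|jN].
  - rewrite eqxx gn ipZl ipZr ip_real -norm_L2_sqr.
    apply/eqP; rewrite eq_complex /=; apply/andP; split; apply/eqP; last by ring.
    by field.
  - by rewrite gg// gtn_eqF.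
  - by rewrite ipC gg// conjc0 ltn_eqF.
  - by rewrite !gf// on.
have wg : w = (norm_L2 w)%:C%C *: g n.
  rewrite gn scalerA [X in X *: _](_ : _ = 1) ?scale1r//.
  by apply/eqP; rewrite eq_complex /=; apply/andP; split; apply/eqP; [field|ring].
apply/seteqP; split=> u /lspanS[a [v]].
  rewrite ef => vf ->; apply/lspanS; exists (a * (norm_L2 w)%:C%C).
  exists (a *: (\sum_(i < n) ip (e n) (f i) *: f i) + v).
    apply: (lspan_eq (e := f)) => [i iN|]; first by rewrite gf.
    by apply: lspan_lin => //; exists (fun i => ip (e n) (f i)).
  by rewrite -scalerA -wg {1}en scalerDr addrA [v + _]addrC.
move=> vg ->; have vf : lspan n f v by apply: lspan_eq vg => i iN; rewrite gf.
apply/lspanS; rewrite gn scalerA; set b := a * _; exists b.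
exists ((- b) *: (\sum_(i < n) ip (e n) (f i) *: f i) + v).
  by rewrite ef; apply: lspan_lin => //; exists (fun i => ip (e n) (f i)).
by rewrite /w scalerBr scaleNr [- _ + v]addrC -[RHS]addrA [- _ + _]addrC.
Qed.

Lemma grassmannian_orthonormal N P : grassmannian N P -> exists2 e, orthonormal N e &
  P = \sum_(i < N) rank_one (e i) (e i) /\ forall i, (i < N)%N -> P (e i) = e i.
Proof.
move=> [[e [fr rg]] PP sP].
pose e' j := if insub j is Some i then e i else 0.
have e'E (i : 'I_N) : e' i = e i by rewrite /e' valK.
have [c c0 i iN|f on ef] := @gram_schmidt N e'.
  have := fr (fun i => c i) _ (Ordinal iN); apply.
  by rewrite -[RHS]c0; apply: eq_bigr => j _; rewrite e'E.
have rf : range P = lspan N f.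
  rewrite rg -ef; apply/seteqP; split=> u [c ->].
    exists (fun j => if insub j is Some i then c i else 0).
    by apply: eq_bigr => i _; rewrite e'E valK.
  by exists (fun i => c i); apply: eq_bigr => i _; rewrite e'E.
have Pf i : (i < N)%N -> P (f i) = f i.
  move=> iN; have : range P (f i) by rewrite rf; exact: lspan_mem.
  by move=> [v _ <-]; rewrite -[LHS]/((P * P) v) PP.
exists f => //; split=> //; apply: bop_eq => u.
have sumE n (h : nat -> B) v : (\sum_(i < n) h i) v = \sum_(i < n) h i v.
  by elim: n => [|n IH]; rewrite ?big_ord0// !big_ord_recr -IH.
rewrite (sumE N (fun i => rank_one (f i) (f i))) /=.
have : range P (P u) by exists u.
rewrite rf => -[c cE]; rewrite {1}cE; apply: eq_bigr => i _; congr (_ *: _).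
(* The i-th coefficient of P u is its product with f i, which equals that of u because P is
   symmetric and fixes f i. *)
by rewrite -(Pf i (ltn_ord i)) -sP cE (ip_orthonormal c).
Qed.

End Hermitian.

(** * Kernels of bounded linear maps as Banach spaces *)

Section KernelSpace.
Variables (R : realType) (E F : normedModType R) (L : E -> F).
Hypothesis lL : forall (c : R) u v, L (c *: u + v) = c *: L u + L v.

(** The linearity proof is an argument of the predicate so that the submodule structure, which
    depends on it, can be found by inference. *)
Definition ker_pred (_ : forall (c : R) u v, L (c *: u + v) = c *: L u + L v) : {pred E} :=
  [pred x | `[< L x = 0 >] ].

Lemma ker_submod_closed : submod_closed (ker_pred lL).
Proof.
split; first by apply/asboolP; have := lL (-1) 0 0; rewrite scaler0 addr0 scaleN1r addNr.
by move=> c u v /asboolP Lu /asboolP Lv; apply/asboolP; rewrite lL Lu Lv scaler0 addr0.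
Qed.

HB.instance Definition _ := GRing.isSubmodClosed.Build R E (ker_pred lL) ker_submod_closed.

Record ker_of := KerOf { ker_val :> E; _ : ker_val \in ker_pred lL }.
HB.instance Definition _ := [isSub for ker_val].
HB.instance Definition _ := [Choice of ker_of by <:].
HB.instance Definition _ := [SubChoice_isSubLmodule of ker_of by <:].

Definition ker_norm (X : ker_of) : R := `|X : E|.

Lemma ker_normD X Y : ker_norm (X + Y) <= ker_norm X + ker_norm Y.
Proof. exact: ler_normD. Qed.
Lemma ker_normZ (r : R) X : ker_norm (r *: X) = `|r| * ker_norm X.
Proof. exact: normrZ. Qed.
Lemma ker_norm_eq0 X : ker_norm X = 0 -> X = 0.
Proof. by move=> /normr0_eq0 X0; apply: val_inj. Qed.
HB.instance Definition _ :=
  Lmodule_isNormed.Build R ker_of ker_normD ker_normZ ker_norm_eq0.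

Lemma ker_normE (X : ker_of) : `|X| = `|X : E|. Proof. by []. Qed.

Lemma ker_valP (X : ker_of) : L X = 0. Proof. by case: X => x /= /asboolP. Qed.

Lemma ker_mem x : L x = 0 -> x \in ker_pred lL. Proof. by move=> ?; apply/asboolP. Qed.

Definition mk_ker x (Lx : L x = 0) : ker_of := KerOf (ker_mem Lx).

Lemma banach_cvg (G : normedModType R) (u : nat -> G) : banach G ->
  (forall n, `|u n.+1 - u n| <= 2^-1 ^+ n) -> exists l : G, u @ \oo --> l.
Proof.
move=> bG uC; have tail n k : `|u (n + k)%N - u n| <= 2 * 2^-1 ^+ n.
  apply: le_trans (geometric_tail n (n + k) (a := (2^-1 : R)) _ _); rewrite ?invr_ge0//.
  elim: k => [|k IH]; first by rewrite addn0 subrr normr0 big_geq.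
  rewrite addnS big_nat_recr ?leq_addr//=.
  rewrite -(subrK (u (n + k)%N) (u _.+1)) -addrA addrC.
  by rewrite (le_trans (ler_normD _ _))// lerD.
have [|l ul] := (cvg_ex _).1 (bG (u n @[n --> \oo]) _ _); last by exists l.
apply: cauchy_exP => e e0.
have C := @geometric_cvg0 R 2; have [N _ HN] := (cvgrPdist_lt _ _).1 C _ e0.
exists (u N); exists N => // n /= Nn; rewrite -ball_normE /= distrC -(subnKC Nn).
apply: le_lt_trans (tail _ _) _.
by have := HN N (leqnn N); rewrite sub0r normrN => /(le_lt_trans (ler_norm _)).
Qed.

Lemma banach_ker C : (forall x, `|L x| <= C * `|x|) -> banach E -> banach ker_of.
Proof.
move=> LC bE; apply: banach_fast_cauchy => u uC.
have [n|l ul] := @banach_cvg E (fun n => u n) bE; first exact: (uC n).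
have Ll : L l = 0.
  apply/eqP; rewrite -normr_eq0 eq_le normr_ge0 andbT.
  have H : C * `|l - (u n : E)| @[n --> \oo] --> 0.
    rewrite (_ : 0 = C * 0); last by rewrite mulr0.
    apply: cvgMl_tmp; apply/cvgrPdist_lt => e e0; have := (cvgrPdist_lt _ _).1 ul _ e0.
    by move=> [M _ HM]; exists M => // n /HM; rewrite /= sub0r normrN normr_id.
  have cS : closed [set z : R | `|L l| <= z] by exact: closed_ge.
  have nS : \forall n \near \oo, [set z : R | `|L l| <= z] (C * `|l - (u n : E)|).
    apply: nearW => n /=; apply: le_trans (LC _).
    by have := lL (-1) (u n : E) l; rewrite ker_valP scaler0 add0r scaleN1r addrC => ->.
  exact: (closed_cvg _ cS nS _ H).
exists (mk_ker Ll); apply/cvgrPdist_lt => e e0.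
exact: ((cvgrPdist_lt _ _).1 ul _ e0).
Qed.

End KernelSpace.

(** * Finite rank adjoints, the unitary group and transitivity *)

Section Transitivity.
Variable R : realType.
Local Notation C := R[i].
Local Notation H1 := (H1 R).
Local Notation B := (bop R).
Local Notation ip := (@ip_H1L2 R).

Lemma mul_rank_one (X : B) f e : X * rank_one f e = rank_one f (X e).
Proof. by apply: bop_eq => u; rewrite -[LHS]/(X (ip u f *: e)) bopZ. Qed.

Lemma adj_rank_one (f e : H1) : adj (rank_one f e) (rank_one e f).
Proof. by move=> u v; rewrite ipZl ipZr -ipC mulrC. Qed.

Lemma adj_sum n (X Y : nat -> B) : (forall i, (i < n)%N -> adj (X i) (Y i)) ->
  adj (\sum_(i < n) X i) (\sum_(i < n) Y i).
Proof.
elim: n => [|n IH] XY; first by rewrite !big_ord0 => u v; rewrite ip0l ip0r.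
by rewrite !big_ord_recr; apply: adjD; [apply: IH => i iN; apply: XY; exact: ltnW|exact: XY].
Qed.

Lemma rank_one_lin (r : R) f g e :
  rank_one (r%:C%C *: f + g) e = r *: rank_one f e + rank_one g e.
Proof.
apply: bop_eq => u; rewrite -[RHS]/(r%:C%C *: (ip u f *: e) + ip u g *: e) /=.
by rewrite ipDr ipZr /= oppr0 scalerDl scalerA.
Qed.

(** In an orthonormal basis e of the range, X P is the sum of the operators u -> <u, e_i> X e_i,
    whose adjoints are u -> <u, X e_i> e_i. The result is antilinear in X over the complex numbers,
    hence linear over the reals. *)
Lemma finite_rank_adjoint N P : grassmannian N P -> exists dg : B -> B, exists2 c : R, 0 <= c &
  [/\ forall (r : R) X Y, dg (r *: X + Y) = r *: dg X + dg Y,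
      forall X, `|dg X| <= c * `|X| & forall X, adj (X * P) (dg X)].
Proof.
move=> /grassmannian_orthonormal[e on [PE _]].
exists (fun X => \sum_(i < N) rank_one (X (e i)) (e i)).
exists (\sum_(i < N) 2 * norm_H1 (e i) * norm_H1 (e i)).
  by apply: sumr_ge0 => i _; rewrite !mulr_ge0 ?norm_H1_ge0.
split=> [r X Y|X|X].
- rewrite scaler_sumr -big_split; apply: eq_bigr => i _.
  exact: rank_one_lin.
- apply: le_trans (ler_norm_sum _ _ _) _; rewrite mulr_suml; apply: ler_sum => i _.
  apply: le_trans (norm_rank_one _ _) _; rewrite [leRHS]mulrAC ler_wpM2r ?norm_H1_ge0//.
  by rewrite -mulrA ler_wpM2l// mulrC; exact: op_normP.
- rewrite PE mulr_sumr; under eq_bigr do rewrite mul_rank_one.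
  by apply: (adj_sum (X := fun i => rank_one (e i) (X (e i)))
    (Y := fun i => rank_one (X (e i)) (e i))) => i _; exact: adj_rank_one.
Qed.

(** Polarisation gives the real part; the imaginary part is a real part after multiplication by i,
    which commutes with U. *)
Lemma unitary_ip (U : B) u v : unitary_group U -> ip (U u) (U v) = ip u v.
Proof.
move=> [_ Un].
have Re_ip x y : complex.Re (ip (U x) (U y)) = complex.Re (ip x y).
  have ReD (a b : C) : complex.Re (a + b) = complex.Re a + complex.Re b by case: a b => [? ?] [? ?].
  have pol (a b : H1) : norm_L2 (a + b) ^+ 2 =
      norm_L2 a ^+ 2 + 2 * complex.Re (ip a b) + norm_L2 b ^+ 2.
    rewrite !norm_L2_sqr ipDl !ipDr !ReD [ip b a]ipC.
    by case: (ip a b) => s t /=; ring.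
  have := pol (U x) (U y); rewrite -bopD !Un pol => H; lra.
have Im_ip (x y : H1) : complex.Im (ip x y) = - complex.Re (ip ('i%C *: x) y).
  by rewrite ip_i; case: (ip x y) => s t /=; ring.
apply/eqP; rewrite eq_complex Re_ip !Im_ip -bopZ Re_ip !eqxx.
by [].
Qed.

Lemma unitaryP (U : B) : unitary_group U <-> invb U /\ adj U (inv_bop U).
Proof.
split=> [UU|[iU aU]].
  have iU : invb U by case: UU.
  split=> // u v; rewrite -[in RHS](unitary_ip _ _ UU).
  by rewrite -[U (inv_bop U v)]/((U * inv_bop U) v) mulbV.
split=> // u; rewrite /norm_L2 aU -[inv_bop U (U u)]/((inv_bop U * U) u) mulVb//.
Qed.

Lemma unitary_inv (U : B) : unitary_group U -> invb U. Proof. by case. Qed.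

Lemma unitary1 : unitary_group (1 : B).
Proof. by apply/unitaryP; rewrite inv_bop1; split; [exact: invb1|exact: adj1]. Qed.

Lemma unitaryM (U V : B) : unitary_group U -> unitary_group V -> unitary_group (U * V).
Proof.
move=> /unitaryP[iU aU] /unitaryP[iV aV]; apply/unitaryP; split; first exact: invbM.
by rewrite inv_bopM//; exact: adjM.
Qed.

Lemma has_rank_conj N (P T : B) : invb T -> has_rank N P -> has_rank N (T * P * inv_bop T).
Proof.
move=> iT [e [fr rg]].
have Tsum n (c : 'I_n -> C) (x : 'I_n -> H1) : T (\sum_i c i *: x i) = \sum_i c i *: T (x i).
  elim: n c x => [|n IH] c x; first by rewrite !big_ord0 bop0.
  by rewrite !big_ord_recl bopD bopZ IH.
have TK x : inv_bop T (T x) = x by rewrite -[LHS]/((inv_bop T * T) x) mulVb.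
have TK' x : T (inv_bop T x) = x by rewrite -[LHS]/((T * inv_bop T) x) mulbV.
exists (fun i => T (e i)); split=> [c|].
  by rewrite -Tsum => H; apply: fr; rewrite -[LHS]TK H bop0.
apply/seteqP; split=> u.
  move=> [v _ <-]; have : range P (P (inv_bop T v)) by exists (inv_bop T v).
  rewrite rg => -[c cE]; exists c.
  by rewrite -Tsum -cE.
move=> [c ->]; rewrite -Tsum; have : range P (\sum_i c i *: e i) by rewrite rg; exists c.
by move=> [v _ <-]; exists (T v) => //; rewrite -[LHS]/(T (P (inv_bop T (T v)))) TK.
Qed.

Lemma grassmannian_conj N (P U : B) : unitary_group U -> grassmannian N P ->
  grassmannian N (U * P * inv_bop U).
Proof.
move=> /unitaryP[iU aU] [rP PP sP]; split; first exact: has_rank_conj.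
  by rewrite -!mulrA [inv_bop U * (U * _)]mulrA mulVb// mul1r [P * (P * _)]mulrA PP.
by have := adjM (adjM aU sP) (adj_sym aU); rewrite mulrA.
Qed.

(** The product is 1 minus the rank one operator along w with coefficient c + d - d c <w, w>, which
    the hypothesis cancels. *)
Lemma reflection_inverse (w : H1) (c d : C) : c + d = d * c * ip w w ->
  (1 - rank_one w (d *: w)) * (1 - rank_one w (c *: w)) = 1.
Proof.
move=> cd; apply: bop_eq => v.
rewrite -[LHS]/((v - ip v w *: (c *: w)) - ip (v - ip v w *: (c *: w)) w *: (d *: w)).
rewrite ipDl ipNl !ipZl -addrA -opprD !scalerA -scalerDl.
rewrite (_ : _ * c + _ = ip v w * (c + d - d * c * ip w w)); last by ring.
by rewrite cd subrr mulr0 scale0r subr0.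
Qed.

(* A complex Householder reflection along [p - q]. *)
Lemma unitary_swap (p q : H1) : ip p p = 1 -> ip q q = 1 -> exists2 V : B, unitary_group V &
  V p = q /\ forall v, ip v (p - q) = 0 -> V v = v.
Proof.
move=> pp qq; have [<-|pq] := eqVneq p q; first by exists 1; [exact: unitary1|].
set w := p - q; pose s := ip p w.
have sE : s = 1 - ip p q by rewrite /s ipDr ipNr pp.
have wE : ip w w = s + (s^*)%C.
  rewrite {1}/w ipDl ipNl -/s; congr (_ + _).
  by rewrite /w ipDr ipNr qq sE rmorphB rmorph1 (ipC p q) opprB.
have w0 : ip w w != 0.
  apply: contra_neq pq => w0; apply/eqP; rewrite -subr_eq0; apply/eqP/norm_L2_eq0.
  by apply/eqP; rewrite -sqrf_eq0 norm_L2_sqr -/w w0.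
have s0 : s != 0 by apply: contra_neq w0 => s0; rewrite wE s0 conjc0 addr0.
have s0' : (s^*)%C != 0 by rewrite conjc_eq0.
(* c = 1 / <p, w> forces V p = p - w = q, and d, its conjugate, makes the inverse of V its adjoint.
   Compatibility of the two is [wE], where both unit norms are used. *)
pose c := s^-1; pose d := ((s^*)%C)^-1.
have cd : c + d = d * c * ip w w by rewrite /c /d wE; field; rewrite s0.
have dc : d + c = c * d * ip w w by rewrite addrC cd; ring.
have iV : is_inverse (1 - rank_one w (d *: w)) (1 - rank_one w (c *: w)).
  by split; exact: reflection_inverse.
exists (1 - rank_one w (c *: w)).
  apply/unitaryP; split; first by eexists; exact: iV.
  rewrite (inv_bopE iV); apply: adjB; first exact: adj1.
  have -> : rank_one w (d *: w) = rank_one (c *: w) w.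
    apply: bop_eq => u /=; rewrite ipZr scalerA mulrC; congr (_ * _ *: _).
    by rewrite /c /d fmorphV.
  exact: adj_rank_one.
split=> [|v vw].
  rewrite -[LHS]/(p - ip p w *: (c *: w)) scalerA -/s mulfV// scale1r.
  by rewrite /w opprB addrCA subrr addr0.
by rewrite -[LHS]/(v - ip v w *: (c *: w)) vw scale0r subr0.
Qed.

(** One vector is corrected at a time. The reflection along U p_k - q_k fixes the q_i already
    reached, since they are orthogonal to q_k and, being U p_i, to U p_k. *)
Lemma unitary_frames N (p q : nat -> H1) : orthonormal N p -> orthonormal N q ->
  exists2 U : B, unitary_group U & forall i, (i < N)%N -> U (p i) = q i.
Proof.
move=> op oq; suff : forall k, (k <= N)%N -> exists2 U : B, unitary_group U &
    forall i, (i < k)%N -> U (p i) = q i by apply.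
elim=> [_|k IH kN]; first by exists 1; [exact: unitary1|].
have [U UU Up] := IH (ltnW kN).
have [||V VV [Vp Vf]] := @unitary_swap (U (p k)) (q k).
- by rewrite unitary_ip// op// eqxx.
- by rewrite oq// eqxx.
exists (V * U); first exact: unitaryM.
move=> i; rewrite ltnS leq_eqVlt => /orP[/eqP->//|ik].
rewrite -[LHS]/(V (U (p i))) Up// Vf// ipDr ipNr -[in ip (q i) (U _)](Up i ik) unitary_ip//.
have iN : (i < N)%N by exact: ltn_trans kN.
by rewrite op// oq// subrr.
Qed.

Lemma grassmannian_transitive N (P Q : B) : grassmannian N P -> grassmannian N Q ->
  exists2 U : B, unitary_group U & U * P * inv_bop U = Q.
Proof.
move=> /grassmannian_orthonormal[p op [PE _]] /grassmannian_orthonormal[q oq [QE _]].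
have [U UU Upq] := unitary_frames op oq; exists U => //.
have [iU aU] := (unitaryP _).1 UU.
rewrite PE QE mulr_sumr mulr_suml; apply: eq_bigr => i _.
rewrite mul_rank_one Upq//; apply: bop_eq => u.
rewrite -[LHS]/(ip (inv_bop U u) (p i) *: q i) /=; congr (_ *: _).
by rewrite (adj_sym aU) Upq.
Qed.

End Transitivity.

(** * Charts of the Grassmannian *)

Section BlockAlgebra.
Variables (A : pzRingType) (p : A).
Hypothesis pp : p * p = p.
Local Notation q := (1 - p).

(** It commutes with p and equals 1 at T = p, so it is invertible for T near p; its inverse then
    inverts the corner p T p. *)
Definition block_diag (T : A) := p * T * p + q * (1 - T) * q.

Lemma mulpq : p * q = 0. Proof. by rewrite mulrBr mulr1 pp subrr. Qed.
Lemma mulqp : q * p = 0. Proof. by rewrite mulrBl mul1r pp subrr. Qed.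
Lemma mulqq : q * q = q. Proof. by rewrite mulrBr mulr1 mulqp subr0. Qed.

Lemma mulp_block_diag T : p * block_diag T = p * T * p.
Proof. by rewrite mulrDr !mulrA pp mulpq !mul0r addr0. Qed.

Lemma mul_block_diagp T : block_diag T * p = p * T * p.
Proof. by rewrite mulrDl -!mulrA pp mulqp !mulr0 addr0. Qed.

Lemma block_diagC T V : V * block_diag T = 1 -> block_diag T * V = 1 -> p * V = V * p.
Proof.
move=> VD DV; rewrite -[LHS]mul1r -{1}VD -!mulrA [block_diag T * _]mulrA.
by rewrite mul_block_diagp -mulp_block_diag -[p * _ * V]mulrA DV mulr1.
Qed.

Lemma block_diag1 : block_diag p = 1.
Proof. by rewrite /block_diag pp pp mulqq mulqq addrC subrK. Qed.

(* The generator [H] of the graph of an idempotent [T] over [p]: the difference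
   [K = T - T V p T] is killed by [p] and fixed by [T], hence killed by the block
   diagonal part of [T]. *)
Lemma idempotent_graph T V : T * T = T ->
  V * block_diag T = 1 -> block_diag T * V = 1 ->
  T * (1 + (q * T * p * V - V * p * T * q)) = (1 + (q * T * p * V - V * p * T * q)) * p.
Proof.
move=> TT VD DV; have pV := block_diagC VD DV.
have pTpV : p * T * p * V = p by rewrite -mulp_block_diag -mulrA DV mulr1.
have VpTp : V * (p * T * p) = p by rewrite -mul_block_diagp mulrA VD mul1r.
(* Each q is expanded as 1 - p: the extra terms p T p V and V p T p both equal p and cancel. *)
have -> : q * T * p * V - V * p * T * q = T * p * V - V * p * T.
  rewrite !mulrBl !mul1r pTpV mulrBr mulr1 -!mulrA [p * (T * p)]mulrA VpTp.
  by rewrite opprB addrA subrK.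
set K := T - T * V * p * T.
have K0 : K = 0.
  have pK : p * K = 0.
    by rewrite mulrBr !mulrA -[p * T * V * p]mulrA -pV mulrA pTpV subrr.
  have TK : T * K = K by rewrite mulrBr !mulrA TT.
  suff DK : block_diag T * K = 0 by rewrite -[K]mul1r -VD -mulrA DK mulr0.
  have qK : q * K = K by rewrite mulrBl mul1r pK subr0.
  by rewrite mulrDl -!mulrA qK pK !mulr0 add0r [(1 - T) * K]mulrBl mul1r TK subrr mulr0.
rewrite mulrDr mulr1 mulrBr !mulrA TT mulrDl mul1r mulrBl.
rewrite -[V * p * T * p]mulrA -[V * p * (T * p)]mulrA [p * (T * p)]mulrA VpTp.
rewrite -[T * p * V * p]mulrA -pV mulrA -[T * p * p]mulrA pp.
by move/subr0_eq: K0 => {1}->; rewrite addrCA [RHS]addrCA !subrr.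
Qed.

Section Graph.
Variables (H I : A).
Hypothesis Hp : H * p + p * H = H.

Lemma graph_pHp : p * H * p = 0.
Proof.
by have /(congr1 ( *%R p)) := Hp; rewrite mulrDr !mulrA pp -[RHS]add0r => /addIr.
Qed.

Lemma graph_qHp : q * H * p = H * p.
Proof. by rewrite mulrBl mul1r mulrBl graph_pHp subr0. Qed.

Lemma graph_idem : I * (1 + H) = 1 ->
  (1 + H) * p * I * ((1 + H) * p * I) = (1 + H) * p * I.
Proof. by move=> IS; rewrite -!mulrA [I * (_ * _)]mulrA IS mul1r [p * (p * _)]mulrA pp. Qed.

Lemma graph_p : p * ((1 + H) * p * I) = p * I.
Proof. by rewrite mulrA mulrA mulrDr mulrDl mulr1 pp graph_pHp addr0. Qed.

(** The range of (1 + H) p I is the graph of H p over the range of p: the q-component is H p applied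
    to the p-component. *)
Lemma graph_q : q * ((1 + H) * p * I) = H * p * (p * ((1 + H) * p * I)).
Proof.
rewrite graph_p !mulrA [q * (1 + H)]mulrDr mulr1 [(q + _) * p]mulrDl mulqp add0r graph_qHp.
by rewrite -[H * p * p]mulrA pp.
Qed.

Lemma reflectK : (p - q) * (p - q) = 1.
Proof. 
by rewrite mulrBl [p * (p - _)]mulrBr [q * (p - _)]mulrBr pp mulpq mulqp mulqq subr0 sub0r
  opprK addrC subrK.
Qed.

(** The reflection p - q anticommutes with the off-diagonal H; conjugating by it carries
    invertibility from 1 + H to 1 - H. *)
Lemma reflect_graph : (p - q) * (1 + H) * (p - q) = 1 - H.
Proof.
rewrite [(p - q) * (1 + H)]mulrDr mulr1 [(p - q + _) * _]mulrDl reflectK; congr (1 + _).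
have E : p - q = p + p - 1 by rewrite opprB addrA.
rewrite E !(mulrBl, mulrBr, mulrDl, mulrDr) !mul1r !mulr1 graph_pHp !addr0 sub0r.
by rewrite opprB addrCA -opprD addrACA Hp opprD addrA subrr sub0r.
Qed.

(** The product is 1 - H^2, and the square of an off-diagonal element is block diagonal. It serves
    to rewrite (1 + H) p (1 + H)^-1 as (1 - H)^-1 p (1 - H). *)
Lemma graph_comm : p * ((1 - H) * (1 + H)) = (1 - H) * (1 + H) * p.
Proof.
have E : (1 - H) * (1 + H) = 1 - H * H.
  by rewrite mulrBl mul1r mulrDr mulr1 opprD addrA addrK.
rewrite E mulrBr mulr1 mulrBl mul1r; congr (_ - _).
have pH : p * H = H - H * p by rewrite -{2}Hp addrAC subrr add0r.
by rewrite mulrA pH mulrBl -[H * p * H]mulrA pH mulrBr opprB addrCA subrr addr0 mulrA.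
Qed.

(** A normal component Y may change the corner p T p; the correction H p Y p changes q T p
    accordingly, so that the slope stays H p. *)
Lemma graph_corner Y : q * Y * p = 0 ->
  q * ((1 + H) * p * I + Y + H * p * Y * p) * p =
  H * p * (p * ((1 + H) * p * I + Y + H * p * Y * p) * p).
Proof.
move=> qYp; set G := (1 + H) * p * I.
have qW : q * (H * p * Y * p) * p = H * p * Y * p.
  by rewrite !mulrA graph_qHp -[_ * p * p]mulrA pp.
have pW : p * (H * p * Y * p) * p = 0 by rewrite !mulrA graph_pHp !mul0r.
rewrite ![q * (_ + _)]mulrDr ![p * (_ + _)]mulrDr ![(_ + _) * p]mulrDl qW pW qYp !addr0.
rewrite graph_q mulrDr; congr (_ + _); first by rewrite !mulrA.
by rewrite !mulrA -[H * p * p]mulrA pp.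
Qed.

Lemma graph_normal Y : q * Y * p = 0 ->
  Y + H * p * Y * p - q * (Y + H * p * Y * p) * p = Y.
Proof.
move=> qYp; have qW : q * (H * p * Y * p) * p = H * p * Y * p.
  by rewrite !mulrA graph_qHp -[_ * p * p]mulrA pp.
by rewrite [q * (_ + _)]mulrDr [(_ + _) * p]mulrDl qW qYp add0r addrK.
Qed.

Section Slope.
Variables T V : A.
Hypotheses (VD : V * block_diag T = 1) (DV : block_diag T * V = 1).

Lemma corner_slope : q * T * p = H * p * (p * T * p) -> q * (T * V) * p = H * p.
Proof.
move=> E; have pV := block_diagC VD DV.
rewrite -[q * (T * V) * p]mulrA -[T * V * p]mulrA -pV !mulrA E.
by rewrite -[LHS]mulrA -mulp_block_diag -[p * block_diag T * V]mulrA DV mulr1 -mulrA pp.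
Qed.

Lemma slope_corner : q * (T * V) * p = H * p -> q * T * p = H * p * (p * T * p).
Proof.
have VpT : V * (p * (p * (T * p))) = p.
  by rewrite [p * (p * _)]mulrA pp [p * (T * p)]mulrA -mul_block_diagp mulrA VD mul1r.
by move=> <-; rewrite -!mulrA VpT.
Qed.

Lemma graph_chartK : q * (T * V) * p = H * p ->
  let Y := T - (1 + H) * p * I - q * (T - (1 + H) * p * I) * p in
  (1 + H) * p * I + Y + H * p * Y * p = T.
Proof.
move=> E; set G := (1 + H) * p * I; set K := T - G => Y.
have HK : H * p * K * p = q * K * p.
  rewrite /K ![_ * (T - G)]mulrBr ![(_ - _) * p]mulrBl (slope_corner E) graph_q.
  by rewrite !mulrA -![H * p * p]mulrA !pp.
have -> : H * p * Y * p = q * K * p.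
  rewrite /Y [_ * (K - _)]mulrBr [(_ - _) * p]mulrBl HK !mulrA.
  by rewrite -[H * p * q]mulrA mulpq mulr0 !mul0r subr0.
by rewrite -addrA subrK addrC subrK.
Qed.

End Slope.
End Graph.
End BlockAlgebra.

(** * The flattening chart at a point of the Grassmannian *)

Section GrassmannianChart.
Variables (R : realType) (N : nat) (P : bop R).
Hypothesis hP : grassmannian N P.
Local Notation B := (bop R).
Local Notation Q := (1 - P).
Variables (dg : B -> B) (c : R).
Hypotheses (c0 : 0 <= c) (dg_lin : forall (r : R) X Y, dg (r *: X + Y) = r *: dg X + dg Y).
Hypotheses (dg_le : forall X, `|dg X| <= c * `|X|) (dg_adj : forall X, adj (X * P) (dg X)).

Lemma proj_idem : P * P = P. Proof. by case: hP. Qed.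
Lemma proj_adj : adj P P. Proof. by case: hP. Qed.
Lemma coproj_adj : adj Q Q. Proof. by apply: adjB; [exact: adj1|exact: proj_adj]. Qed.
Local Notation pp := proj_idem.

(* The off-diagonal antihermitian operator with the same lower left block as [X];
   only finite rank operators have an adjoint for the L2 product, whence [dg]. *)
Definition offdiag (X : B) : B := Q * X * P - dg (Q * X * P).

Lemma corner_adj X : adj (Q * X * P) (dg (Q * X * P)).
Proof. by have := dg_adj (Q * X * P); rewrite -[_ * P * P]mulrA pp. Qed.

(** By uniqueness of adjoints: the adjoint of a lower left block is an upper right block. *)
Lemma dg_corner X : dg (Q * X * P) = P * dg (Q * X * P) * Q.
Proof.
apply: (adj_uniq (corner_adj X)).
have := adjM coproj_adj (adjM (corner_adj X) proj_adj).
by rewrite -[_ * P * P]mulrA pp !mulrA (mulqq pp).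
Qed.

Lemma mulp_offdiag X : P * offdiag X = - dg (Q * X * P).
Proof.
rewrite mulrBr !mulrA (mulpq pp) !mul0r sub0r; congr (- _).
by rewrite dg_corner !mulrA pp.
Qed.

Lemma mul_offdiagp X : offdiag X * P = Q * X * P.
Proof.
by rewrite mulrBl -[_ * P * P]mulrA pp dg_corner -[_ * Q * P]mulrA (mulqp pp) mulr0 subr0.
Qed.

Lemma offdiag_codiag X : offdiag X * P + P * offdiag X = offdiag X.
Proof. by rewrite mul_offdiagp mulp_offdiag. Qed.

Lemma corner_offdiag X : Q * offdiag X * P = Q * X * P.
Proof. by rewrite -mulrA mul_offdiagp !mulrA (mulqq pp). Qed.

Lemma offdiag_idem X : offdiag (offdiag X) = offdiag X.
Proof. by rewrite {1}/offdiag corner_offdiag. Qed.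

Lemma offdiag_adj X : adj (offdiag X) (- offdiag X).
Proof.
rewrite opprB; apply: adjB; first exact: corner_adj.
exact: adj_sym (corner_adj X).
Qed.

Lemma corner_lin (r : R) X Y : Q * (r *: X + Y) * P = r *: (Q * X * P) + Q * Y * P.
Proof. by rewrite mulrDr mulrDl bop_scaleAr bop_scaleAl. Qed.

Lemma corner_le X : `|Q * X * P| <= `|Q| * `|P| * `|X|.
Proof.
apply: le_trans (norm_bopM _ _) _; rewrite mulrAC ler_wpM2r//; exact: norm_bopM.
Qed.

Lemma offdiag_lin (r : R) X Y : offdiag (r *: X + Y) = r *: offdiag X + offdiag Y.
Proof. by rewrite /offdiag corner_lin dg_lin scalerBr opprD addrACA. Qed.

Lemma offdiag_le X : `|offdiag X| <= (1 + c) * (`|Q| * `|P|) * `|X|.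
Proof.
rewrite -mulrA mulrDl mul1r /offdiag; apply: le_trans (ler_normB _ _) _.
apply: lerD; first exact: corner_le.
by apply: le_trans (dg_le _) _; apply: ler_wpM2l => //; exact: corner_le.
Qed.

Lemma offdiag_eq_corner X Y : Q * X * P = Q * Y * P -> offdiag X = offdiag Y.
Proof. by rewrite /offdiag => ->. Qed.

Lemma offdiag_comm X : offdiag (X * P - P * X) = offdiag X.
Proof.
apply: offdiag_eq_corner.
by rewrite mulrBr mulrBl !mulrA (mulqp pp) mul0r mul0r subr0 -!mulrA pp.
Qed.

Lemma offdiag_sub_lin (r : R) X Y :
  offdiag (r *: X + Y) - (r *: X + Y) = r *: (offdiag X - X) + (offdiag Y - Y).
Proof. by rewrite offdiag_lin [r *: (offdiag X - X)]scalerBr opprD addrACA. Qed.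

(** The image of the projection [offdiag], presented as the kernel of [offdiag] - 1 so that it
    inherits completeness as a kernel; [normal] is the complement formed by the operators without
    lower left block. *)
Definition tangent := ker_of offdiag_sub_lin.
Definition normal := ker_of corner_lin.
Definition tangent_val (H : tangent) : B := ker_val H.
Definition normal_val (Y : normal) : B := ker_val Y.
Local Coercion tangent_val : tangent >-> bop.
Local Coercion normal_val : normal >-> bop.

Lemma banach_tangent : banach tangent.
Proof.
apply: (banach_ker (C := (1 + c) * (`|Q| * `|P|) + 1)) => [X|]; last exact: banach_bop.
by rewrite mulrDl mul1r; apply: le_trans (ler_normB _ _) _; rewrite lerD2r; exact: offdiag_le.
Qed.

Lemma banach_normal : banach normal.
Proof. by apply: banach_ker corner_le _; exact: banach_bop. Qed.

Lemma tangentE (H : tangent) : offdiag H = H.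
Proof. by apply/subr0_eq; exact: (ker_valP H). Qed.

Lemma tangent_codiag (H : tangent) : (H : B) * P + P * H = H.
Proof. by rewrite -tangentE offdiag_codiag. Qed.

Lemma tangent_adj (H : tangent) : adj H (- (H : B)).
Proof. by have := offdiag_adj H; rewrite tangentE. Qed.

Lemma normalE (Y : normal) : Q * Y * P = 0. Proof. exact: (ker_valP Y). Qed.

Lemma to_tangent_subproof X : offdiag (offdiag X) - offdiag X = 0.
Proof. by rewrite offdiag_idem subrr. Qed.
Definition to_tangent X : tangent := mk_ker offdiag_sub_lin (to_tangent_subproof X).

Lemma to_normal_subproof X : Q * (X - Q * X * P) * P = 0.
Proof. by rewrite mulrBr mulrBl !mulrA (mulqq pp) -[_ * P * P]mulrA pp subrr. Qed.
Definition to_normal X : normal := mk_ker corner_lin (to_normal_subproof X).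

Lemma to_tangent_lin (r : R) X Y : to_tangent (r *: X + Y) = r *: to_tangent X + to_tangent Y.
Proof. by apply: val_inj => /=; exact: offdiag_lin. Qed.

Lemma to_normal_lin (r : R) X Y : to_normal (r *: X + Y) = r *: to_normal X + to_normal Y.
Proof. by apply: val_inj => /=; rewrite corner_lin scalerBr opprD addrACA. Qed.

Lemma analytic_to_tangent X : analytic_diff to_tangent X to_tangent.
Proof. exact: analytic_diff_lin to_tangent_lin offdiag_le. Qed.

Lemma analytic_to_normal X : analytic_diff to_normal X to_normal.
Proof.
apply: (analytic_diff_lin (C := 1 + `|Q| * `|P|)) => [|Y]; first exact: to_normal_lin.
by rewrite ker_normE mulrDl mul1r; apply: le_trans (ler_normB _ _) _; rewrite lerD2l; exact: corner_le.
Qed.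

Lemma analytic_tangent_val (H : tangent) : analytic_diff tangent_val H tangent_val.
Proof. by apply: (analytic_diff_lin (C := 1)) => // X; rewrite mul1r. Qed.

Lemma analytic_normal_val (Y : normal) : analytic_diff normal_val Y normal_val.
Proof. by apply: (analytic_diff_lin (C := 1)) => // X; rewrite mul1r. Qed.

Lemma tangentK (H : tangent) : to_tangent H = H.
Proof. by apply: val_inj; exact: tangentE. Qed.

(** The lower left block of T V, with V the inverse of [block_diag], is Q T P (P T P)^-1;
    [to_tangent] completes it to an antihermitian operator. *)
Definition slope (T : B) : tangent := to_tangent (T * inv_bop (block_diag P T)).
Definition graph (H : tangent) : B := (1 + (H : B)) * P * inv_bop (1 + (H : B)).
Definition chart_fun (T : B) : tangent * normal := (slope T, to_normal (T - graph (slope T))).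
Definition chart_fun_inv (u : tangent * normal) : B :=
  graph u.1 + (u.2 : B) + (u.1 : B) * P * (u.2 : B) * P.
(** Not a ball: the open set where the values of [inv_bop] in [slope] and [graph] are genuine
    inverses. *)
Definition chart_ball : set B :=
  [set T | invb (block_diag P T) /\ invb (1 + (slope T : B))].

Lemma analytic_block_diag T : exists L, analytic_diff (block_diag P) T L.
Proof.
eexists; apply: analytic_diff_add.
  apply: analytic_diff_mul (analytic_diff_cst _ _).
  by apply: analytic_diff_mul (analytic_diff_cst _ _) (analytic_diff_id _).
apply: analytic_diff_mul (analytic_diff_cst _ _).
apply: analytic_diff_mul (analytic_diff_cst _ _) _.
exact: analytic_diff_sub (analytic_diff_cst _ _) (analytic_diff_id _).
Qed.

Lemma analytic_slope T : invb (block_diag P T) -> exists K, analytic_diff slope T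
  (fun X => to_tangent (T * K X + X * inv_bop (block_diag P T))).
Proof.
move=> iD; have [L dL] := analytic_block_diag T.
have dI := analytic_diff_comp dL (analytic_diff_inv iD).
have dM := analytic_diff_mul (analytic_diff_id T) dI.
by eexists; exact: (analytic_diff_comp dM (analytic_to_tangent _)).
Qed.

(** At P the block diagonal part is 1, and the variation of its inverse enters as P times an
    operator, which Q on the left kills. *)
Lemma analytic_slope_base : analytic_diff slope P to_tangent.
Proof.
have D1 := block_diag1 pp.
have [|K dK] := analytic_slope (T := P); first by rewrite D1; exact: invb1.
apply: analytic_diff_eq dK => X; apply: val_inj; apply: offdiag_eq_corner.
by rewrite D1 inv_bop1 mulr1 mulrDr mulrDl [Q * (P * _)]mulrA (mulqp pp) !mul0r add0r.
Qed.

Lemma analytic_graph (H : tangent) : invb (1 + (H : B)) -> exists L, analytic_diff graph H L.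
Proof.
move=> iS.
have dS := analytic_diff_add (analytic_diff_cst (1 : B) H) (analytic_tangent_val H).
have dI := analytic_diff_comp dS (analytic_diff_inv iS).
have dSP := analytic_diff_mul dS (analytic_diff_cst P H).
by eexists; exact: (analytic_diff_mul dSP dI).
Qed.

Lemma analytic_chart_fun T : chart_ball T -> exists L, analytic_diff chart_fun T L.
Proof.
move=> [iD iS]; have [L dL] := analytic_slope iD; have [K dK] := analytic_graph iS.
have dG := analytic_diff_comp dL dK.
have dN := analytic_diff_comp (analytic_diff_sub (analytic_diff_id T) dG) (analytic_to_normal _).
by eexists; exact: (analytic_diff_pair dL dN).
Qed.

Lemma analytic_chart_fun_inv (u : tangent * normal) : invb (1 + (u.1 : B)) ->
  exists L, analytic_diff chart_fun_inv u L.
Proof.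
move=> iS; have [L dL] := analytic_graph iS.
have dG := analytic_diff_comp (analytic_diff_fst u) dL.
have d1 := analytic_diff_comp (analytic_diff_fst u) (analytic_tangent_val u.1).
have d2 := analytic_diff_comp (analytic_diff_snd u) (analytic_normal_val u.2).
have dP := analytic_diff_cst P u.
have dM := analytic_diff_mul (analytic_diff_mul (analytic_diff_mul d1 dP) d2) dP.
by eexists; exact: (analytic_diff_add (analytic_diff_add dG d2) dM).
Qed.

Lemma slope_valE T : (slope T : B) =
  Q * (T * inv_bop (block_diag P T)) * P - dg (Q * (T * inv_bop (block_diag P T)) * P).
Proof. by []. Qed.

Lemma corner_slopeE T : Q * (T * inv_bop (block_diag P T)) * P = (slope T : B) * P.
Proof. by rewrite [RHS]mul_offdiagp. Qed.

(** For symmetric T the block diagonal part and its inverse V are symmetric, so the adjoint term of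
    the slope is V P T Q by uniqueness of adjoints; this is the H of [idempotent_graph]. *)
Lemma grassmannian_graph T : grassmannian N T -> chart_ball T -> T = graph (slope T).
Proof.
move=> [_ TT sT] [iD iS]; have [VD DV] := inv_bopP iD; have [IS SI] := inv_bopP iS.
have aD : adj (block_diag P T) (block_diag P T).
  have := adjD (adjM proj_adj (adjM sT proj_adj))
    (adjM coproj_adj (adjM (adjB (@adj1 R) sT) coproj_adj)).
  by rewrite /block_diag !mulrA.
have aV := adjV aD iD iD; have pV := block_diagC pp VD DV.
have E : (slope T : B) = Q * T * P * inv_bop (block_diag P T) -
    inv_bop (block_diag P T) * P * T * Q.
  rewrite slope_valE; congr (_ - _); first by rewrite -!mulrA pV.
  apply: (adj_uniq (corner_adj _)).
  have := adjM coproj_adj (adjM (adjM sT aV) proj_adj).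
  by rewrite !mulrA pV.
rewrite /graph; have := idempotent_graph pp TT VD DV; rewrite -E => <-.
by rewrite -mulrA SI mulr1.
Qed.

(** Symmetry: the adjoint of (1 + H) P (1 + H)^-1 is (1 - H)^-1 P (1 - H), and the two agree because
    (1 - H) (1 + H) commutes with P. *)
Lemma graph_grassmannian (H : tangent) : invb (1 + (H : B)) -> grassmannian N (graph H).
Proof.
move=> iS; have [IS SI] := inv_bopP iS; have Hp := tangent_codiag H.
split; first by case: hP => rP _ _; exact: has_rank_conj.
  exact: (graph_idem pp IS).
have iS' : is_inverse ((P - Q) * inv_bop (1 + (H : B)) * (P - Q)) (1 - (H : B)).
  rewrite -(reflect_graph pp Hp); split; rewrite !mulrA.
    rewrite -[_ * (P - Q) * (P - Q)]mulrA (reflectK pp) mulr1 -[_ * _ * (1 + _)]mulrA IS mulr1.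
    exact: (reflectK pp).
  rewrite -[_ * (P - Q) * (P - Q)]mulrA (reflectK pp) mulr1 -[_ * _ * inv_bop _]mulrA SI mulr1.
  exact: (reflectK pp).
have iS2 : invb (1 - (H : B)) by eexists; exact: iS'.
have aS : adj (1 + (H : B)) (1 - (H : B)) by apply: adjD; [exact: adj1|exact: tangent_adj].
have [_ SI'] := inv_bopP iS2; have [IS' _] := inv_bopP iS2.
have E : graph H = inv_bop (1 - (H : B)) * (P * (1 - (H : B))).
  rewrite /graph -[LHS]mul1r -{1}IS' -!mulrA; congr (_ * _).
  rewrite !mulrA -(graph_comm Hp) -!mulrA SI mulr1//.
move=> u v; rewrite {2}E.
exact: (adjM (adjM aS proj_adj) (adjV aS iS iS2)).
Qed.

Lemma chart_funK T : chart_ball T -> chart_fun_inv (chart_fun T) = T.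
Proof.
move=> [iD iS]; have [VD DV] := inv_bopP iD; have [IS SI] := inv_bopP iS.
exact: (graph_chartK pp _ (tangent_codiag (slope T)) VD (corner_slopeE T)).
Qed.

Lemma chart_fun_invK (u : tangent * normal) : invb (1 + (u.1 : B)) ->
  invb (block_diag P (chart_fun_inv u)) ->
  chart_ball (chart_fun_inv u) /\ chart_fun (chart_fun_inv u) = u.
Proof.
case: u => H Y iS iD; have [VD DV] := inv_bopP iD; have [IS SI] := inv_bopP iS.
have Hp := tangent_codiag H.
have sH : slope (chart_fun_inv (H, Y)) = H.
  rewrite -[RHS]tangentK; apply: val_inj; apply: offdiag_eq_corner.
  rewrite -[RHS]mulrA (corner_slope pp VD DV (graph_corner pp _ Hp (normalE Y))).
  by rewrite mulrA (graph_qHp pp Hp).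
split; first by split=> //; rewrite sH.
rewrite /chart_fun sH; congr (_, _); apply: val_inj.
have := graph_normal pp Hp (normalE Y); rewrite /= /chart_fun_inv /=.
by rewrite -[graph H + _ + _]addrA [graph H + _]addrC addrK.
Qed.

Lemma slope_base : slope P = 0.
Proof.
apply: val_inj; rewrite -[LHS]/(offdiag _) -[RHS]/(0 : B) /offdiag.
rewrite [Q * _]mulrA (mulqp pp) !mul0r sub0r.
by have := dg_lin (-1) 0 0; rewrite scaler0 addr0 scaleN1r addNr => ->; rewrite oppr0.
Qed.

Lemma chart_ball_base : chart_ball P.
Proof.
split; first by rewrite block_diag1 ?pp//; exact: invb1.
by rewrite slope_base -[(0 : tangent) : B]/(0 : B) addr0; exact: invb1.
Qed.

Lemma open_chart_ball : open chart_ball.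
Proof.
rewrite openE => T [iD iS]; rewrite /interior.
have [L /analytic_diff_continuous cD] := analytic_block_diag T.
have [K /analytic_diff_continuous cS] := analytic_slope iD.
have cT := analytic_diff_continuous (analytic_diff_add (analytic_diff_cst (1 : B) _)
   (analytic_tangent_val (slope T))).
apply: filterI.
  exact: (cD _ (open_nbhs_nbhs (conj (@open_invb R) iD))).
exact: (cS _ (cT _ (open_nbhs_nbhs (conj (@open_invb R) iS)))).
Qed.

(** The explicit inverse gives openness: near a point of the image the two operators to be inverted
    remain invertible, and there every u is the image of [chart_fun_inv u]. *)
Lemma chart_cod_open : open (chart_fun @` chart_ball).
Proof.
rewrite openE => _ [T WT <-]; rewrite /interior; have [iD iS] := WT.
have [L /analytic_diff_continuous cD] := analytic_block_diag (chart_fun_inv (chart_fun T)).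
have [K /analytic_diff_continuous cI] := analytic_chart_fun_inv (u := chart_fun T) iS.
have cS := analytic_diff_continuous (analytic_diff_add (analytic_diff_cst (1 : B) _)
   (analytic_diff_comp (analytic_diff_fst (chart_fun T)) (analytic_tangent_val (chart_fun T).1))).
have n1 : nbhs (chart_fun T) [set u | invb (1 + tangent_val u.1)].
  exact: (cS _ (open_nbhs_nbhs (conj (@open_invb R) iS))).
have n2 : nbhs (chart_fun T) [set u | invb (block_diag P (chart_fun_inv u))].
  by apply: (cI _ (cD _ (open_nbhs_nbhs (conj (@open_invb R) _)))); rewrite chart_funK.
by apply: filterS2 n1 n2 => u i1 i2; exists (chart_fun_inv u); case: (chart_fun_invK i1 i2).
Qed.

Lemma chart_diffeo : analytic_diffeo chart_ball chart_fun chart_fun_inv.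
Proof.
split; [exact: open_chart_ball|exact: chart_cod_open| | |].
- by move=> T; rewrite inE; exact: chart_funK.
- by move=> T /analytic_chart_fun[L]; exact: analytic_diff_at.
- by move=> _ [T [iD iS] <-]; have [L] := analytic_chart_fun_inv (u := chart_fun T) iS;
    exact: analytic_diff_at.
Qed.

Lemma chart_grassmannian : chart_fun @` (@grassmannian R N `&` chart_ball) =
  chart_fun @` chart_ball `&` [set u | u.2 = 0].
Proof.
apply/seteqP; split=> [_ [T [gT WT] <-]|_ [[T WT <-] /= T0]].
  split; first by exists T.
  rewrite /= -(grassmannian_graph gT WT) subrr.
  by have := to_normal_lin (-1) 0 0; rewrite scaler0 addr0 scaleN1r addNr.
exists T => //; split=> //; rewrite -(chart_funK WT) /chart_fun_inv [(chart_fun T).2]T0.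
rewrite -[(0 : normal) : B]/(0 : B) addr0 mulr0 mul0r addr0.
by apply: graph_grassmannian; case: WT.
Qed.

End GrassmannianChart.

(** Hides the construction. [L] is the derivative at P of the tangent coordinate and [j] a bounded
    right inverse with antihermitian values; the last clause lets [L] absorb the commutator in the
    differential of the orbit map. *)
Lemma grassmannian_chart (R : realType) N (P : bop R) : grassmannian N P ->
  exists (E1 E2 : normedModType R) (W : set (bop R)) (Phi : bop R -> E1 * E2)
    (Psi : E1 * E2 -> bop R),
  [/\ banach E1, banach E2, analytic_diffeo W Phi Psi,
      Phi @` (@grassmannian R N `&` W) = Phi @` W `&` [set u | u.2 = 0] & W P] /\
  exists (L : bop R -> E1) (j : E1 -> bop R),
  [/\ analytic_diff (fun T => (Phi T).1) P L,
      forall H, L (j H) = H /\ adj (j H) (- j H),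
      forall (r : R) H K, j (r *: H + K) = r *: j H + j K,
      forall H, `|j H| <= `|H| &
      forall X, L (X * P - P * X) = L X].
Proof.
move=> hP; have [dg [c c0 [dgl dgc dga]]] := finite_rank_adjoint hP.
exists (tangent P dgl), (normal P), (chart_ball hP dgl dga), (chart_fun hP dgl dga),
  (@chart_fun_inv _ P dg dgl); split.
  split; [exact: (banach_tangent (c := c))|exact: banach_normal|exact: chart_diffeo dgc _|
    exact: chart_grassmannian|exact: chart_ball_base].
exists (to_tangent hP dgl dga), (@tangent_val _ P dg dgl); split=> [|H||H|X] //.
- exact: analytic_slope_base dgc _.
- by split; [exact: tangentK|exact: (tangent_adj hP dga)].
- by apply: val_inj; exact: (offdiag_comm hP).
Qed.

(** * The homogeneous space *)

Section Submanifolds.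
Variables (R : realType) (E : normedModType R) (M : set E).

Lemma analytic_inl (F G : normedModType R) (x : F) :
  analytic_diff (fun u : F => (u, 0 : G)) x (fun u => (u, 0)).
Proof. exact: analytic_diff_pair (analytic_diff_id x) (analytic_diff_cst 0 x). Qed.

Lemma pair_eta_snd0 (F G : normedModType R) (p : F * G) : p.2 = 0 -> (p.1, 0) = p.
Proof. by case: p => a b /= ->. Qed.

Section FlatChart.
Variables (E1 E2 : normedModType R) (W : set E) (Phi : E -> E1 * E2) (Psi : E1 * E2 -> E).
Hypothesis (dPhi : analytic_diffeo W Phi Psi).
Hypothesis (flat : Phi @` (M `&` W) = Phi @` W `&` [set p | p.2 = 0]).

Lemma flat_snd T : M T -> W T -> (Phi T).2 = 0.
Proof.
move=> MT WT; have : (Phi @` (M `&` W)) (Phi T) by exists T.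
by rewrite flat => -[].
Qed.

Lemma flat_pair T : M T -> W T -> ((Phi T).1, 0) = Phi T.
Proof. by move=> MT WT; apply/pair_eta_snd0/flat_snd. Qed.

Lemma flatK T : W T -> Psi (Phi T) = T.
Proof. by case: dPhi => _ _ K _ _ WT; apply: K; rewrite inE. Qed.

Lemma flat_cod : (fun T => (Phi T).1) @` (M `&` W) = [set u | (Phi @` W) (u, 0)].
Proof.
apply/seteqP; split=> [_ [T [MT WT] <-]|u Wu].
  by exists T => //; rewrite flat_pair.
have : (Phi @` (M `&` W)) (u, 0) by rewrite flat.
by move=> [T MWT Tu]; exists T => //; rewrite Tu.
Qed.

Lemma flat_inv_analytic u : (Phi @` W) (u, 0) ->
  exists L, analytic_diff (fun u => Psi (u, 0)) u L.
Proof.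
case: dPhi => _ _ _ _ aPsi /aPsi/analytic_at_diff[L dL].
by eexists; exact: (analytic_diff_comp (analytic_inl E2 u) dL).
Qed.

Lemma flat_chart : is_chart M
  (@Chart R E E1 (M `&` W) (fun y => (Phi y).1) (fun u => Psi (u, 0))).
Proof.
have [oW oPhi K aPhi aPsi] := dPhi; split=> /=.
- by exists W.
- rewrite /chart_cod /= flat_cod openE => u uW; rewrite /interior.
  have := analytic_diff_continuous (analytic_inl E2 u).
  by apply; exact: open_nbhs_nbhs.
- by move=> T; rewrite inE => -[MT WT]; rewrite flat_pair// flatK.
- apply: continuous_in_subspaceT => T; rewrite inE => -[MT WT].
  have [L dL] := analytic_at_diff (aPhi T WT).
  exact: analytic_diff_continuous (analytic_diff_comp dL (analytic_diff_fst _)).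
- apply: continuous_in_subspaceT => u; rewrite in_setE => uW.
  have {}uW : ((fun T => (Phi T).1) @` (M `&` W)) u by exact: uW.
  rewrite flat_cod in uW.
  by have [L] := flat_inv_analytic uW; exact: analytic_diff_continuous.
Qed.

End FlatChart.

Lemma submanifold_chart c : submanifold_atlas M c -> is_chart M c /\ banach (chart_model c).
Proof.
by move=> [E1 [E2 [W [Phi [Psi [b1 b2 dPhi flat ->]]]]]]; split=> //; exact: flat_chart.
Qed.

Lemma submanifold_compatible c d : submanifold_atlas M c -> submanifold_atlas M d ->
  compatible c d.
Proof.
move=> [E1 [E2 [W [Phi [Psi [b1 b2 dPhi flat ->]]]]]].
move=> [F1 [F2 [W' [Phi' [Psi' [b1' b2' dPhi' flat' ->]]]]]].
move=> _ [T [[MT WT] [_ WT']] <-] /=.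
have uW : (Phi @` W) ((Phi T).1, 0) by rewrite (flat_pair flat)//; exists T.
have [L dL] := flat_inv_analytic dPhi uW.
have TE : Psi ((Phi T).1, 0) = T by rewrite (flat_pair flat)// (flatK dPhi).
have [_ _ _ aPhi' _] := dPhi'.
have : analytic_at Phi' (Psi ((Phi T).1, 0)) by rewrite TE; exact: aPhi'.
move=> /analytic_at_diff[L' dL'].
exact: analytic_diff_at (analytic_diff_comp (analytic_diff_comp dL dL') (analytic_diff_fst _)).
Qed.

Lemma submanifold_manifold : analytic_submanifold M ->
  analytic_manifold M (submanifold_atlas M).
Proof.
by move=> sM; split; [exact: submanifold_chart|exact: sM|exact: submanifold_compatible].
Qed.

End Submanifolds.

Lemma closed_ker (R : realType) (E F : normedModType R) (D : E -> F) :
  (forall x, {for x, continuous D}) -> closed [set x | D x = 0].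
Proof.
move=> cD; rewrite (_ : [set x | _] = (fun x => `|D x|) @^-1` [set r | r <= 0]).
  apply: closed_comp; last exact: closed_le.
  by move=> x _; apply: continuous_comp; [exact: cD|exact: norm_continuous].
by apply/seteqP; split=> x /=; rewrite normr_le0 => /eqP.
Qed.

Section Splitting.
Variables (R : realType) (E F : normedModType R).

(** The complement is the image of the section s, written as the kernel of s D - 1 to make it
    visibly closed. *)
Lemma closed_complemented_split (D : E -> F) (s : F -> E) C K :
  (forall (r : R) u v, D (r *: u + v) = r *: D u + D v) ->
  (forall (r : R) u v, s (r *: u + v) = r *: s u + s v) ->
  (forall u, `|D u| <= C * `|u|) -> (forall v, `|s v| <= K * `|v|) ->
  (forall v, D (s v) = v) -> closed_complemented [set u | D u = 0].
Proof.
move=> lD ls bD bs Ds.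
have aD x := analytic_diff_lin x lD bD; have as' y := analytic_diff_lin y ls bs.
have D0 : D 0 = 0 by have := lD (-1) 0 0; rewrite scaler0 addr0 scaleN1r addNr.
have s0 : s 0 = 0 by have := ls (-1) 0 0; rewrite scaler0 addr0 scaleN1r addNr.
split; first by apply: closed_ker => x; exact: analytic_diff_continuous (aD x).
exists [set x | s (D x) - x = 0]; split.
- apply: closed_ker => x; apply: analytic_diff_continuous.
  exact: analytic_diff_sub (analytic_diff_comp (aD x) (as' (D x))) (analytic_diff_id x).
- split; first by rewrite /= D0 s0 subr0.
  by move=> r u v /subr0_eq Eu /subr0_eq Ev /=; rewrite lD ls Eu Ev subrr.
- apply/seteqP; split=> x /=; last by move=> ->; rewrite D0 s0 subr0.
  by move=> [-> /subr0_eq]; rewrite s0.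
- move=> x; exists (x - s (D x)), (s (D x)); split; last by rewrite subrK.
    by have := lD (-1) (s (D x)) x; rewrite /= scaleN1r addrC => ->; rewrite Ds scaleN1r addNr.
  by rewrite /= Ds subrr.
Qed.

End Splitting.

(** * The orbit maps and the action of the unitary group *)

Section Action.
Variables (R : realType) (N : nat).
Local Notation B := (bop R).
Local Notation G := (@unitary_group R).
Local Notation Gr := (@grassmannian R N).
Local Notation conj := (fun U P : B => U * P * inv_bop U).

(** The chart map is a choice among logarithms; at the centre [exp_bop_eq1] leaves 0 as the only
    candidate. *)
Lemma exp_chart_center (U : B) : G U ->
  chart_dom (exp_chart U) U /\ chart_map (exp_chart U) U = 0.
Proof.
move=> UU; have iU := unitary_inv UU; have [VU _] := inv_bopP iU.
have e0 : exp_bop (0 : B) = 1 by exact: exp_bop0.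
have n0 : `|0 : lie_u R| < 2^-1 by rewrite normr0 invr_gt0.
split; first by exists 0 => //; rewrite -[lie_u_val 0]/(0 : B) e0 mulr1.
apply: xget_unique.
  by split=> //; rewrite -[lie_u_val 0]/(0 : B) e0 mulr1.
move=> X [Xn UX]; apply: val_inj; apply: exp_bop_eq1 => //.
by rewrite -[LHS]mul1r -VU -mulrA -UX.
Qed.

Lemma analytic_lie_u_val (X : lie_u R) : analytic_diff (@lie_u_val R) X (@lie_u_val R).
Proof. by apply: (analytic_diff_lin (C := 1)) => // Y; rewrite mul1r. Qed.

Lemma analytic_exp_chart_inv (U : B) : analytic_diff (@chart_inv R B (exp_chart U)) 0
  (fun X : lie_u R => U * (X : B)).
Proof.
have dE := analytic_diff_comp (analytic_lie_u_val 0) (@analytic_diff_exp R).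
apply: analytic_diff_eq (analytic_diff_mul (analytic_diff_cst U _) dE) => X /=.
by rewrite mul0r addr0.
Qed.

Lemma exp_chart_inv0 (U : B) : @chart_inv R B (exp_chart U) 0 = U.
Proof. by rewrite -[LHS]/(U * exp_bop (0 : B)) exp_bop0 mulr1. Qed.

Lemma analytic_conj (E : normedModType R) (f g : E -> B) x K L :
  invb (f x) -> analytic_diff f x K -> analytic_diff g x L ->
  analytic_diff (fun y => conj (f y) (g y)) x (fun h => f x * g x *
    - (inv_bop (f x) * K h * inv_bop (f x)) + (f x * L h + K h * g x) * inv_bop (f x)).
Proof.
move=> iF dK dL; exact: (analytic_diff_mul (analytic_diff_mul dK dL)
  (analytic_diff_comp dK (analytic_diff_inv iF))).
Qed.

Lemma conj_continuous (U P : B) : invb U ->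
  {for (U, P), continuous (fun p : B * B => conj p.1 p.2)}.
Proof.
move=> iU; have d1 := analytic_diff_fst ((U, P) : B * B).
have d2 := analytic_diff_snd ((U, P) : B * B).
exact: analytic_diff_continuous (analytic_conj iU d1 d2).
Qed.

Lemma orbit_continuous (U P : B) : invb U -> {for U, continuous (fun V : B => conj V P)}.
Proof.
move=> iU; exact: analytic_diff_continuous
  (analytic_conj iU (analytic_diff_id U) (analytic_diff_cst P U)).
Qed.


Lemma grassmannian_submanifold : analytic_submanifold Gr.
Proof.
move=> P gP; have [E1 [E2 [W [Phi [Psi [[b1 b2 dP fP WP] _]]]]]] := grassmannian_chart gP.
by eexists; split; first by exists E1, E2, W, Phi, Psi.
Qed.

Lemma conj_lie_subproof (U X : B) : G U -> adj X (- X) ->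
  inv_bop U * X * U \in @antihermitian R.
Proof.
move=> /unitaryP[iU aU] aX; apply/antihermitianP.
have := adjM (adjM (adj_sym aU) aX) aU.
by rewrite mulNr mulrN mulrA.
Qed.

Lemma orbit_submersion_at (P U : B) : Gr P -> G U ->
  exists d, [/\ submanifold_atlas Gr d, chart_dom d (conj U P) &
    exists D, [/\ analytic_diff (@local_rep R B B (exp_chart U) d (conj^~ P))
        (chart_map (exp_chart U) U) D,
      forall v, exists u, D u = v & closed_complemented [set u | D u = 0]]].
Proof.
move=> gP UU; have iU := unitary_inv UU; have gP' := grassmannian_conj UU gP.
have [VU UV] := inv_bopP iU.
have [E1 [E2 [W [Phi [Psi [[b1 b2 dP fP WP] [L [j [dL Lj lj nj LX]]]]]]]]] :=
  grassmannian_chart gP'.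
eexists; split; first by exists E1, E2, W, Phi, Psi.
  by split.
have [lL [C C0 LC]] := analytic_diff_bounded dL.
pose D (X : lie_u R) : E1 := L (U * (X : B) * inv_bop U).
(* Conjugation by U turns the section [j], antihermitian at the point U P U^-1, into a section with
   values in the Lie algebra. *)
pose s (H : E1) : lie_u R := LieU (conj_lie_subproof UU (Lj H).2).
have Ds H : D (s H) = H.
  by rewrite /D /= !mulrA UV mul1r -mulrA UV mulr1 (Lj H).1.
have lD (r : R) X Y : D (r *: X + Y) = r *: D X + D Y.
  rewrite /D -lL; congr L; rewrite -[lie_u_val (_ + _)]/(r *: (X : B) + (Y : B)).
  by rewrite mulrDr mulrDl bop_scaleAr bop_scaleAl.
have ls (r : R) H K : s (r *: H + K) = r *: s H + s K.
  apply: val_inj; rewrite -[RHS]/(r *: (s H : B) + (s K : B)) /= lj.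
  by rewrite mulrDr mulrDl bop_scaleAr bop_scaleAl.
exists D; split; last 1 first.
- apply: (closed_complemented_split (C := C * (`|U| * `|inv_bop U|))
    (K := `|inv_bop U| * `|U|)) lD ls _ _ Ds => [X|H].
    apply: le_trans (LC _) _; rewrite -[leRHS]mulrA ler_wpM2l//.
    apply: le_trans (norm_bopM _ _) _; rewrite [leRHS]mulrAC ler_wpM2r//; exact: norm_bopM.
  rewrite -[`|s H|]/(`|inv_bop U * j H * U|).
  apply: le_trans (norm_bopM _ _) _; rewrite [leRHS]mulrAC ler_wpM2r//.
  by apply: le_trans (norm_bopM _ _) _; rewrite ler_wpM2l.
- rewrite (exp_chart_center UU).2.
  have dI := analytic_exp_chart_inv U.
  have iI : invb (@chart_inv R B (exp_chart U) 0) by rewrite exp_chart_inv0.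
  have dF := analytic_conj iI dI (analytic_diff_cst P (0 : lie_u R)).
  have dL' : analytic_diff (fun T => (Phi T).1) (conj (@chart_inv R B (exp_chart U) 0) P) L.
    by rewrite exp_chart_inv0.
  apply: analytic_diff_eq (analytic_diff_comp dF dL') => X /=.
  rewrite -[U * exp_bop (lie_u_val 0)]/(@chart_inv R B (exp_chart U) 0) exp_chart_inv0.
  (* With Z = U X U^-1, the differential of the orbit map is the commutator of Z with U P U^-1, on
     which [L] takes the same value as on Z. *)
  rewrite /D -[RHS]LX mulr0 add0r addrC mulrN !mulrA; congr L; congr (_ - _).
  by rewrite -[U * X * inv_bop U * U]mulrA VU mulr1.
- by move=> v; exists (s v).
Qed.

Lemma orbit_submersion (P : B) : Gr P ->
  submersion G (@unitary_atlas R) Gr (submanifold_atlas Gr) (conj^~ P).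
Proof.
move=> gP; split; first split.
- by move=> U UU; exact: grassmannian_conj.
- apply: continuous_in_subspaceT => U; rewrite in_setE => UU.
  exact: orbit_continuous (unitary_inv UU).
- move=> U UU; have [d [Ad Ud [D [dD _ _]]]] := orbit_submersion_at gP UU.
  exists (exp_chart U), d; split=> //; first by exists U.
    exact: (exp_chart_center UU).1.
  exact: analytic_diff_at dD.
move=> U UU; have [d [Ad Ud [D [dD sD kD]]]] := orbit_submersion_at gP UU.
exists (exp_chart U), d; split=> //; first by exists U.
  exact: (exp_chart_center UU).1.
have -> : ('d (@local_rep R B B (exp_chart U) d (conj^~ P))
    (chart_map (exp_chart U) U) : _ -> _) = D.
  by apply/funext => X; exact: analytic_diff_diff.
by split.
Qed.

Lemma action_analytic : analytic_map (G `*` Gr)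
  (prod_atlas (@unitary_atlas R) (submanifold_atlas Gr)) Gr (submanifold_atlas Gr)
  (fun p : B * B => conj p.1 p.2).
Proof.
split.
- by move=> [U P] [/= UU gP]; exact: grassmannian_conj.
- apply: continuous_in_subspaceT => -[U P]; rewrite in_setE => -[/= UU gP].
  exact: conj_continuous (unitary_inv UU).
move=> [U P] [/= UU gP]; have gP' := grassmannian_conj UU gP.
have [E1 [E2 [W [Phi [Psi [[b1 b2 dP fP WP] _]]]]]] := grassmannian_chart gP.
have [F1 [F2 [W' [Phi' [Psi' [[b1' b2' dP' fP' WP'] _]]]]]] := grassmannian_chart gP'.
pose c := @Chart R B E1 (Gr `&` W) (fun y => (Phi y).1) (fun u => Psi (u, 0)).
pose d := @Chart R B F1 (Gr `&` W') (fun y => (Phi' y).1) (fun u => Psi' (u, 0)).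
exists (prod_chart (exp_chart U) c), d; split.
- exists (exp_chart U), c; split=> //; first by exists U.
  by exists E1, E2, W, Phi, Psi.
- by exists F1, F2, W', Phi', Psi'.
- by split; [exact: (exp_chart_center UU).1|split].
- by split.
rewrite /local_rep.
have -> : chart_map (prod_chart (exp_chart U) c) (U, P) = (0, (Phi P).1).
  by congr (_, _); exact: (exp_chart_center UU).2.
have uW : (Phi @` W) ((Phi P).1, 0) by rewrite (flat_pair fP)//; exists P.
have [K dK] := flat_inv_analytic dP uW.
have PE : Psi ((Phi P).1, 0) = P by rewrite (flat_pair fP)// (flatK dP).
pose x : lie_u R * E1 := (0, (Phi P).1).
have d1 := analytic_diff_comp (analytic_diff_fst x) (analytic_exp_chart_inv U).
have d2 := analytic_diff_comp (analytic_diff_snd x) dK.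
have iU : invb ((@chart_inv R B (exp_chart U) \o fst) x).
  by rewrite [_ x]exp_chart_inv0; exact: unitary_inv.
have dF := analytic_conj iU d1 d2.
have [_ _ _ aP' _] := dP'.
have : analytic_at Phi' (conj ((@chart_inv R B (exp_chart U) \o fst) x)
    (((fun u => Psi (u, 0)) \o snd) x)).
  rewrite [(_ \o fst) x]exp_chart_inv0 [(_ \o snd) x]PE; exact: aP'.
move=> /analytic_at_diff[L' dL'].
exact: analytic_diff_at (analytic_diff_comp (analytic_diff_comp dF dL') (analytic_diff_fst _)).
Qed.

Lemma grassmannian_homogeneous : homogeneous_space G
  (fun U V : B => U * V) (1 : B) (@unitary_atlas R) Gr (submanifold_atlas Gr) conj.
Proof.
split.
- exact: submanifold_manifold grassmannian_submanifold.
- split=> [U P UU|P _|U V P /unitary_inv iU /unitary_inv iV _].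
  + exact: grassmannian_conj.
  + by rewrite inv_bop1 mul1r mulr1.
  + by rewrite inv_bopM// !mulrA.
- by move=> P Q gP gQ; have [U UU <-] := grassmannian_transitive gP gQ; exists U.
- exact: action_analytic.
- by move=> P; exact: orbit_submersion.
Qed.

End Action.

Theorem theorem4p8 (R : realType) (N : nat) (P : bop R)
    (hP : grassmannian N P) :
  [/\ submersion (@unitary_group R) (@unitary_atlas R)
        (@grassmannian R N) (submanifold_atlas (@grassmannian R N))
        (fun U : bop R => U * P * inv_bop U),
      homogeneous_space (@unitary_group R)
        (fun U V : bop R => U * V) (1 : bop R) (@unitary_atlas R)
        (@grassmannian R N) (submanifold_atlas (@grassmannian R N))
        (fun U Q : bop R => U * Q * inv_bop U) &
      analytic_submanifold (@grassmannian R N)].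
Proof.
by split; [exact: orbit_submersion|exact: grassmannian_homogeneous|
  exact: grassmannian_submanifold].
Qed.
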